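(* Let $\Delta\subseteq\mathbb{R}^2$ be a finite simplicial complex homeomorphic to a disk, and let $\mathbf r=\{r_\tau : \tau\in\Delta_1^\circ\}$ and $\mathbf s=\{s_\gamma : \gamma\in\Delta_0\}$ be families of non-negative integers. Then for every integer $d\ge 0$ $$\dim \mathcal S_d^{\mathbf r,\mathbf s}(\Delta)\ \ge\ \binom{d+2}{2}+\sum_{\tau\in\Delta_1^\circ}\dim J(\tau)_d-\sum_{\gamma\in\Delta_0^\circ}\dim \overline J(\gamma)_d ,$$ and equality holds for all sufficiently large $d$.
   Context: $\Delta_i$ is the set of $i$-dimensional faces of $\Delta$ and $\Delta_i^\circ$ the subset of interior ones (those not contained in the boundary of $\Delta$). All dimensions are over $\mathbb R$, and a subscript $d$ on a graded object denotes its degree $d$ part. $S=\mathbb{R}[x,y,z]$ with the standard grading. $\mathcal S_d^{\mathbf r,\mathbf s}(\Delta)$ is the real vector space of continuous functions $f$ on $\Delta$ such that: on each triangle $\sigma\in\Delta_2$, $f|_\sigma$ is a polynomial of total degree at most $d$; for each interior edge $\tau$, $f$ is $C^{r_\tau}$ on the union of the two triangles containing $\tau$; and for each vertex $\gamma\in\Delta_0$, the polynomials $f|_\sigma$, for all triangles $\sigma$ containing $\gamma$, have the same partial derivatives at $\gamma$ up to order $s_\gamma$. Embed $\mathbb R^2$ in $\mathbb R^3$ as the plane $z=1$. For a face $\beta$ of $\Delta$, $\hat\beta\subset\mathbb R^3$ is the convex hull of the origin and the image of $\beta$. For an edge $\tau$, $\ell_\tau\in S$ is a nonzero linear form vanishing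 on $\hat\tau$. For a vertex $\gamma$, $\hat{\mathfrak m}_\gamma\subset S$ is the ideal of polynomials vanishing on the line through $\hat\gamma$ (generated by two independent linear forms). For an interior edge $\tau=[\gamma,\gamma']$, $$J(\tau)=\langle \ell_\tau^{r_\tau+1}\rangle\cap\hat{\mathfrak m}_\gamma^{s_\gamma+1}\cap\hat{\mathfrak m}_{\gamma'}^{s_{\gamma'}+1}.$$ For an interior vertex $\gamma$, $$\overline J(\gamma)=\sum_{\tau\in\Delta_1^\circ,\ \tau\ni\gamma}\bigl(\langle \ell_\tau^{r_\tau+1}\rangle\cap\hat{\mathfrak m}_\gamma^{s_\gamma+1}\bigr).$$ *)

(* Defs.v *)
From HB Require Import structures.
From mathcomp Require Import all_boot all_order all_algebra finmap.
From mathcomp Require Import all_classical all_reals all_analysis.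
(* The notations of mpoly clash with those of MathComp-Analysis: below,
   [mpoly n R] is {mpoly R[n]}, [meval v p] is p.@[v], [mderivm m p] is
   p^`M[m] and [ishomog1 d mdeg] is d.-homog. *)
From mathcomp Require Import -(notations) mpoly.

Set Implicit Arguments.
Unset Strict Implicit.
Unset Printing Implicit Defensive.

Import Order.TTheory GRing.Theory Num.Theory.
Import numFieldNormedType.Exports.

Local Open Scope classical_set_scope.
Local Open Scope ring_scope.

Section LinearAlgebra.
Variables (R : realType) (V : lmodType R).
Implicit Types (A W : set V).

Definition convex_hull A : set V := [set x |
  exists n (p : 'I_n -> V) (a : 'I_n -> R),
    [/\ forall i, A (p i), forall i, 0 <= a i, \sum_i a i = 1
      & x = \sum_i a i *: p i]].

Definition has_dim W (n : nat) : Prop :=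
  exists b : 'I_n -> V,
    (forall c : 'I_n -> R, \sum_i c i *: b i = 0 -> forall i, c i = 0) /\
    W = [set w | exists c : 'I_n -> R, w = \sum_i c i *: b i].

(* Junk value 0 when [W] is not a finite-dimensional subspace of [V]. *)
Definition fdim W : nat := xget 0%N [set n | has_dim W n].

End LinearAlgebra.

Section Ideals.
Variable A : comNzRingType.
Implicit Types I G : set A.

Definition ideal_gen G : set A := [set p |
  exists n (a g : 'I_n -> A),
    (forall i, G (g i)) /\ p = \sum_i a i * g i].

Definition ideal_pow I (k : nat) : set A :=
  ideal_gen [set p | exists a : 'I_k -> A, (forall i, I (a i)) /\ p = \prod_i a i].

(* The sum of the ideals [I t], for [t] in the finite set [E]. *)
Definition ideal_sum (T : choiceType) (E : {fset T}) (I : T -> set A) : set A :=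
  [set p | exists q : T -> A,
     (forall t, t \in E -> I t (q t)) /\ p = \sum_(t <- E) q t].

End Ideals.

Definition homeomorphic (T U : topologicalType) (A : set T) (B : set U) : Prop :=
  exists (f : T -> U) (g : U -> T),
    [/\ {within A, continuous f}, {within B, continuous g},
        forall x, A x -> B (f x) /\ g (f x) = x
      & forall y, B y -> A (g y) /\ f (g y) = y].

Section Plane.
Variable R : realType.
Local Notation plane := 'rV[R]_2.

Definition unit_disk : set plane :=
  [set x | x 0 0 ^+ 2 + x 0 1 ^+ 2 <= 1].

(* All partial derivatives of order at most [k] exist and are continuous at
   every point of the open set [U]. *)
Fixpoint class_C_open (k : nat) (U : set plane) (g : plane -> R) : Prop :=
  (forall x, U x -> {for x, continuous g}) /\
  (if k is k'.+1 then
     forall i : 'I_2,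
       (forall x, U x -> derivable g x (delta_mx 0 i)) /\
       class_C_open k' U (fun x => 'D_(delta_mx 0 i) g x)
   else True).

(* [f] is C^k on a set that need not be open when it coincides there with a C^k
   function defined on an open neighborhood of the set. *)
Definition class_C (k : nat) (A : set plane) (f : plane -> R) : Prop :=
  exists (U : set plane) (g : plane -> R),
    [/\ open U, A `<=` U, forall x, A x -> f x = g x & class_C_open k U g].

Implicit Types (b e t : {fset plane}) (K : {fset {fset plane}}).

(* A face is encoded by the finite set of its vertices; the face itself, as a
   subset of the plane, is [hull b]. *)
Definition hull b : set plane := convex_hull [set` b].

Definition affine_indep b : Prop :=
  forall a : plane -> R,
    \sum_(v <- b) a v = 0 -> \sum_(v <- b) a v *: v = 0 ->
    forall v, v \in b -> a v = 0.

(* The empty set is not a face. As [hull fset0] is empty, the last condition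
   says that two faces are disjoint or meet along their common face. *)
Definition simplicial_complex K : Prop :=
  [/\ fset0 \notin K,
      forall b b', b \in K -> (b' `<=` b)%fset -> b' != fset0 -> b' \in K,
      forall b, b \in K -> affine_indep b
    & forall b b', b \in K -> b' \in K ->
        hull b `&` hull b' = hull (b `&` b')%fset].

Section Complex.
Variable K : {fset {fset plane}}.

Definition carrier : set plane := [set x | exists2 b, b \in K & hull b x].

Definition boundary : set plane := closure carrier `\` carrier°.

Definition faces (i : nat) : {fset {fset plane}} :=
  [fset b in K | #|` b| == i.+1]%fset.

Definition interior_edges : {fset {fset plane}} :=
  [fset e in faces 1 | `[< ~ (hull e `<=` boundary)%classic >]]%fset.

(* Vertices are handled as points instead of singletons. *)
Definition vertices : {fset plane} := (\bigcup_(b <- faces 0) b)%fset.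

Definition interior_vertices : {fset plane} :=
  [fset v in vertices | `[< ~ boundary v >]]%fset.

Definition represents (f : plane -> R) (t : {fset plane}) (p : mpoly 2 R) : Prop :=
  forall x, hull t x -> f x = meval (fun i => x 0 i) p.

(* Only the values of [r] on interior edges and of [s] on vertices matter. *)
Variables (r : {fset plane} -> nat) (s : plane -> nat).

(* A function on the carrier is encoded by its extension by zero to the whole
   plane. *)
Definition splines (d : nat) : set (plane -> R) := [set f |
  [/\ {within carrier, continuous f} /\ (forall x, ~ carrier x -> f x = 0),
      forall t, t \in faces 2 ->
        exists2 p : mpoly 2 R, (msize p <= d.+1)%N & represents f t p,
      forall e t t', e \in interior_edges -> t \in faces 2 -> t' \in faces 2 ->
        t != t' -> (e `<=` t)%fset -> (e `<=` t')%fset ->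
        class_C (r e) (hull t `|` hull t') f
    & forall v t t', v \in vertices -> t \in faces 2 -> t' \in faces 2 ->
        v \in t -> v \in t' ->
        forall p p' : mpoly 2 R, represents f t p -> represents f t' p' ->
        forall m : multinom 2, (mdeg m <= s v)%N ->
          meval (fun i => v 0 i) (mderivm m p) =
          meval (fun i => v 0 i) (mderivm m p')]].

End Complex.

Local Notation S := (mpoly 3 R).

Definition embed (x : plane) : 'rV[R]_3 := row_mx x (const_mx 1 : 'rV[R]_1).

Definition cone b : set 'rV[R]_3 := convex_hull (0 |` (embed @` hull b)).

Definition vanishes_on (p : S) (A : set 'rV[R]_3) : Prop :=
  forall x, A x -> meval (fun i => x 0 i) p = 0.

Definition edge_form e (l : S) : Prop :=
  [/\ l \is ishomog1 1 mdeg, l != 0 & vanishes_on l (cone e)].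

Definition vertex_ideal (v : plane) : set S := [set p |
  vanishes_on p [set c *: x | c in [set: R] & x in cone [fset v]%fset]].

Definition degree_part (I : set S) (d : nat) : set S :=
  I `&` [set p | p \is ishomog1 d mdeg].

Section EdgeIdeals.
Variables (r : {fset plane} -> nat) (s : plane -> nat).
Variable ell : {fset plane} -> S.

Definition edge_ideal e : set S :=
  ideal_gen [set ell e ^+ (r e).+1].

Definition J_edge e : set S :=
  edge_ideal e `&`
  [set p | forall v, v \in e -> ideal_pow (vertex_ideal v) (s v).+1 p].

Definition J_vertex K (v : plane) : set S :=
  ideal_sum [fset e in interior_edges K | v \in e]%fset
    (fun e => edge_ideal e `&` ideal_pow (vertex_ideal v) (s v).+1).

End EdgeIdeals.

End Plane.

(* Main.v *)
(** After homogenization, a spline of degree at most d is a family of forms of degree d,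
one for each triangle, whose difference across every interior edge e lies in J(e).  Taking
signed differences across the interior edges is a linear map whose kernel consists of the
constant families, of dimension 'C(d + 2, 2); the differences around an interior vertex add
up to 0.  Conversely, any family of elements of the J(e)_d that adds up to 0 around
every interior vertex comes from a spline, because the complex is homeomorphic to a disk:
around one vertex this is a duality argument in the star of the vertex, and the increments
of the local solutions form a cocycle on the pairs of triangles that meet, which becomes a
coboundary once it is integrated along the segments starting at the centre of the disk.  Hence the dimension
of the splines is 'C(d + 2, 2) plus the sum of the dim J(e)_d minus the dimension of the image
of the boundary map from the sum of the J(e)_d to the sum of the J(v)_d over interior vertices.

This boundary map is onto in large degree.  The polynomials that, placed at the vertex v, are
a boundary form an ideal.  An element of J(e) can be moved from one end of e to the other, and
it disappears at a boundary vertex, so the ideal contains the product of high powers of the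
forms of the edges of any path from v to the boundary.  Given a linear form x vanishing at v
and a set T of edges, either x is spanned by the forms of T or the forms of T vanish at
a point P with x(P) <> 0, and then some path to the boundary uses only edges whose forms do
not vanish at P.  By descending induction on T some power of x lies in the ideal enlarged by
the forms of T, and finally in the ideal itself.  In degree d large, a monomial in the
coordinates attached to an edge is divisible by such a power at one of the two ends. *)

Require Import Defs.
From HB Require Import structures.
From mathcomp Require Import all_boot all_order all_algebra finmap.
From mathcomp Require Import all_classical all_reals all_analysis.
From mathcomp Require Import -(notations) mpoly.
From mathcomp Require Import ring lra zify.

Set Implicit Arguments.
Unset Strict Implicit.
Unset Printing Implicit Defensive.

Import Order.TTheory GRing.Theory Num.Theory.
Import numFieldNormedType.Exports.

Local Open Scope classical_set_scope.
Local Open Scope ring_scope.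

(** * Finite-dimensional spaces *)

(** The disk hypothesis is a bare homeomorphism and says nothing about faces, so all combinatorial
    consequences are drawn from the topology of the round disk. It has no isolated point, and near
    each of its points it stays connected when that point is removed; hence the carrier cannot be
    cut locally at a point, which forces every face into a triangle and links the triangles at a
    vertex through common edges. It is also compact and star-shaped, so a cocycle on its overlapping
    cells has a primitive, obtained without homology.

    On the algebraic side, smoothness across an edge, agreement at a vertex and the ideals of edges
    and vertices are all read in linear coordinates in which the edge form becomes a variable and
    the lines over the ends become axes. Each condition then says that the monomials of low weight
    are absent. This gives the equivalence between splines and families of forms, and also shows
    that the ideals are homogeneous. *)

Section Dimension.
Variable R : realType.

(** Writing each basis in terms of the other gives two matrices whose product is the identity of
    size [m]; its rank is at most [n]. *)
Lemma has_dim_le (V : lmodType R) (W : set V) m n :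
  has_dim W m -> has_dim W n -> (m <= n)%N.
Proof.
move=> [b [bfree Wb]] [b' [b'free Wb']].
have bW i : W (b i).
  rewrite Wb; exists (fun j => (j == i)%:R).
  rewrite (bigD1 i)//= eqxx scale1r big1 ?addr0// => j /negPf ->.
  by rewrite scale0r.
have /choice[M Mb] : forall i, exists c : 'I_n -> R, b i = \sum_j c j *: b' j.
  by move=> i; move: (bW i); rewrite Wb'.
have b'W i : W (b' i).
  rewrite Wb'; exists (fun j => (j == i)%:R).
  rewrite (bigD1 i)//= eqxx scale1r big1 ?addr0// => j /negPf ->.
  by rewrite scale0r.
have /choice[N Nb] : forall i, exists c : 'I_m -> R, b' i = \sum_j c j *: b j.
  by move=> i; move: (b'W i); rewrite Wb.
have : (\matrix_(i, j) M i j) *m (\matrix_(i, j) N i j) = 1%:M :> 'M[R]_m.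
  apply/matrixP => i k; rewrite !mxE.
  under eq_bigr do rewrite !mxE.
  apply/eqP; rewrite -subr_eq0; apply/eqP.
  move: k; apply: (bfree (fun k => \sum_j M i j * N j k - (i == k)%:R)).
  under eq_bigr do rewrite scalerBl.
  rewrite sumrB [X in _ - X](bigD1 i)//= eqxx scale1r.
  rewrite [X in _ - (_ + X)]big1 ?addr0; last first.
    by move=> j /negPf; rewrite eq_sym => ->; rewrite scale0r.
  apply/eqP; rewrite subr_eq0; apply/eqP.
  under eq_bigr do rewrite scaler_suml.
  rewrite exchange_big/= Mb; apply: eq_bigr => j _.
  by rewrite Nb scaler_sumr; apply: eq_bigr => k _; rewrite scalerA.
by move/mulmx1_min.
Qed.

Lemma fdimE (V : lmodType R) (W : set V) n : has_dim W n -> fdim W = n.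
Proof.
move=> Wn; apply: xget_unique => // m Wm.
by apply/eqP; rewrite eqn_leq (has_dim_le Wm Wn) (has_dim_le Wn Wm).
Qed.

(** Splines and polynomials live in spaces of infinite dimension; their subspaces are measured by
    parametrizing them injectively from a [vectType]. *)
Lemma fdim_image (vT : vectType R) (V : lmodType R) (f : {linear vT -> V})
    (U : {vspace vT}) :
  (forall u, u \in U -> f u = 0 -> u = 0) ->
  fdim [set f u | u in [set u | u \in U]] = \dim U.
Proof.
move=> finj; apply: fdimE; exists (fun i => f (vbasis U)`_i); split.
  move=> c c0 i; have /finj : \sum_i c i *: (vbasis U)`_i \in U.
    by apply: memv_suml => j _; rewrite memvZ// vbasis_mem// mem_nth ?size_tuple.
  rewrite linear_sum/=; under eq_bigr do rewrite linearZ/=.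
  move=> /(_ c0) /freeP; apply.
  exact: basis_free (vbasisP U).
apply/seteqP; split => w /=.
  move=> [u uU <-]; exists (fun i => coord (vbasis U) i u).
  rewrite {1}(coord_vbasis uU) linear_sum/=.
  by under eq_bigr do rewrite linearZ/=.
move=> [c ->]; exists (\sum_i c i *: (vbasis U)`_i).
  by apply: memv_suml => j _; rewrite memvZ// vbasis_mem// mem_nth ?size_tuple.
by rewrite linear_sum/=; under eq_bigr do rewrite linearZ/=.
Qed.

(** A subspace of maximal dimension among those inside [A] is all of [A]: adding the line of a
    further vector of [A] would stay inside [A]. *)
Lemma subspace_vspace (vT : vectType R) (A : set vT) :
  A 0 -> (forall c u v, A u -> A v -> A (c *: u + v)) ->
  {U : {vspace vT} | A = [set u | u \in U]}.
Proof.
move=> A0 Alin; apply: cid.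
have [n [U [UA Un Umax]]] : exists n (U : {vspace vT}),
    [/\ (forall u, u \in U -> A u), \dim U = n &
      forall W : {vspace vT}, (forall u, u \in W -> A u) -> (\dim W <= n)%N].
  pose P n := `[< exists2 U : {vspace vT}, (forall u, u \in U -> A u) & \dim U = n >].
  have P0 : exists n, P n.
    exists 0%N; apply/asboolP; exists 0%VS; rewrite ?dimv0// => u.
    by rewrite memv0 => /eqP ->.
  have Pb n : P n -> (n <= \dim {:vT})%N.
    by move=> /asboolP[U _ <-]; rewrite dimvS// subvf.
  case: (ex_maxnP P0 Pb) => n /asboolP[U UA Un] nmax.
  exists n, U; split => // W WA; apply: nmax; apply/asboolP; by exists W.
exists U; apply/seteqP; split => // u Au /=.
have le : (\dim (U + <[u]>) <= n)%N.
  apply: Umax => w /memv_addP[x xU [y]].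
  by move=> /vlineP[k ->] ->; rewrite addrC; apply: Alin => //; exact: UA.
suff /eqP -> : U == (U + <[u]>)%VS.
  by apply: (subvP (addvSr U <[u]>%VS)); rewrite memv_line.
by rewrite eqEdim addvSl Un le.
Qed.

(** The product is the direct sum of the copies of the [U i] under the coordinate injections. *)
Lemma prod_vspace (vT : vectType R) (I : finType) (U : I -> {vspace vT}) :
  {W : {vspace {ffun I -> vT}} | (forall g, (g \in W) = [forall i, g i \in U i])
    & \dim W = (\sum_i \dim (U i))%N}.
Proof.
pose f i (u : vT) : {ffun I -> vT} := [ffun j => if j == i then u else 0].
have flin i : linear (f i).
  move=> c u v; apply/ffunP => j; rewrite !ffunE.
  by case: eqP => // _; rewrite scaler0 addr0.
pose fm i := GRing.isLinear.Build R vT {ffun I -> vT} *:%R (f i) (flin i).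
pose fL i : {linear vT -> {ffun I -> vT}} := HB.pack (f i) (fm i).
pose F i := linfun (fL i).
have FE i u : F i u = f i u by rewrite lfunE.
exists (\sum_i (F i @: U i))%VS.
  move=> g; apply/memv_sumP/forallP => [[h hU ->] i|gU].
    rewrite sum_ffunE (bigD1 i)//= big1 ?addr0 => [|j /negPf ji]; last first.
      by have /memv_imgP[u _ ->] := hU j isT; rewrite FE ffunE eq_sym ji.
    by have /memv_imgP[u uU ->] := hU i isT; rewrite FE ffunE eqxx.
  exists (fun i => f i (g i)) => [i _|].
    by rewrite -FE memv_img.
  apply/ffunP => i; rewrite sum_ffunE (bigD1 i)//= big1 ?addr0 => [|j /negPf ji]; last first.
    by rewrite ffunE eq_sym ji.
  by rewrite ffunE eqxx.
have dF i : \dim (F i @: U i) = \dim (U i).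
  apply: limg_dim_eq; apply/eqP; rewrite -subv0; apply/subvP => u.
  rewrite memv_cap memv_ker FE => /andP[_ /eqP/ffunP/(_ i)].
  by rewrite !ffunE eqxx => ->; rewrite mem0v.
have -> : (\sum_i \dim (U i) = \sum_i \dim (F i @: U i))%N by apply: eq_bigr.
have : directv (\sum_i (F i @: U i))%VS; last by move/directvP.
apply/directv_sum_independent => u uU su i _.
have /memv_imgP[x _ ux] := uU i isT; rewrite ux FE.
suff -> : x = 0 by apply/ffunP => j; rewrite !ffunE; case: ifP.
move/ffunP/(_ i): su; rewrite sum_ffunE (bigD1 i)//= big1 ?addr0.
  by rewrite ux FE !ffunE eqxx.
move=> j /negPf ji.
by have /memv_imgP[y _ ->] := uU j isT; rewrite FE ffunE eq_sym ji.
Qed.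

End Dimension.

(** * Triangles in the plane *)

Section PlaneGeometry.
Variable R : realType.
Local Notation plane := 'rV[R]_2.
Implicit Types (v w u x y p : plane) (b e t : {fset plane}) (K : {fset {fset plane}}).

(** Twice the signed area of the triangle: its sign tells on which side of the line [v w] the point
    [u] lies, and quotients of such areas are barycentric coordinates. *)
Definition area v w u : R :=
  (w 0 0 - v 0 0) * (u 0 1 - v 0 1) - (w 0 1 - v 0 1) * (u 0 0 - v 0 0).

Lemma planeP x y : x 0 0 = y 0 0 -> x 0 1 = y 0 1 -> x = y.
Proof.
move=> e0 e1; apply/rowP => i.
by case: i => -[|[|//]] i; [rewrite (_ : Ordinal i = 0)|rewrite (_ : Ordinal i = 1)];
  rewrite //; apply/val_inj.
Qed.

Lemma area_rot v w u : area v w u = area w u v.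
Proof. by rewrite /area; ring. Qed.

Lemma area_swap v w u : area w v u = - area v w u.
Proof. by rewrite /area; ring. Qed.

Lemma area_vv v u : area v v u = 0.
Proof. by rewrite /area; ring. Qed.

Lemma area_vuv v u : area v u v = 0.
Proof. by rewrite /area; ring. Qed.

Lemma area_vuu v u : area v u u = 0.
Proof. by rewrite /area; ring. Qed.

Lemma area_mean v w x y (t : R) :
  area v w ((1 - t) *: x + t *: y) = (1 - t) * area v w x + t * area v w y.
Proof. by rewrite /area !mxE; ring. Qed.

Lemma area_sum v w u x : area x w u + area v x u + area v w x = area v w u.
Proof. by rewrite /area; ring. Qed.

Lemma area_bary v w u x :
  area v w u *: x = area x w u *: v + area v x u *: w + area v w x *: u.
Proof. by apply: planeP; rewrite !mxE /area; ring. Qed.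

Lemma coord0_continuous : continuous (fun x : plane => x 0 0).
Proof. exact: coord_continuous. Qed.

Lemma coord1_continuous : continuous (fun x : plane => x 0 1).
Proof. exact: coord_continuous. Qed.

Lemma area_continuous v w : continuous (area v w).
Proof.
move=> x; have c0 := @coord0_continuous x; have c1 := @coord1_continuous x.
exact: (cvgB (cvgM (cvg_cst _) (cvgB c1 (cvg_cst _)))
             (cvgM (cvg_cst _) (cvgB c0 (cvg_cst _)))).
Qed.

Lemma card2_fset (T : choiceType) (b : {fset T}) : #|` b|%fset = 2 ->
  exists v w : T, v != w /\ b = [fset v; w]%fset.
Proof.
move=> b2; have bu := fset_uniq b.
have bE (x : T) : (x \in b) = (x \in (b : seq T)) by [].
move: b2 bu bE; case: (enum_fset b) => [|v [|w []]]//= _.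
rewrite inE andbT => vw bE; exists v, w; split => //.
by apply/fsetP => x; rewrite bE !inE.
Qed.

Lemma card3_fset (T : choiceType) (b : {fset T}) : #|` b|%fset = 3 ->
  exists v w u : T, uniq [:: v; w; u] /\ b = [fset v; w; u]%fset.
Proof.
move=> b2; have bu := fset_uniq b.
have bE (x : T) : (x \in b) = (x \in (b : seq T)) by [].
move: b2 bu bE; case: (enum_fset b) => [|v [|w [|u []]]]// _ uq bE.
exists v, w, u; split => //.
by apply/fsetP => x; rewrite bE !inE orbA.
Qed.

Lemma big_fset2 (V : nmodType) (F : plane -> V) v w : v != w ->
  \sum_(x <- [fset v; w]%fset) F x = F v + F w.
Proof.
move=> vw; rewrite (perm_big [:: v; w]) /= ?big_cons ?big_nil ?addr0//.
apply: uniq_perm; rewrite ?fset_uniq//= ?inE ?vw//.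
by move=> x; rewrite !inE.
Qed.

Lemma big_fset3 (V : nmodType) (F : plane -> V) v w u : uniq [:: v; w; u] ->
  \sum_(x <- [fset v; w; u]%fset) F x = F v + F w + F u.
Proof.
move=> vwu; rewrite (perm_big [:: v; w; u]) /= ?big_cons ?big_nil ?addr0 ?addrA//.
apply: uniq_perm; rewrite ?fset_uniq// => x; by rewrite !inE orbA.
Qed.

Lemma hullP b x : hull b x <->
  exists a : plane -> R, [/\ forall v, v \in b -> 0 <= a v, \sum_(v <- b) a v = 1
    & x = \sum_(v <- b) a v *: v].
Proof.
split=> [[n [p [a [pb a0 a1 ->]]]]|[a [a0 a1 ->]]].
  exists (fun v => \sum_(i | p i == v) a i).
  have sumE (V : nmodType) (F : 'I_n -> plane -> V) :
      \sum_(v <- b) \sum_(i | p i == v) F i v = \sum_i F i (p i).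
    under eq_bigr do rewrite big_mkcond.
    rewrite exchange_big; apply: eq_bigr => i _ /=.
    rewrite (bigD1_seq (p i)) ?fset_uniq ?pb//= eqxx big1 ?addr0// => j.
    by rewrite eq_sym => /negPf ->.
  split=> [v _||]; first by apply: sumr_ge0.
    by rewrite sumE.
  under [RHS]eq_bigr do rewrite scaler_suml.
  by rewrite sumE.
exists (size b), (fun i => tnth (in_tuple b) i), (fun i => a (tnth (in_tuple b) i)).
split=> [i|i||].
- by rewrite /= -/(_ \in b) mem_tnth.
- by apply: a0; exact: mem_tnth.
- by rewrite -[RHS]a1 [RHS]big_tnth.
- by rewrite [LHS]big_tnth.
Qed.

Lemma hull0 x : ~ hull fset0 x.
Proof. by move=> /hullP[a [_]]; rewrite big_seq_fset0 => /eqP; rewrite eq_sym oner_eq0. Qed.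

Lemma hull1P v x : hull [fset v]%fset x <-> x = v.
Proof.
split=> [/hullP[a [_]]|->]; first by rewrite !big_seq_fset1 => -> ->; rewrite scale1r.
by apply/hullP; exists (fun=> 1); rewrite !big_seq_fset1 scale1r.
Qed.

Lemma hull_vertex b v : v \in b -> hull b v.
Proof.
move=> vb; apply/hullP; exists (fun x => (x == v)%:R); split=> [w _||].
- exact: ler0n.
- rewrite (bigD1_seq v) ?fset_uniq//= eqxx big1 ?addr0// => w /negPf ->//.
- rewrite (bigD1_seq v) ?fset_uniq//= eqxx scale1r big1 ?addr0// => w /negPf ->.
  by rewrite scale0r.
Qed.

Lemma hullS b b' x : (b `<=` b')%fset -> hull b x -> hull b' x.
Proof.
move=> /fsubsetP bb' [n [p [a [pb a0 a1 ->]]]].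
by exists n, p, a; split => // i; apply: bb'; exact: pb.
Qed.

Lemma hull2P v w x : hull [fset v; w]%fset x <->
  exists2 t : R, 0 <= t <= 1 & x = (1 - t) *: v + t *: w.
Proof.
have [<-|vw] := eqVneq v w.
  rewrite fsetUid; split=> [/hull1P ->|[t _ ->]].
    by exists 0; rewrite ?lexx ?ler01// scale0r addr0 subr0 scale1r.
  by apply/hull1P; rewrite -scalerDl subrK scale1r.
split=> [/hullP[a [a0]]|[t /andP[t0 t1] ->]].
  rewrite !big_fset2// => a1 ->; exists (a w); last by rewrite -a1 addrK.
  have av : 0 <= a v by apply: a0; rewrite !inE eqxx.
  have aw : 0 <= a w by apply: a0; rewrite !inE eqxx orbT.
  by rewrite aw -a1 lerDr.
apply/hullP; exists (fun x => if x == w then t else 1 - t).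
rewrite !big_fset2// eqxx (negPf vw); split=> [u _||//].
  by case: ifP => _//; rewrite subr_ge0.
by rewrite subrK.
Qed.

Lemma hull2_area v w x : hull [fset v; w]%fset x -> area v w x = 0.
Proof.
by move=> /hull2P[t _ ->]; rewrite area_mean area_vuv area_vuu !mulr0 addr0.
Qed.

Lemma area_neq0_uniq v w u : area v w u != 0 -> uniq [:: v; w; u].
Proof.
move=> D0; rewrite /= !inE negb_or andbT -andbA; apply/and3P; split.
- by apply: contra_neq D0 => ->; rewrite area_vv.
- by apply: contra_neq D0 => ->; rewrite area_vuv.
- by apply: contra_neq D0 => ->; rewrite area_vuu.
Qed.

(** The barycentric coordinates are quotients by [area v w u]; multiplying by this area instead
    keeps their signs, whatever the orientation of the triangle. *)
Lemma hull3P v w u x : area v w u != 0 ->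
  hull [fset v; w; u]%fset x <->
  [/\ 0 <= area x w u * area v w u, 0 <= area v x u * area v w u
    & 0 <= area v w x * area v w u].
Proof.
move=> D0; have uq := area_neq0_uniq D0.
split=> [/hullP[a [a0]]|[h1 h2 h3]].
  rewrite !big_fset3// => a1 xE.
  have av : 0 <= a v by apply: a0; rewrite !inE eqxx.
  have aw : 0 <= a w by apply: a0; rewrite !inE eqxx orbT.
  have au : 0 <= a u by apply: a0; rewrite !inE eqxx orbT.
  have sq c : 0 <= c -> 0 <= c * area v w u * area v w u.
    by move=> c0; rewrite -mulrA mulr_ge0// -expr2 sqr_ge0.
  have -> : area x w u = a v * area v w u.
    have -> : a v = 1 - a w - a u by rewrite -a1; ring.
    have -> : x = (1 - a w - a u) *: v + a w *: w + a u *: u.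
      by rewrite xE -a1; congr (_ *: _ + _ + _); ring.
    by rewrite /area !mxE; ring.
  have -> : area v x u = a w * area v w u.
    have -> : a w = 1 - a v - a u by rewrite -a1; ring.
    have -> : x = a v *: v + (1 - a v - a u) *: w + a u *: u.
      by rewrite xE -a1; congr (_ + _ *: _ + _); ring.
    by rewrite /area !mxE; ring.
  have -> : area v w x = a u * area v w u.
    have -> : a u = 1 - a v - a w by rewrite -a1; ring.
    have -> : x = a v *: v + a w *: w + (1 - a v - a w) *: u.
      by rewrite xE -a1; congr (_ + _ *: _); ring.
    by rewrite /area !mxE; ring.
  by split; exact: sq.
have ge c : 0 <= c * area v w u -> 0 <= c / area v w u.
  move=> h; have -> : c / area v w u = c * area v w u * (area v w u)^-1 ^+ 2.
    by field.
  by rewrite mulr_ge0// sqr_ge0.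
apply/hullP; exists (fun y => if y == v then area x w u / area v w u
  else if y == w then area v x u / area v w u else area v w x / area v w u).
rewrite !big_fset3// eqxx.
move: uq; rewrite /= !inE negb_or andbT -andbA => /and3P[vw vu wu].
rewrite !(eq_sym _ v) (negPf vw) (negPf vu) eqxx (eq_sym _ w) (negPf wu); split.
- by move=> y _; case: ifP => _; [|case: ifP => _]; exact: ge.
- by rewrite -!mulrDl area_sum divff.
- apply: (scalerI D0); rewrite area_bary !scalerDr !scalerA.
  by rewrite ![area v w u * (_ / _)]mulrC !divfK.
Qed.

End PlaneGeometry.

(** * Planar simplicial complexes *)

Section Complexes.
Variable R : realType.
Local Notation plane := 'rV[R]_2.
Implicit Types (v w u x y p n : plane) (b e t : {fset plane}) (K : {fset {fset plane}}).

Lemma closed_area_ge (f : plane -> R) :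
  continuous f -> closed [set x | 0 <= f x].
Proof.
move=> fc; have -> : [set x | 0 <= f x] = f @^-1` [set y | 0 <= y] by [].
by apply: closed_comp => [x _|]; [exact: fc|exact: closed_ge].
Qed.

Definition dot (x y : plane) : R := x 0 0 * y 0 0 + x 0 1 * y 0 1.
Definition cross (x y : plane) : R := x 0 0 * y 0 1 - x 0 1 * y 0 0.

Lemma areaE v w u : area v w u = cross (w - v) (u - v).
Proof. by rewrite /area /cross !mxE. Qed.

Lemma dot_eq0 x : (dot x x == 0) = (x == 0).
Proof.
rewrite /dot -!expr2 paddr_eq0 ?sqr_ge0// !sqrf_eq0.
apply/andP/eqP => [[/eqP x0 /eqP x1]|->]; last by rewrite !mxE.
by apply: planeP; rewrite !mxE.
Qed.

Lemma dot_ge0 x : 0 <= dot x x.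
Proof. by rewrite /dot -!expr2 addr_ge0 ?sqr_ge0. Qed.

Lemma line_continuous v w : continuous (fun t : R => (1 - t) *: v + t *: w).
Proof.
move=> t; have c1 : {for t, continuous (fun t : R => 1 - t)} by exact: (cvgB (cvg_cst _) (@cvg_id _ _)).
exact: (cvgD (cvgZr_tmp c1) (@scalel_continuous R _ w t)).
Qed.

Lemma hull2_closed v w : closed (hull [fset v; w]%fset).
Proof.
rewrite (_ : hull _ = (fun t : R => (1 - t) *: v + t *: w) @` `[0, 1]).
  apply: compact_closed; first exact: norm_hausdorff.
  apply: continuous_compact; last exact: segment_compact.
  by apply: continuous_subspaceT => t; exact: line_continuous.
apply/seteqP; split => x; first by move=> /hull2P[t t01 ->]; exists t => //=; rewrite in_itv.
by move=> [t /=]; rewrite in_itv => t01 <-; apply/hull2P; exists t.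
Qed.

Lemma hull3_closed v w u : area v w u != 0 -> closed (hull [fset v; w; u]%fset).
Proof.
move=> D0.
rewrite (_ : hull _ = [set x | 0 <= area w u x * area v w u] `&`
  [set x | 0 <= area u v x * area v w u] `&` [set x | 0 <= area v w x * area v w u]).
  by apply: closedI; [apply: closedI|]; apply: closed_area_ge => // x;
    exact: (cvgM (@area_continuous _ _ _ x) (cvg_cst _)).
apply/seteqP; split => x /=.
  by move/(hull3P _ D0) => [h1 h2 h3]; rewrite (area_rot u v x) -(area_rot x w u).
move=> [[h1 h2] h3]; apply/(hull3P _ D0).
by split => //; [rewrite area_rot|rewrite area_rot area_rot].
Qed.

Lemma affine_indep_area K v w u : simplicial_complex K ->
  [fset v; w; u]%fset \in K -> uniq [:: v; w; u] -> area v w u != 0.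
Proof.
move=> [_ _ Kaff _] tK uq; apply/eqP => D0.
move: (uq); rewrite /= !inE negb_or andbT -andbA => /and3P[vw vu wu].
have dep (a b c : R) : a + b + c = 0 -> a *: v + b *: w + c *: u = 0 ->
    [/\ a = 0, b = 0 & c = 0].
  move=> abc0 abcv.
  have := Kaff _ tK (fun x => if x == v then a else if x == w then b else c).
  have wv : (w == v) = false by rewrite eq_sym (negPf vw).
  rewrite !big_fset3// eqxx !(eq_sym _ v) (negPf vw) (negPf vu) eqxx.
  rewrite (eq_sym _ w) (negPf wu) => /(_ abc0 abcv) h; split.
  - by move: (h v); rewrite !inE eqxx => /(_ isT).
  - by move: (h w); rewrite !inE eqxx orbT wv => /(_ isT).
  - move: (h u); rewrite !inE eqxx orbT (eq_sym u v) (negPf vu) (eq_sym u w) (negPf wu).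
    by move=> /(_ isT).
have wv : w = v -> False by move=> wv; rewrite wv eqxx in vw.
apply: wv; apply: planeP.
  (* When the area is 0, differences of first coordinates are the coefficients of an affine
     dependency; its last coefficient is [w 0 0 - v 0 0]. Second coordinates are treated alike. *)
  have [] := dep ((u - w) 0 0) (- (u - v) 0 0) ((w - v) 0 0).
  - by rewrite !mxE; ring.
  - apply: planeP; rewrite !mxE; first by ring.
    by rewrite -D0 /area; ring.
  - by rewrite !mxE => _ _ /eqP; rewrite subr_eq0 => /eqP.
have [] := dep ((u - w) 0 1) (- (u - v) 0 1) ((w - v) 0 1).
- by rewrite !mxE; ring.
- apply: planeP; rewrite !mxE; last by ring.
  by rewrite -[RHS]oppr0 -D0 /area; ring.
- by rewrite !mxE => _ _ /eqP; rewrite subr_eq0 => /eqP.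
Qed.

(** * Local structure of a complex around its points, edges and vertices *)

Section Complex.
Variables (K : {fset {fset plane}}) (KC : simplicial_complex K).

Lemma face_nonempty b : b \in K -> b != fset0.
Proof. by case: KC => K0 _ _ _ bK; apply: contraNneq K0 => <-. Qed.

Lemma face_sub b b' : b \in K -> (b' `<=` b)%fset -> b' != fset0 -> b' \in K.
Proof. by case: KC => _ + _ _; apply. Qed.

Lemma face_cap b b' : b \in K -> b' \in K ->
  hull b `&` hull b' = hull (b `&` b')%fset.
Proof. by case: KC => _ _ _; apply. Qed.

(** Four points of the plane are affinely dependent: the barycentric coordinates of the fourth in
    the triangle of the first three, cleared of denominators, give the dependency. *)
Lemma face_card b : b \in K -> (#|` b| <= 3)%N.
Proof.
move=> bK; rewrite leqNgt; apply/negP => b4.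
have bu := fset_uniq b; have bE x : (x \in b) = (x \in (b : seq plane)) by [].
move: b4 bu bE; case: (enum_fset b) => [|v1 [|v2 [|v3 [|v4 s]]]]//= _ uq bE.
have sub3 : ([fset v1; v2; v3] `<=` b)%fset.
  apply/fsubsetP => x; rewrite bE !inE => /orP[/orP[]|] ->; by rewrite ?orbT.
have K3 : [fset v1; v2; v3]%fset \in K.
  by apply: (face_sub bK sub3); apply/fset0Pn; exists v1; rewrite !inE eqxx.
move: uq; rewrite !inE !negb_or => /andP[/and4P[n12 n13 n14 _]].
move=> /andP[/and3P[n23 n24 _]] /andP[/andP[n34 _] _].
have uq3 : uniq [:: v1; v2; v3] by rewrite /= !inE negb_or n12 n13 n23.
have D0 := affine_indep_area KC K3 uq3.
have sub4 : (v4 |` [fset v1; v2; v3] `<=` b)%fset.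
  apply/fsubsetP => x; rewrite bE !inE => /orP[|/orP[/orP[]|]] ->; by rewrite ?orbT.
have K4 : (v4 |` [fset v1; v2; v3])%fset \in K.
  by apply: (face_sub bK sub4); apply/fset0Pn; exists v4; rewrite !inE eqxx.
have v4n : v4 \notin [fset v1; v2; v3]%fset.
  by rewrite !inE !negb_or !(eq_sym v4) n14 n24 n34.
case: KC => _ _ /(_ _ K4) aff _.
have := aff (fun x => if x == v4 then - area v1 v2 v3
  else if x == v1 then area v4 v2 v3 else if x == v2 then area v1 v4 v3
  else area v1 v2 v4).
rewrite !big_fsetU1//= !big_fset3// eqxx.
rewrite !(negPf n14) !(negPf n24) !(negPf n34) eqxx !(eq_sym _ v1) (negPf n12).
rewrite (negPf n13) eqxx (eq_sym _ v2) (negPf n23) area_sum addNr scaleNr.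
rewrite (area_bary v1 v2 v3 v4) addNr => /(_ erefl erefl v4).
by rewrite !inE eqxx => /(_ isT)/eqP; rewrite oppr_eq0 (negPf D0).
Qed.

Lemma hull_closed b : b \in K -> closed (hull b).
Proof.
move=> bK; have := face_card bK; rewrite leq_eqVlt ltnS => /orP[/eqP b3|].
  have [v [w [u [uq bE]]]] := card3_fset b3.
  by rewrite bE; apply: hull3_closed; apply: (affine_indep_area KC); rewrite -?bE.
rewrite leq_eqVlt ltnS => /orP[/eqP b2|].
  by have [v [w [_ ->]]] := card2_fset b2; exact: hull2_closed.
rewrite leq_eqVlt ltnS leqn0 => /orP[|].
  by move=> /cardfs1P[v ->]; rewrite -[[fset v]%fset]fsetUid; exact: hull2_closed.
by rewrite cardfs_eq0 (negPf (face_nonempty bK)).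
Qed.

(** The finitely many hulls that miss [p] are closed, so some neighborhood of [p] avoids them
    all. *)
Lemma local_star p : \forall x \near p, forall b, b \in K -> hull b x -> hull b p.
Proof.
have : \forall x \near p, forall b : K, hull (val b) x -> hull (val b) p.
  have := @filter_forall _ _ (fun (b : K) x => hull (val b) x -> hull (val b) p) (nbhs p) _.
  apply=> b /=.
  have [bp|bp] := pselect (hull (val b) p); first by apply: nearW.
  have : \forall x \near p, (~` hull (val b)) x.
    by apply: open_nbhs_nbhs; split => //; apply: closed_openC; apply: hull_closed; exact: valP.
  by apply: filterS => x nx /nx.
by apply: filterS => x h b bK; exact: (h [` bK]%fset).
Qed.

Lemma hull_face_vertex b v : [fset v]%fset \in K -> b \in K -> hull b v -> v \in b.
Proof.
move=> vK bK bv; have : (hull [fset v]%fset `&` hull b) v by split => //; apply/hull1P.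
rewrite (face_cap vK bK); have [vb _|vb] := boolP (v \in b); first by [].
rewrite (_ : ([fset v] `&` b)%fset = fset0); first by move/hull0.
by apply/fsetP => x; rewrite !inE; apply/andP => -[/eqP -> vb']; rewrite vb' in vb.
Qed.

Lemma vertexP v : reflect (exists2 b, b \in K & v \in b) (v \in vertices K).
Proof.
apply: (iffP idP) => [/bigfcupP[b /andP[]]|[b bK vb]].
  by rewrite !inE => /andP[bK _] _ vb; exists b.
apply/bigfcupP; exists [fset v]%fset; last by rewrite inE.
rewrite andbT !inE cardfs1 eqxx andbT (face_sub bK)//.
  by apply/fsubsetP => x; rewrite inE => /eqP ->.
by apply/fset0Pn; exists v; rewrite inE.
Qed.

Lemma vertex_face v : (v \in vertices K) = ([fset v]%fset \in K).
Proof.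
apply/vertexP/idP => [[b bK vb]|vK]; last by exists [fset v]%fset; rewrite ?inE.
apply: (face_sub bK); first by apply/fsubsetP => x; rewrite inE => /eqP ->.
by apply/fset0Pn; exists v; rewrite inE.
Qed.

Lemma carrier_vertex v : v \in vertices K -> carrier K v.
Proof. by rewrite vertex_face => vK; exists [fset v]%fset => //; apply/hull1P. Qed.

Lemma interior_nboundary x : (carrier K)° x -> ~ boundary K x.
Proof. by move=> xi [_]. Qed.

Lemma nboundary_interior x : carrier K x -> ~ boundary K x -> (carrier K)° x.
Proof.
move=> cx nb; have [//|xi] := pselect ((carrier K)° x).
by exfalso; apply: nb; split => //; exact: subset_closure.
Qed.

Lemma interior_vertexP v :
  v \in interior_vertices K <-> v \in vertices K /\ (carrier K)° v.
Proof.
rewrite !inE /=; split=> [/andP[vV /asboolP nb]|[vV vi]].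
  by split => //; apply: nboundary_interior => //; exact: carrier_vertex.
by rewrite vV; apply/asboolP; exact: interior_nboundary.
Qed.

Lemma near_ray p n (P : set plane) : (\forall x \near p, P x) ->
  \forall t \near 0^'+, P (p + t *: n).
Proof.
move=> Pp; apply: (@cvg_within _ (nbhs (0 : R))).
have : (fun t : R => p + t *: n) @ (0 : R) --> p + 0 *: n.
  exact: (cvgD (cvg_cst p) (@scalel_continuous R _ n 0)).
by rewrite scale0r addr0; apply.
Qed.

Lemma hull_linear_bound b v (h : plane -> R) x (c0 c1 : R) :
  (forall y, h y = c0 * y 0 0 + c1 * y 0 1) ->
  (forall w, w \in b -> h w <= h v) -> hull b x -> h x <= h v.
Proof.
move=> hE hw /hullP[a [a0 a1 ->]].
have -> : h (\sum_(w <- b) a w *: w) = \sum_(w <- b) a w * h w.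
  rewrite hE !summxE !mulr_sumr -big_split/=.
  by apply: eq_bigr => w _; rewrite !mxE hE; ring.
rewrite -[leRHS]mul1r -a1 mulr_suml big_seq_cond [leRHS]big_seq_cond.
by apply: ler_sum => w /andP[wb _]; apply: ler_wpM2l; [exact: a0|exact: hw].
Qed.

(** A point slightly to the right or left of [v], according to the sign of [s], lies in a face at
    [v]; a face without vertices strictly on that side of [v] could not contain it. *)
Lemma interior_vertex_neighbor v (s : R) : v \in interior_vertices K -> s != 0 ->
  exists w, [/\ w != v, [fset v; w]%fset \in K & 0 < s * (w 0 0 - v 0 0)].
Proof.
move=> /interior_vertexP[vV vi] s0.
have nv : \forall x \near v, carrier K x /\ forall b, b \in K -> hull b x -> hull b v.
  by apply: filterI; [exact: vi|exact: local_star].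
have : \forall t \near 0^'+, (0 : R) < t /\
    let x := v + t *: (s *: delta_mx 0 0) in
    carrier K x /\ forall b, b \in K -> hull b x -> hull b v.
  by apply: filterI; [exact: nbhs_right_gt|exact: (near_ray (s *: delta_mx 0 0) nv)].
move=> /filter_ex [t [t0 []]].
set x := v + _ => -[b bK bx] /(_ b bK bx) bv.
have vb : v \in b by apply: hull_face_vertex => //; rewrite -vertex_face.
have [[w [wb hw]]|nw] := pselect (exists w, w \in b /\ 0 < s * (w 0 0 - v 0 0)).
  have wv : w != v by apply/eqP => wv; move: hw; rewrite wv subrr mulr0 ltxx.
  exists w; split => //; apply: (face_sub bK).
    by apply/fsubsetP => y; rewrite !inE => /orP[] /eqP ->.
  by apply/fset0Pn; exists v; rewrite !inE eqxx.
have : s * x 0 0 <= s * v 0 0.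
  apply: (@hull_linear_bound b v (fun y => s * y 0 0) x s 0) => // [y|w wb].
    by rewrite mul0r addr0.
  by rewrite -subr_le0 -mulrBr leNgt; apply/negP => h; apply: nw; exists w.
rewrite /x !mxE !eqxx mulr1 mulrDr gerDl leNgt; case/negP.
by rewrite mulrCA mulr_gt0// -expr2 exprn_even_gt0//= .
Qed.

(** At a relative interior point of the side, the barycentric coordinates at [v] and [w] are
    positive, and they stay so nearby. *)
Lemma near_tri_side v w u (l : R) : 0 < l < 1 -> area v w u != 0 ->
  \forall x \near ((1 - l) *: v + l *: w),
    0 <= area v w x * area v w u -> hull [fset v; w; u]%fset x.
Proof.
move=> /andP[l0 l1] D0; set p := _ + _.
have c1 : {for p, continuous (fun x => area w u x * area v w u)}.
  exact: (cvgM (@area_continuous _ w u p) (cvg_cst _)).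
have c2 : {for p, continuous (fun x => area u v x * area v w u)}.
  exact: (cvgM (@area_continuous _ u v p) (cvg_cst _)).
have D2 : 0 < area v w u ^+ 2 by rewrite exprn_even_gt0.
have g1 : 0 < area w u p * area v w u.
  rewrite (_ : _ * _ = (1 - l) * area v w u ^+ 2) ; last first.
    by rewrite /p area_mean area_vuv -area_rot; ring.
  by apply: mulr_gt0 => //; rewrite subr_gt0.
have g2 : 0 < area u v p * area v w u.
  rewrite (_ : _ * _ = l * area v w u ^+ 2) ; last first.
    by rewrite /p area_mean area_vuu area_rot; ring.
  exact: mulr_gt0.
have n1 : \forall x \near p, 0 < area w u x * area v w u.
  exact: (cvgr_gt _ c1 _ g1).
have n2 : \forall x \near p, 0 < area u v x * area v w u.
  exact: (cvgr_gt _ c2 _ g2).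
near=> x => h; apply/(hull3P _ D0); split => //.
  by rewrite area_rot ltW//; near: x.
by rewrite -area_rot ltW//; near: x.
Unshelve. all: by end_near. Qed.

Lemma half_in01 : 0 < (2^-1 : R) < 1.
Proof. by apply/andP; split; lra. Qed.

(** Two triangles on the same side of an edge have common points off the line of the edge, whereas
    distinct ones may meet in the edge only. *)
Lemma tri_side_unique v w u u' : [fset v; w; u]%fset \in K ->
  [fset v; w; u']%fset \in K -> 0 < area v w u * area v w u' -> u = u'.
Proof.
move=> tK tK' D; apply/eqP/negPn/negP => uu'.
have D0 : area v w u != 0 by apply: contraTneq D => ->; rewrite mul0r ltxx.
have D0' : area v w u' != 0 by apply: contraTneq D => ->; rewrite mulr0 ltxx.
set p := (1 - 2^-1) *: v + 2^-1 *: w.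
have [x [x0 hx hx']] : exists x, [/\ area v w x != 0, hull [fset v; w; u]%fset x &
    hull [fset v; w; u']%fset x].
  have n1 := near_ray (u - p) (near_tri_side half_in01 D0).
  have n2 := near_ray (u - p) (near_tri_side half_in01 D0').
  have : \forall t \near 0^'+, [/\ (0 : R) < t,
      0 <= area v w (p + t *: (u - p)) * area v w u -> hull [fset v; w; u]%fset (p + t *: (u - p)) &
      0 <= area v w (p + t *: (u - p)) * area v w u' -> hull [fset v; w; u']%fset (p + t *: (u - p))].
    near=> t; split; [near: t; exact: nbhs_right_gt|near: t; exact: n1|near: t; exact: n2].
  move=> /filter_ex[t [t0 h h']]; exists (p + t *: (u - p)).
  have aE : area v w (p + t *: (u - p)) = t * area v w u.
    have -> : p + t *: (u - p) = (1 - t) *: p + t *: u.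
      by rewrite scalerBr scalerBl scale1r addrA addrAC.
    have ap : area v w p = 0 by rewrite /p area_mean area_vuv area_vuu !mulr0 addr0.
    by rewrite area_mean ap mulr0 add0r.
  split; first by rewrite aE mulf_neq0 // gt_eqF.
    by apply: h; rewrite aE -mulrA mulr_ge0 ?ltW// -expr2 exprn_even_gt0.
  by apply: h'; rewrite aE -mulrA mulr_ge0 ?ltW.
have : (hull [fset v; w; u]%fset `&` hull [fset v; w; u']%fset) x by [].
rewrite (face_cap tK tK') => hxx; apply/negP: x0.
rewrite negbK; apply/eqP/hull2_area; apply: hullS hxx.
apply/fsubsetP => y; rewrite !inE => /andP[/orP[->//|/eqP ->]] /orP[->//|].
by rewrite (negPf uu').
Unshelve. all: by end_near. Qed.

(** The face meets the edge in the hull of their common vertices; with one end missing, this hull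
    contains at most the other end. *)
Lemma face_hull_edge v w b (l : R) : v != w -> [fset v; w]%fset \in K -> b \in K ->
  0 < l < 1 -> hull b ((1 - l) *: v + l *: w) -> (v \in b) /\ (w \in b).
Proof.
move=> vw eK bK /andP[l0 l1]; set p := _ + _ => bp.
have : (hull [fset v; w]%fset `&` hull b) p.
  by split => //; apply/hull2P; exists l; rewrite ?(ltW l0) ?(ltW l1).
rewrite (face_cap eK bK) => h.
have pv : p != v.
  rewrite -subr_eq0 (_ : p - v = l *: (w - v)).
    by rewrite scaler_eq0 gt_eqF//= subr_eq0 eq_sym.
  by rewrite /p; apply: planeP; rewrite !mxE; ring.
have pw : p != w.
  rewrite -subr_eq0 (_ : p - w = (1 - l) *: (v - w)).
    by rewrite scaler_eq0 subr_eq0 gt_eqF//= subr_eq0.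
  by rewrite /p; apply: planeP; rewrite !mxE; ring.
split; apply/negPn/negP => nb.
  move/eqP: pw; apply; apply/hull1P; apply: hullS h.
  apply/fsubsetP => y; rewrite !inE => /andP[/orP[/eqP ->|//]].
  by rewrite (negPf nb).
move/eqP: pv; apply; apply/hull1P; apply: hullS h.
apply/fsubsetP => y; rewrite !inE => /andP[/orP[//|/eqP ->]].
by rewrite (negPf nb).
Qed.

Lemma face_third b v w x : b \in K -> v != w -> v \in b -> w \in b -> hull b x ->
  area v w x != 0 -> exists2 u, b = [fset v; w; u]%fset &
    area v w u != 0 /\ 0 <= area v w x * area v w u.
Proof.
move=> bK vw vb wb bx x0.
have /fsubsetPn[u ub uvw] : ~~ (b `<=` [fset v; w])%fset.
  by apply: contra x0 => bvw; apply/eqP/hull2_area; exact: hullS bx.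
move: (uvw); rewrite !inE negb_or => /andP[uv uw].
have uq : uniq [:: v; w; u] by rewrite /= !inE negb_or vw !(eq_sym _ u) uv uw.
have bE : b = [fset v; w; u]%fset.
  apply/esym/eqP; rewrite eqEfcard; apply/andP; split.
    by apply/fsubsetP => y; rewrite !inE => /orP[/orP[]|] /eqP ->.
  apply: (leq_trans (face_card bK)).
  by rewrite fsetUC cardfsU1 uvw cardfs2 vw.
have D0 : area v w u != 0 by apply: (affine_indep_area KC); rewrite -?bE.
exists u => //; split => //.
by move: bx; rewrite bE => /(hull3P _ D0)[].
Qed.

Lemma faceP b i : b \in faces K i <-> b \in K /\ #|` b| = i.+1.
Proof. by rewrite !inE /=; split=> [/andP[-> /eqP ->]|[-> ->]]; rewrite ?eqxx. Qed.

Lemma edgeP v w : v != w -> ([fset v; w]%fset \in faces K 1) = ([fset v; w]%fset \in K).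
Proof. by move=> vw; rewrite !inE /= cardfs2 vw eqxx andbT. Qed.

Lemma interior_edgeP e : e \in interior_edges K <->
  e \in faces K 1 /\ ~ (hull e `<=` boundary K).
Proof.
by rewrite !inE /=; split=> [/andP[h /asboolP]|[h /asboolP]]; [split|rewrite h].
Qed.

Definition perp (x : plane) : plane := \row_j (if j == 0 then - x 0 1 else x 0 0).

Lemma area_perp v w p (t : R) : area v w p = 0 ->
  area v w (p + t *: perp (w - v)) = t * dot (w - v) (w - v).
Proof. move=> a0; transitivity (area v w p + t * dot (w - v) (w - v)); last by rewrite a0 add0r.
by rewrite /area /dot !mxE /=; ring. Qed.

(** Stepping off the edge from a relative interior point that is interior to the carrier leads into
    a face containing that point, hence both ends of the edge, with a third vertex on the chosen
    side. *)
Lemma interior_edge_two_sided v w (s : R) : v != w ->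
  [fset v; w]%fset \in interior_edges K -> s != 0 ->
  exists2 u, [fset v; w; u]%fset \in K & 0 < s * area v w u.
Proof.
move=> vw /interior_edgeP[/faceP[eK _]].
move=> /existsNP[p /not_implyP[ep nb]] s0.
have ip : (carrier K)° p.
  by apply: nboundary_interior => //; exists [fset v; w]%fset.
(* The point found outside the boundary may be an end of the edge; it is moved towards the midpoint
   without leaving the interior. *)
have [l l01 ip'] : exists2 l : R, 0 < l < 1 & (carrier K)° ((1 - l) *: v + l *: w).
  move/hull2P: ep => [t /andP[t0 t1] pE].
  have nip : \forall x \near p, (carrier K)° x by apply: nbhs_interior.
  have := near_ray (2^-1 *: (v + w) - p) nip.
  move=> h; have : \forall t \near 0^'+, [/\ (0 : R) < t, t < 1 &
      (carrier K)° (p + t *: (2^-1 *: (v + w) - p))].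
    near=> x; split; [near: x; exact: nbhs_right_gt|near: x; exact: nbhs_right_lt|].
    by near: x; exact: h.
  move=> /filter_ex[x [x0 x1]] => hx.
  exists ((1 - x) * t + x * 2^-1).
    apply/andP; split.
      rewrite ltr_wpDl ?mulr_gt0 ?invr_gt0//.
      by rewrite mulr_ge0// subr_ge0 ltW.
    have : (1 - x) * t <= (1 - x) * 1 by apply: ler_wpM2l => //; rewrite subr_ge0 ltW.
    by lra.
  rewrite (_ : _ + _ = p + x *: (2^-1 *: (v + w) - p))//.
  by rewrite pE; apply: planeP; rewrite !mxE; field.
set q := _ + _ in ip'.
have aq : area v w q = 0 by rewrite /q area_mean area_vuv area_vuu !mulr0 addr0.
have nq : \forall x \near q, carrier K x /\ forall b, b \in K -> hull b x -> hull b q.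
  by apply: filterI; [exact: ip'|exact: local_star].
have : \forall t \near 0^'+, (0 : R) < t /\
    let x := q + t *: (s *: perp (w - v)) in
    carrier K x /\ forall b, b \in K -> hull b x -> hull b q.
  by apply: filterI; [exact: nbhs_right_gt|exact: (near_ray (s *: perp (w - v)) nq)].
move=> /filter_ex [t [t0 /= []]]; rewrite scalerA.
set x := q + _ => -[b bK bx] /(_ b bK bx) bq.
have d0 : 0 < dot (w - v) (w - v).
  by rewrite lt_def dot_ge0 dot_eq0 subr_eq0 eq_sym vw.
have ax : area v w x = t * s * dot (w - v) (w - v) by rewrite /x area_perp.
have [vb wb] := face_hull_edge vw eK bK l01 bq.
have ax0 : area v w x != 0.
  by rewrite ax mulf_neq0 ?(gt_eqF d0)// mulf_neq0// gt_eqF.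
have [u bE [D0 sg]] := face_third bK vw vb wb bx ax0.
exists u; first by rewrite -bE.
rewrite lt_def mulf_neq0//=; move: sg; rewrite ax.
rewrite (_ : t * s * dot _ _ * _ = (t * dot (w - v) (w - v)) * (s * area v w u)); last by ring.
by rewrite pmulr_rge0// mulr_gt0.
Unshelve. all: by end_near. Qed.

(** The two triangles cover the two half-neighborhoods of the midpoint of the edge. *)
Lemma two_sided_interior_edge v w u u' : [fset v; w; u]%fset \in K ->
  [fset v; w; u']%fset \in K -> area v w u * area v w u' < 0 ->
  [fset v; w]%fset \in interior_edges K.
Proof.
move=> tK tK' D.
have D0 : area v w u != 0 by apply: contraTneq D => ->; rewrite mul0r ltxx.
have D0' : area v w u' != 0 by apply: contraTneq D => ->; rewrite mulr0 ltxx.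
have vw : v != w by have /= := area_neq0_uniq D0; rewrite inE negb_or => /andP[/andP[]].
set p := (1 - 2^-1) *: v + 2^-1 *: w.
have ip : (carrier K)° p.
  have h1 := near_tri_side half_in01 D0; have h2 := near_tri_side half_in01 D0'.
  have : \forall x \near p, carrier K x; last by [].
  near=> x.
  have [h|h] := lerP 0 (area v w x * area v w u).
    by exists [fset v; w; u]%fset => //; move: h; near: x; exact: h1.
  exists [fset v; w; u']%fset => //.
  have : 0 <= area v w x * area v w u' by nra.
  by near: x; exact: h2.
apply/interior_edgeP; rewrite edgeP//; split.
  apply: (face_sub tK); first by apply/fsubsetP => y; rewrite !inE => /orP[] ->; rewrite ?orbT.
  by apply/fset0Pn; exists v; rewrite !inE eqxx.
move=> /(_ p); case => //; apply/hull2P; exists 2^-1 => //.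
by have /andP[h1 h2] := half_in01; rewrite !ltW.
Unshelve. all: by end_near. Qed.

(* If some direction [u] at [v] were not covered by a triangle, the edge making the
   smallest angle with it on one side would have no triangle on the side of [u]. *)
Lemma directions_covered v w0 w1 u : [fset v; w0; w1]%fset \in K ->
  area v w0 w1 != 0 ->
  (forall w, v != w -> [fset v; w]%fset \in K -> [fset v; w]%fset \in interior_edges K) ->
  exists w w', [/\ [fset v; w; w']%fset \in K, area v w w' != 0,
     0 <= cross u (w' - v) * area v w w' & 0 <= cross (w - v) u * area v w w'].
Proof.
move=> tK D0 alli.
have subK x : x \in [fset v; w0; w1]%fset -> [fset v; x]%fset \in K.
  move=> xt; apply: (face_sub tK).
    by apply/fsubsetP => y; rewrite !inE => /orP[] /eqP ->; rewrite ?eqxx//; move: xt; rewrite !inE.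
  by apply/fset0Pn; exists v; rewrite !inE eqxx.
have [->|u0] := eqVneq u 0.
  by exists w0, w1; split => //; rewrite /cross !mxE; nra.
pose W := [fset w in vertices K | (v != w) && ([fset v; w]%fset \in K)]%fset.
have [wa [waK vwa ca]] : exists wa, [/\ [fset v; wa]%fset \in K, v != wa & cross u (wa - v) != 0].
  have uq := area_neq0_uniq D0; move: (uq); rewrite /= !inE negb_or => /andP[/andP[n0 n1] _].
  have [h0|h0] := eqVneq (cross u (w0 - v)) 0; last first.
    by exists w0; split => //; apply: subK; rewrite !inE eqxx orbT.
  have [h1|h1] := eqVneq (cross u (w1 - v)) 0; last first.
    by exists w1; split => //; apply: subK; rewrite !inE eqxx !orbT.
  exfalso; move: D0; rewrite areaE => /eqP; apply; apply/eqP.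
  have : dot u u * cross (w0 - v) (w1 - v) == 0.
    rewrite (_ : _ * _ = dot u (w0 - v) * cross u (w1 - v) - dot u (w1 - v) * cross u (w0 - v)).
      by rewrite h0 h1 !mulr0 subrr.
    by rewrite /dot /cross; ring.
  by rewrite mulf_eq0 dot_eq0 (negPf u0).
pose s : R := Num.sg (cross u (wa - v)).
have s0 : s != 0 by rewrite sgr_eq0.
have s2 : s * s = 1 by rewrite -expr2 sqr_sg ca.
pose Q (w : W) := 0 < s * cross u (val w - v).
have waW : wa \in W.
  have waV : wa \in vertices K.
    by apply/vertexP; exists [fset v; wa]%fset; rewrite // !inE eqxx orbT.
  by rewrite !inE /= waV vwa waK.
have Qwa : Q [` waW]%fset by rewrite /Q /s /= -normrEsg normr_gt0.
(* The cotangent of the angle between [u] and the edge, for edges on the side [s]: it decreases with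
   the angle, so its maximum selects the edge closest to [u]. *)
pose cot (w : W) : R := dot u (val w - v) / (s * cross u (val w - v)).
case: (@Order.TotalTheory.arg_maxP _ _ W [` waW]%fset Q cot Qwa) => w Qw wmax.
have [wV /andP[vw wK]] : val w \in vertices K /\ (v != val w) && ([fset v; val w]%fset \in K).
  by have := valP w; rewrite !inE /= => /andP[].
have [|w' tK' sw'] := interior_edge_two_sided vw (alli _ vw wK) (_ : - s != 0).
  by rewrite oppr_eq0.
have D0' : area v (val w) w' != 0.
  by apply: contraTneq sw' => ->; rewrite mulr0 ltxx.
have uq := area_neq0_uniq D0'; move: (uq); rewrite /= !inE negb_or => /andP[/andP[_ vw'] _].
have w'K : [fset v; w']%fset \in K.
  apply: (face_sub tK'); last by apply/fset0Pn; exists v; rewrite !inE eqxx.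
  by apply/fsubsetP => y; rewrite !inE => /orP[] ->; rewrite ?orbT.
have w'W : w' \in W.
  have w'V : w' \in vertices K.
    by apply/vertexP; exists [fset v; w']%fset; rewrite // !inE eqxx orbT.
  by rewrite !inE /= w'V vw' w'K.
move: sw'; rewrite areaE => sw'.
have [cpos|cneg] := ltP 0 (s * cross u (w' - v)).
  have := wmax [` w'W]%fset cpos; rewrite /cot /= ler_pdivrMr// mulrAC ler_pdivlMr//.
  rewrite leNgt; case/negP; rewrite -subr_gt0.
  rewrite (_ : _ - _ = dot u u * (- s * cross (val w - v) (w' - v))).
    by rewrite mulr_gt0// lt_def dot_ge0 dot_eq0 u0.
  by rewrite /dot /cross; ring.
exists (val w), w'; split => //; rewrite areaE.
  rewrite (_ : _ * _ = (s * cross u (w' - v)) * (s * cross (val w - v) (w' - v))).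
    by rewrite mulr_le0// -oppr_ge0 -mulNr ltW.
  by rewrite mulrACA s2 mul1r.
rewrite (_ : _ * _ = (- (s * cross u (val w - v))) * (s * cross (val w - v) (w' - v))).
  by rewrite mulr_le0// -?oppr_ge0 -?mulNr ?opprK ltW.
rewrite -[LHS]mul1r -s2 /cross; ring.
Qed.

(** Near [v], the barycentric coordinate at [v] is nonnegative in all triangles at once. The two
    others are linear in [x - v], and some triangle at [v] covers this direction. *)
Lemma all_edges_interior v w0 w1 : [fset v; w0; w1]%fset \in K ->
  area v w0 w1 != 0 ->
  (forall w, v != w -> [fset v; w]%fset \in K -> [fset v; w]%fset \in interior_edges K) ->
  (carrier K)° v.
Proof.
move=> tK D0 alli.
have : \forall x \near v, forall w w' : vertices K, area v (val w) (val w') != 0 ->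
    0 <= area x (val w) (val w') * area v (val w) (val w').
  have := @filter_forall _ _ (fun (w : vertices K) x => forall w' : vertices K,
    area v (val w) (val w') != 0 ->
    0 <= area x (val w) (val w') * area v (val w) (val w')) (nbhs v) _.
  apply=> w /=.
  have := @filter_forall _ _ (fun (w' : vertices K) x =>
    area v (val w) (val w') != 0 ->
    0 <= area x (val w) (val w') * area v (val w) (val w')) (nbhs v) _.
  apply=> w' /=.
  have [D|D] := eqVneq (area v (val w) (val w')) 0; first by apply: nearW => x; rewrite D.
  have c1 : {for v, continuous (fun x => area (val w) (val w') x * area v (val w) (val w'))}.
    exact: (cvgM (@area_continuous _ _ _ v) (cvg_cst _)).
  have g1 : 0 < area (val w) (val w') v * area v (val w) (val w').
    by rewrite -area_rot -expr2 exprn_even_gt0.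
  apply: (filterS _ (cvgr_gt _ c1 _ g1)) => x xg _.
  by rewrite area_rot ltW.
apply: filterS => x h.
have [w [w' [tK' D' c1 c2]]] := directions_covered (x - v) tK D0 alli.
exists [fset v; w; w']%fset => //; apply/(hull3P _ D'); split.
- have wV : w \in vertices K by apply/vertexP; exists [fset v; w; w']%fset; rewrite // !inE eqxx orbT.
  have w'V : w' \in vertices K by apply/vertexP; exists [fset v; w; w']%fset; rewrite // !inE eqxx orbT.
  exact: (h [` wV]%fset [` w'V]%fset D').
- by rewrite areaE.
- by rewrite [area v w x]areaE.
Qed.

End Complex.
End Complexes.

(** * Cells on a disk *)

Section Disk.
Variable R : realType.
Local Notation plane := 'rV[R]_2.
Local Notation disk := (@unit_disk R).
Implicit Types (x y z p q a b d : plane).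

(** The level set of [u x] is both open and closed in [A]. *)
Lemma connected_locally_constant (T : topologicalType) (U : Type) (A : set T)
    (u : T -> U) : connected A ->
  (forall x : T, A x -> \forall y \near x, A y -> u y = u x) ->
  forall x y : T, A x -> A y -> u x = u y.
Proof.
move=> cA uloc x y Ax Ay.
have AB : A `&` [set z | u z = u x] = A.
  apply: cA; first by exists x.
    exists (interior [set z | A z -> u z = u x]); first exact: open_interior.
    apply/seteqP; split => z /= [Az uz]; split => //.
      by have := uloc z Az; apply: filterS => t /[apply] ->.
    exact: (nbhs_singleton uz).
  exists (~` (interior [set z | A z -> u z <> u x])).
    by apply: open_closedC; exact: open_interior.
  apply/seteqP; split => z /= [Az uz]; split => //.
    by move=> /nbhs_singleton; apply.
  apply: contrapT => nz; apply: uz.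
  by have := uloc z Az; apply: filterS => t /[apply] ->.
by have : A y by []; rewrite -AB => -[_ ->].
Qed.

Definition segment x y : set plane := [set (1 - t) *: x + t *: y | t in `[0, 1 : R]].

Lemma segment_left x y : segment x y x.
Proof. by exists 0; rewrite ?subr0 ?scale1r ?scale0r ?addr0//= in_itv/= lexx ler01. Qed.

Lemma segment_right x y : segment x y y.
Proof. by exists 1; rewrite ?subrr ?scale1r ?scale0r ?add0r//= in_itv/= lexx ler01. Qed.

Lemma connected_segment x y : connected (segment x y).
Proof.
apply: connected_continuous_connected; first exact: segment_connected.
by apply: continuous_subspaceT => t; exact: line_continuous.
Qed.

Lemma disk_segment x y z : disk x -> disk y -> segment x y z -> disk z.
Proof.
rewrite /unit_disk /= => dx dy [t /=]; rewrite in_itv/= => /andP[t0 t1] <-.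
rewrite !mxE.
set a := x 0 0 in dx *; set b := x 0 1 in dx *.
set c := y 0 0 in dy *; set d := y 0 1 in dy *.
have h1 : (1 - t) * (a ^+ 2 + b ^+ 2) <= (1 - t) * 1 by apply: ler_wpM2l => //; rewrite subr_ge0.
have h2 : t * (c ^+ 2 + d ^+ 2) <= t * 1 by apply: ler_wpM2l.
have h3 : 0 <= t * (1 - t) * ((a - c) ^+ 2 + (b - d) ^+ 2).
  by rewrite !mulr_ge0 ?subr_ge0 ?addr_ge0 ?sqr_ge0.
by nra.
Qed.

Lemma disk0 : disk 0.
Proof. by rewrite /unit_disk /= !mxE expr0n/= addr0 ler01. Qed.

Lemma disk_delta i : disk (delta_mx 0 i).
Proof.
rewrite /unit_disk /= !mxE/=.
by case: i => -[|[|//]] i; rewrite /= ?expr1n ?expr0n /= ?addr0 ?add0r.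
Qed.

Lemma ball_segment q (r : R) x y z :
  ball q r x -> ball q r y -> segment x y z -> ball q r z.
Proof.
rewrite -ball_normE /= => bx by_ [t /=]; rewrite in_itv/= => /andP[t0 t1] <-.
have -> : q - ((1 - t) *: x + t *: y) = (1 - t) *: (q - x) + t *: (q - y).
  by apply: planeP; rewrite !mxE; ring.
apply: (le_lt_trans (ler_normD _ _)); rewrite !normrZ (ger0_norm t0) ger0_norm ?subr_ge0//.
have [->|tn0] := eqVneq t 0; first by rewrite subr0 mul1r mul0r addr0.
have h1 : (1 - t) * `|q - x| <= (1 - t) * r by rewrite ler_wpM2l ?subr_ge0// ltW.
have h2 : t * `|q - y| < t * r by rewrite ltr_pM2l// lt_def tn0.
by lra.
Qed.

(* The part of the disk in a ball around [q] stays connected without [q]. *)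
Lemma punctured_constant (U : Type) q (r : R) (u : plane -> U) : disk q -> 0 < r ->
  let C := [set x | [/\ disk x, ball q r x & x != q]] in
  (forall x, C x -> \forall y \near x, C y -> u y = u x) ->
  forall x y, C x -> C y -> u x = u y.
Proof.
move=> dq r0 C uloc.
have useg x y : C x -> C y -> ~ segment x y q -> u x = u y.
  move=> [dx bx xq] [dy by_ yq] nq.
  have sC z : segment x y z -> C z.
    move=> sz; split; [exact: disk_segment sz|exact: ball_segment sz|].
    by apply/eqP => zq; apply: nq; rewrite -zq.
  apply: (connected_locally_constant (@connected_segment x y));
    [|exact: segment_left|exact: segment_right].
  by move=> z /sC Cz; have := uloc _ Cz; apply: filterS => t tC /sC.
move=> x y Cx Cy; have [sq|] := pselect (segment x y q); last exact: useg.
have [dx bx xq] := Cx; have [dy by_ yq] := Cy.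
(* The segment from [x] to [y] passes through [q]: the detour goes through a point [z] off the line
   [x q], found by moving slightly from [q] towards one of three non-collinear points of the
   disk. *)
have [d dd d0] : exists2 d, disk d & area x q d != 0.
  have [h0|] := eqVneq (area x q 0) 0; last by exists 0 => //; exact: disk0.
  have [h1|] := eqVneq (area x q (delta_mx 0 0)) 0; last by exists (delta_mx 0 0) => //; exact: disk_delta.
  have [h2|] := eqVneq (area x q (delta_mx 0 1)) 0; last by exists (delta_mx 0 1) => //; exact: disk_delta.
  exfalso; move/eqP: xq; apply; move: h0 h1 h2; rewrite /area !mxE /= => h0 h1 h2.
  by apply: planeP; apply/eqP; rewrite -subr_eq0; apply/eqP; lra.
have [z [dz bz az]] : exists z, [/\ disk z, ball q r z & area x q z != 0].
  have nb : \forall z \near q, ball q r z by exact: nbhsx_ballx.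
  have := near_ray (d - q) nb; move=> h.
  have : \forall t \near 0^'+, [/\ (0 : R) < t, t < 1 & ball q r (q + t *: (d - q))].
    near=> t; split; [near: t; exact: nbhs_right_gt|near: t; exact: nbhs_right_lt|].
    by near: t; exact: h.
  move=> /filter_ex[t [t0 t1 bt]].
  have zE : q + t *: (d - q) = (1 - t) *: q + t *: d by apply: planeP; rewrite !mxE; ring.
  exists (q + t *: (d - q)); split => //.
    apply: (disk_segment dq dd); exists t; rewrite ?zE//= in_itv/= !ltW//.
  by rewrite zE area_mean area_vuu mulr0 add0r mulf_neq0// gt_eqF.
have zq : z != q by apply: contra_neq az => ->; rewrite area_vuu.
have Cz : C z by split.
transitivity (u z); [apply: useg => //|apply/esym; apply: useg => //].
  move=> [t _ tE]; have : area x q q = 0 by rewrite area_vuu.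
  rewrite -{2}tE area_mean area_vuv mulr0 add0r => /eqP; rewrite mulf_eq0 (negPf az) orbF => /eqP t0.
  by move/eqP: xq; apply; rewrite -tE t0 subr0 scale1r scale0r addr0.
have ay : area x q y = 0.
  move: sq => [t _ tE]; have : area x q q = 0 by rewrite area_vuu.
  rewrite -{2}tE area_mean area_vuv mulr0 add0r => /eqP; rewrite mulf_eq0 => /orP[/eqP t0|/eqP//].
  by exfalso; move/eqP: xq; apply; rewrite -tE t0 subr0 scale1r scale0r addr0.
move=> [t _ tE]; have : area x q q = 0 by rewrite area_vuu.
rewrite -{2}tE area_mean ay mulr0 add0r => /eqP; rewrite mulf_eq0 (negPf az) orbF => /eqP t0.
by move/eqP: yq; apply; rewrite -tE t0 subr0 scale1r scale0r addr0.
Unshelve. all: by end_near. Qed.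

Lemma within_near (X : set plane) (f : plane -> plane) p (P : set plane) :
  {within X, continuous f} -> X p -> (\forall y \near f p, P y) ->
  \forall x \near p, X x -> P (f x).
Proof. by move=> /subspace_continuousP h Xp Pf; have := h _ Xp _ Pf. Qed.

(** * Sets homeomorphic to the disk and their finite closed coverings *)

Section Homeo.
Variables (X : set plane) (f g : plane -> plane).
Hypotheses (fc : {within X, continuous f}) (gc : {within disk, continuous g})
  (fX : forall x, X x -> disk (f x) /\ g (f x) = x)
  (gX : forall y, disk y -> X (g y) /\ f (g y) = y).

(** In the disk, the points near [f p] other than [f p] form a connected set, on which membership in
    [A] is locally constant. So one of the two closed pieces reduces to [p] near [p]. *)
Lemma homeo_no_local_cut p (A B : set plane) : X p -> closed A -> closed B ->
  (\forall x \near p, X x -> A x \/ B x) ->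
  (\forall x \near p, X x -> A x -> B x -> x = p) ->
  (\forall x \near p, X x -> A x -> x = p) \/
  (\forall x \near p, X x -> B x -> x = p).
Proof.
move=> Xp cA cB AB ABp; have [dq gq] := fX Xp; set q := f p in dq gq *.
have [r r0 hr] : exists2 r : R, 0 < r & forall y, disk y -> ball q r y ->
    (A (g y) \/ B (g y)) /\ (A (g y) -> B (g y) -> g y = p).
  have : \forall x \near g q, X x -> (A x \/ B x) /\ (A x -> B x -> x = p).
    rewrite gq; near=> x => Xx; split; last by move: Xx; near: x.
    by move: Xx; near: x.
  move/(within_near gc dq) => /nbhs_ballP[r r0 hr]; exists r => // y dy byr.
  by apply: (hr y byr dy); have [] := gX dy.
have gnp y : disk y -> y != q -> g y <> p.
  by move=> dy /eqP yq gyp; apply: yq; rewrite /q -gyp; have [_ ->] := gX dy.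
pose u y : bool := `[< A (g y) >].
have loc y : disk y -> ball q r y -> y != q -> \forall z \near y,
    [/\ disk z, ball q r z & z != q] -> u z = u y.
  move=> dy byr yq; have [or_ and_] := hr y dy byr.
  have [Ay|nAy] := pselect (A (g y)).
    have nB : ~ B (g y) by move=> By; exact: (gnp y dy yq (and_ Ay By)).
    have : \forall x \near g y, ~ B x.
      by apply: open_nbhs_nbhs; split => //; exact: closed_openC.
    move/(within_near gc dy); apply: filterS => z h [dz bz zq].
    rewrite /u !asboolT//; have [[//|Bz] _] := hr z dz bz.
    by have := h dz.
  have : \forall x \near g y, ~ A x.
    by apply: open_nbhs_nbhs; split => //; exact: closed_openC.
  move/(within_near gc dy); apply: filterS => z h [dz bz zq].
  by rewrite /u !asboolF//; exact: h.
have uc x y : [/\ disk x, ball q r x & x != q] -> [/\ disk y, ball q r y & y != q] -> u x = u y.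
  apply: (punctured_constant dq r0) => z [dz bz zq]; exact: loc.
have nball : \forall x \near p, X x -> ball q r (f x).
  by apply: (within_near fc Xp); exact: nbhsx_ballx.
have fnq x : X x -> x != p -> f x != q.
  by move=> Xx; apply: contra_neq => fxq; have [_ <-] := fX Xx; rewrite fxq gq.
have [[y [dy byr yq] uy]|nu] := pselect (exists2 y, [/\ disk y, ball q r y & y != q] & u y).
  right; near=> x => Xx Bx; apply/eqP/negPn/negP => xp.
  have [df gf] := fX Xx.
  have bx : ball q r (f x) by move: Xx; near: x.
  have Ax : A x.
    by rewrite -gf; apply/asboolP; rewrite -/(u (f x)) (uc _ y)//; split => //; exact: fnq.
  by move/eqP: xp; apply; move: Xx Ax Bx; near: x.
left; near=> x => Xx Ax; apply/eqP/negPn/negP => xp.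
have [df gf] := fX Xx.
apply: nu; exists (f x); last by apply/asboolP; rewrite gf.
split => //; last exact: fnq.
by move: Xx; near: x.
Unshelve. all: by end_near. Qed.

Lemma homeo_not_isolated p : X p -> ~ (\forall x \near p, X x -> x = p).
Proof.
move=> Xp iso; have [dq gq] := fX Xp; set q := f p in dq gq *.
have [d dd dq'] : exists2 d, disk d & d != q.
  have [<-|q0] := eqVneq 0 q; last by exists 0 => //; exact: disk0.
  exists (delta_mx 0 0); first exact: disk_delta.
  by apply/eqP => /matrixP/(_ 0 0)/eqP; rewrite !mxE /= oner_eq0.
have h1 : \forall y \near q, disk y -> X (g y) -> g y = p.
  move: iso; rewrite -{1}gq => iso.
  by have := within_near gc dq iso; apply: filterS => y h /[dup] dy /h.
have h := near_ray (d - q) h1.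
have : \forall t \near 0^'+, [/\ (0 : R) < t, t < 1 &
   disk (q + t *: (d - q)) -> X (g (q + t *: (d - q))) -> g (q + t *: (d - q)) = p].
  near=> t; split; [near: t; exact: nbhs_right_gt|near: t; exact: nbhs_right_lt|].
  by near: t; exact: h.
move=> /filter_ex[t [t0 t1 gt]].
have dz : disk (q + t *: (d - q)).
  apply: (disk_segment dq dd); exists t; rewrite /= ?in_itv/= ?ltW//.
  by apply: planeP; rewrite !mxE; ring.
have [Xz fz] := gX dz.
have : q + t *: (d - q) == q by rewrite -{1}fz gt.
rewrite -subr_eq0 addrAC subrr add0r scaler_eq0 gt_eqF//= subr_eq0.
by rewrite (negPf dq').
Unshelve. all: by end_near. Qed.

Variables (T : finType) (A : T -> set plane).
Hypotheses (Acl : forall t, closed (A t)) (AX : forall x, X x <-> exists t, A t x).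

Lemma near_cells a : disk a -> \forall b \near a, disk b -> forall t, A t (g b) -> A t (g a).
Proof.
move=> da; apply: (@within_near disk g a (fun x => forall t, A t x -> A t (g a)) gc da).
have := @filter_forall _ _ (fun (t : T) x => A t x -> A t (g a)) (nbhs (g a)) _.
apply=> t; have [h|h] := pselect (A t (g a)); first by apply: nearW.
have : \forall x \near g a, ~ A t x.
  by apply: open_nbhs_nbhs; split => //; exact: closed_openC.
by apply: filterS => x nA /nA.
Qed.

Lemma cell_choice : exists tau : plane -> T, forall a, disk a -> A (tau a) (g a).
Proof.
have [t0 _] : exists t, A t (g 0) by apply/AX; have [] := gX disk0.
have : forall a, exists t, disk a -> A t (g a).
  move=> a; have [da|nd] := pselect (disk a); last by exists t0.
  by have [/AX[t At] _] := gX da; exists t.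
by move=> /choice[tau tauP]; exists tau.
Qed.

(** Along a radius of the disk the value of [P] at a chosen cell is locally constant: the cells
    chosen near a point all contain the image of that point. *)
Lemma homeo_connected (U : Type) (P : T -> U) :
  (forall t t' x, A t x -> A t' x -> P t = P t') ->
  forall t t' x x', A t x -> A t' x' -> P t = P t'.
Proof.
move=> PA; have [tau tauP] := cell_choice.
have loc a : disk a -> P (tau a) = P (tau 0).
  move=> da; apply: (connected_locally_constant (@connected_segment 0 a)
     (u := fun b => P (tau b))); [|exact: segment_right|exact: segment_left].
  move=> b sb; have db : disk b := disk_segment disk0 da sb.
  have := near_cells db; apply: filterS => c h sc.
  have dc : disk c := disk_segment disk0 da sc.
  by apply: (PA _ _ (g b)); [apply: h => //; exact: tauP|exact: tauP].
move=> t t' x x' Ax Ax'.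
have H s y : A s y -> P s = P (tau 0).
  move=> sy; have Xy : X y by apply/AX; exists s.
  have [df gf] := fX Xy; rewrite -(loc _ df); apply: (PA _ _ y) => //.
  by rewrite -{2}gf; exact: tauP.
by rewrite (H t x Ax) (H t' x' Ax').
Qed.

Lemma disk_compact : compact disk.
Proof.
apply: (@subclosed_compact _ _ [set v : plane | forall i, `[-1, 1 : R]%classic (v ord0 i)]).
- rewrite (_ : disk = [set x | 0 <= 1 - (x 0 0 * x 0 0 + x 0 1 * x 0 1)]).
    apply: closed_area_ge => x.
    have c0 := @coord0_continuous R x; have c1 := @coord1_continuous R x.
    exact: (cvgB (cvg_cst _) (cvgD (cvgM c0 c0) (cvgM c1 c1))).
  by apply/seteqP; split => x; rewrite /unit_disk /= subr_ge0 -!expr2.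
- exact: (@rV_compact R 2 (fun=> `[-1, 1]%classic) (fun _ => @segment_compact R _ _)).
- move=> x; rewrite /unit_disk /= => dx i; rewrite in_itv/=.
  have : x ord0 i ^+ 2 <= 1.
    case: i => -[|[|//]] i.
      rewrite (_ : Ordinal i = 0); last exact/val_inj.
      by apply: le_trans dx; rewrite lerDl sqr_ge0.
    rewrite (_ : Ordinal i = 1); last exact/val_inj.
    by apply: le_trans dx; rewrite lerDr sqr_ge0.
  by move=> h; apply/andP; split; nra.
Qed.

Lemma disk_bounded : exists2 M : R, 0 < M & forall a, disk a -> `|a| <= M.
Proof.
have := compact_bounded disk_compact.
by move=> /pinfty_ex_gt0[M M0 h]; exists M => // a /h.
Qed.

(* A Lebesgue number for the cells, transported to the disk. *)
Lemma cell_lebesgue (tau : plane -> T) : (forall a, disk a -> A (tau a) (g a)) ->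
  exists2 e : R, 0 < e & forall a b c, disk a -> disk b -> disk c ->
    `|a - b| < e -> `|a - c| < e ->
    exists x, [/\ A (tau a) x, A (tau b) x & A (tau c) x].
Proof.
move=> tauP.
pose P (e : R) a := forall b c, disk a -> disk b -> disk c -> `|a - b| < e -> `|a - c| < e ->
    exists x, [/\ A (tau a) x, A (tau b) x & A (tau c) x].
have : \forall e \near 0^'+, disk `<=` P e.
  have /compact_near_coveringP cov := disk_compact.
  apply: cov => a0 da0.
  have /nbhs_ballP[e0 e00 he0] := near_cells da0.
  have e02 : 0 < e0 / 2 by rewrite divr_gt0.
  near=> a e => b c da db dc ab ac; exists (g a0).
  have ae : ball a0 (e0 / 2) a by near: a; exact: nbhsx_ballx.
  have ee : e < e0 / 2 by near: e; exact: nbhs_right_lt.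
  move: ae; rewrite -ball_normE /= => ae.
  have bnear z : `|a - z| < e -> ball a0 e0 z.
    move=> az; rewrite -ball_normE /= -(subrK a a0) -addrA.
    apply: (le_lt_trans (ler_normD _ _)); rewrite [ltRHS](splitr e0).
    by apply: ltrD => //; exact: lt_trans az ee.
  have aa : ball a0 e0 a.
    by rewrite -ball_normE /=; apply: lt_trans ae _; rewrite ltr_pdivrMr// mulr2n mulrDr mulr1 ltrDl.
  by split; [exact: (he0 a aa da _ (tauP _ da))|exact: (he0 b (bnear _ ab) db _ (tauP _ db))|
    exact: (he0 c (bnear _ ac) dc _ (tauP _ dc))].
move=> h; have : \forall e \near 0^'+, (0 : R) < e /\ disk `<=` P e.
  by apply: filterI => //; exact: nbhs_right_gt.
move=> /filter_ex[e [e0 he]]; exists e => // a b c da; exact: he.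
Unshelve. all: by end_near. Qed.

(* Alexander-Spanier primitive: integrate the cocycle along the segment from the
   centre of the disk, which is star-shaped. *)
Lemma homeo_nerve_exact (c : T -> T -> R) :
  (forall t, connected (A t)) ->
  (forall x t1 t2 t3, A t1 x -> A t2 x -> A t3 x -> c t1 t2 + c t2 t3 = c t1 t3) ->
  exists phi : T -> R, forall t t' x, A t x -> A t' x -> c t t' = phi t' - phi t.
Proof.
move=> Ac cc; have [tau tauP] := cell_choice.
have [e e0 he] := cell_lebesgue tauP.
have [M M0 hM] := disk_bounded.
(* Each radius is cut into [n] steps shorter than [e / 2], so that the diagonals between two
   neighboring radii are shorter than [e]. *)
have [n n0 nM] : exists2 n, (0 < n)%N & M / n%:R < e / 2.
  have [n hn] : exists n, 2 * M / e < n%:R.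
    exists (Num.bound (2 * M / e)); apply: archi_boundP.
    by rewrite divr_ge0 ?ltW// mulr_gt0.
  have n0 : (0 < n)%N by rewrite -(ltr0n R); apply: le_lt_trans hn; rewrite divr_ge0 ?ltW// mulr_gt0.
  exists n => //; rewrite ltr_pdivrMr ?ltr0n//.
  move: hn; rewrite ltr_pdivrMr// => hn.
  by rewrite mulrAC ltr_pdivlMr// mulrC [e * _]mulrC.
have nR0 : n%:R != 0 :> R by rewrite pnatr_eq0 -lt0n.
pose sc (i : nat) a : plane := (i%:R / n%:R) *: a.
have scd i a : (i <= n)%N -> disk a -> disk (sc i a).
  move=> ilen da; apply: (disk_segment disk0 da); exists (i%:R / n%:R).
    by rewrite /= in_itv/= divr_ge0 ?ler0n//= ler_pdivrMr ?ltr0n// mul1r ler_nat.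
  by rewrite scaler0 add0r.
pose F a : R := \sum_(i < n) c (tau (sc i a)) (tau (sc i.+1 a)).
have ctt a : disk a -> c (tau a) (tau a) = 0.
  move=> da; have := cc (g a) (tau a) (tau a) (tau a) (tauP a da) (tauP a da) (tauP a da).
  by move/eqP; rewrite -subr_eq0 addrK => /eqP.
have Fdiff a b : disk a -> disk b -> `|a - b| < e / 2 -> F b - F a = c (tau a) (tau b).
  move=> da db ab.
  have scab i : (i <= n)%N -> `|sc i a - sc i b| < e / 2.
    move=> ilen; rewrite -scalerBr normrZ ger0_norm ?divr_ge0 ?ler0n//.
    apply: le_lt_trans ab; rewrite ler_piMl//.
    by rewrite ler_pdivrMr ?ltr0n// mul1r ler_nat.
  have scS i x : (i < n)%N -> disk x -> `|sc i x - sc i.+1 x| < e / 2.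
    move=> ilt dx; rewrite -scalerBl -mulrBl -natr1 opprD addrA subrr add0r mulN1r scaleNr normrN.
    rewrite normrZ ger0_norm ?invr_ge0 ?ler0n//.
    apply: le_lt_trans nM; rewrite mulrC ler_wpM2r ?invr_ge0 ?ler0n//.
    exact: hM.
  (* A ladder between the radii of [a] and [b]: each square is cut along the diagonal from [sc k a]
     to [sc k.+1 b], and the cocycle identity holds on both halves because their three cells
     meet. *)
  have lad k : (k <= n)%N ->
      \sum_(i < k) c (tau (sc i b)) (tau (sc i.+1 b)) -
      \sum_(i < k) c (tau (sc i a)) (tau (sc i.+1 a)) = c (tau (sc k a)) (tau (sc k b)).
    elim: k => [_|k IH klt].
      by rewrite !big_ord0 subr0 /sc mul0r !scale0r ctt//; exact: disk0.
    rewrite !big_ord_recr/= opprD addrACA IH; last exact: ltnW.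
    have e2 : e / 2 < e by rewrite ltr_pdivrMr// mulr2n mulrDr mulr1 ltrDl.
    have [dka dkb] := (scd k a (ltnW klt) da, scd k b (ltnW klt) db).
    have [dka' dkb'] := (scd k.+1 a klt da, scd k.+1 b klt db).
    have kk : `|sc k a - sc k.+1 b| < e.
      rewrite -(subrK (sc k b) (sc k a)) -addrA.
      apply: (le_lt_trans (ler_normD _ _)); rewrite [ltRHS](splitr e).
      by apply: ltrD; [apply: scab; exact: ltnW|exact: scS].
    have [x [x1 x2 x3]] := he _ _ _ dka dkb dkb' (lt_trans (scab k (ltnW klt)) e2) kk.
    have [y [y1 y2 y3]] := he _ _ _ dka dka' dkb' (lt_trans (scS k a klt da) e2) kk.
    rewrite addrA (cc _ _ _ _ x1 x2 x3) -(cc _ _ _ _ y1 y2 y3).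
    by rewrite addrAC subrr add0r.
  have := lad n (leqnn n); rewrite -/(F a) -/(F b) => ->.
  by rewrite /sc divff// !scale1r.
(* The integral up to [a], followed by the step into the cell [t]. It is locally constant as the
   image of [a] moves in [t], hence depends only on [t] because cells are connected. *)
pose u a t : R := F a + c (tau a) t.
have near_norm a : \forall b \near a, `|a - b| < e / 2.
  have : nbhs a (ball a (e / 2)) by apply: nbhsx_ballx; rewrite divr_gt0.
  by apply: filterS => b; rewrite -ball_normE.
have uloc t x : A t x -> \forall y \near x, A t y -> u (f y) t = u (f x) t.
  move=> tx; have Xx : X x by apply/AX; exists t.
  have [df gf] := fX Xx.
  have h1 := within_near fc Xx (near_norm (f x)).
  have h2 := within_near fc Xx (near_cells df).
  near=> y => ty; have Xy : X y by apply/AX; exists t.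
  have [dfy gfy] := fX Xy.
  have n1 : `|f x - f y| < e / 2 by move: Xy; near: y; exact: h1.
  have n2 : forall t, A t (g (f y)) -> A t (g (f x)).
    by move: Xy dfy; near: y; exact: h2.
  rewrite /u -(subrK (F (f x)) (F (f y))) Fdiff// addrAC (cc x) 1?addrC//.
  - by rewrite -{2}gf; exact: tauP.
  - by rewrite -gf; apply: n2; exact: tauP.
have uconst t x y : A t x -> A t y -> u (f x) t = u (f y) t.
  by apply: (connected_locally_constant (Ac t) (u := fun x => u (f x) t)) => z; exact: uloc.
have : forall t, exists s : R, forall x, A t x -> u (f x) t = s.
  move=> t; have [[x tx]|nx] := pselect (exists x, A t x).
    by exists (u (f x) t) => y ty; exact: uconst.
  by exists 0 => x tx; exfalso; apply: nx; exists x.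
move=> /choice[phi phiP]; exists phi => t t' x tx t'x.
have Xx : X x by apply/AX; exists t.
have [df gf] := fX Xx.
rewrite -(phiP t x tx) -(phiP t' x t'x) /u opprD addrACA subrr add0r.
rewrite -(cc x (tau (f x)) t t')//; first by rewrite addrAC subrr add0r.
by rewrite -{2}gf; exact: tauP.
Unshelve. all: by end_near. Qed.

End Homeo.
End Disk.

(** * Exactness of the cochain complex *)

Section Exactness.
Variable R : realType.
Local Notation plane := 'rV[R]_2.
Implicit Types (v w u x y p : plane) (b e t : {fset plane}).

Lemma hull_segment b x y z : hull b x -> hull b y -> segment x y z -> hull b z.
Proof.
move=> /hullP[a [a0 a1 ->]] /hullP[c [c0 c1 ->]] [t /=]; rewrite in_itv/= => /andP[t0 t1] <-.
apply/hullP; exists (fun v => (1 - t) * a v + t * c v); split.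
- by move=> v vb; rewrite addr_ge0// mulr_ge0 ?subr_ge0 ?a0 ?c0.
- by rewrite big_split/= -!mulr_sumr a1 c1 !mulr1 subrK.
- rewrite !scaler_sumr -big_split/=; apply: eq_bigr => v _.
  by rewrite !scalerA scalerDl.
Qed.

Lemma connected_hull b : connected (hull b).
Proof.
have [[x hx]|nx] := pselect (exists x, hull b x); last first.
  rewrite (_ : hull b = set0); first exact: connected0.
  by apply/seteqP; split => x // hx; apply: nx; exists x.
rewrite (_ : hull b = \bigcup_(y in hull b) segment x y).
  apply: bigcup_connected => [|y _]; last exact: connected_segment.
  by exists x => y _; exact: segment_left.
apply/seteqP; split => [y hy|y [z hz]]; first by exists y => //; exact: segment_right.
exact: hull_segment.
Qed.

Lemma sum_pred2 (V : nmodType) (T : eqType) (s : seq T) (F : T -> V) (a b : T) :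
  uniq s -> a != b ->
  \sum_(i <- s | (i == a) || (i == b)) F i =
  (if a \in s then F a else 0) + (if b \in s then F b else 0).
Proof.
move=> us ab.
have one c : (if c \in s then F c else 0) = \sum_(i <- s | i == c) F i.
  case: ifPn => cs; first by rewrite -big_filter (filter_pred1_uniq us cs) big_seq1.
  rewrite big_seq_cond big_pred0// => i; apply/andP => -[si /eqP ic].
  by rewrite -ic si in cs.
rewrite !one (bigID (pred1 a))/=; congr (_ + _); apply: eq_bigl => i /=.
  by case: eqP => //= _; rewrite andbF.
by have [->|] := eqVneq i a; rewrite /= ?(negPf ab) ?andbT.
Qed.

(** The Fredholm alternative: a row vector lies in the row space of a matrix once it kills every
    column vector that the matrix kills. The columns of the cokernel matrix are enough as tests. *)
Lemma solvable_dual (I J : finType) (D : I -> J -> R) (g : J -> R) :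
  (forall o : J -> R, (forall i, \sum_j D i j * o j = 0) -> \sum_j g j * o j = 0) ->
  exists phi : I -> R, forall j, \sum_i D i j * phi i = g j.
Proof.
move=> dual.
pose M : 'M[R]_(#|I|, #|J|) := \matrix_(i, j) D (enum_val i) (enum_val j).
pose G : 'rV[R]_#|J| := \row_j g (enum_val j).
have /submxP[X GX] : (G <= M)%MS.
  rewrite submxE; apply/eqP/matrixP => i k; rewrite !mxE.
  rewrite -[RHS](dual (fun j => cokermx M (enum_rank j) k)) => [|i'].
    rewrite (reindex (@enum_rank J))/=; last by apply: onW_bij; exact: enum_rank_bij.
    by apply: eq_bigr => j _; rewrite !mxE enum_rankK.
  have /matrixP/(_ (enum_rank i') k) := mulmx_coker M.
  rewrite !mxE (reindex (@enum_rank J))/=; last by apply: onW_bij; exact: enum_rank_bij.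
  by move=> h; rewrite -[RHS]h; apply: eq_bigr => j _; rewrite !mxE !enum_rankK.
exists (fun i => X 0 (enum_rank i)) => j.
have /matrixP/(_ 0 (enum_rank j)) := GX; rewrite !mxE enum_rankK => ->.
rewrite (reindex (@enum_rank I))/=; last by apply: onW_bij; exact: enum_rank_bij.
by apply: eq_bigr => i _; rewrite !mxE !enum_rankK mulrC.
Qed.

(** The lexicographic order of the plane orients all edges at once. *)
Definition orient v w : R :=
  if v 0 0 == w 0 0 then Num.sg (w 0 1 - v 0 1) else Num.sg (w 0 0 - v 0 0).

Lemma orient_vv v : orient v v = 0.
Proof. by rewrite /orient eqxx subrr sgr0. Qed.

Lemma orientC v w : orient w v = - orient v w.
Proof. by rewrite /orient eq_sym; case: ifP => _; rewrite -sgrN opprB. Qed.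

Lemma orient_sqr v w : v != w -> orient v w * orient v w = 1.
Proof.
move=> vw; rewrite -expr2 /orient; case: eqP => [v0|/eqP v0]; rewrite sqr_sg subr_eq0.
  by case: eqP => // v1; move/eqP: vw; case; apply: planeP.
by rewrite eq_sym v0.
Qed.

(** The incidence sign of [v] in the oriented edge [e]. Edges are unordered sets, and the sum picks
    out the other end, since the term of [v] itself is 0. *)
Definition vsign v e : R := \sum_(w <- e) orient v w.

Lemma vsignE v w : v != w -> vsign v [fset v; w]%fset = orient v w.
Proof. by move=> vw; rewrite /vsign big_fset2// orient_vv add0r. Qed.

(* The sign with which an oriented triangle meets an oriented edge: the ordered pairs
   of distinct vertices of [e] contribute twice the same amount. *)
Definition tsign t e : R :=
  2^-1 * \sum_(v <- e) \sum_(w <- e) \sum_(u <- t) orient v w * Num.sg (area v w u).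

Lemma tsignE v w u : area v w u != 0 ->
  tsign [fset v; w; u]%fset [fset v; w]%fset = orient v w * Num.sg (area v w u).
Proof.
move=> D; have uq := area_neq0_uniq D.
have vw : v != w by move: uq => /= /andP[]; rewrite inE negb_or => /andP[].
rewrite /tsign !big_fset2// !big_fset3// !orient_vv.
rewrite !area_vuv !area_vuu sgr0 !mulr0 !mul0r !add0r ?addr0.
have -> : area w v u = - area v w u by rewrite /area; ring.
by rewrite (orientC v w) sgrN mulrNN; field.
Qed.

Section Complex.
Variables (K : {fset {fset plane}}) (KC : simplicial_complex K).

Lemma closed_face_union (S : {fset plane} -> Prop) :
  closed [set x | exists2 t, t \in K /\ S t & hull t x].
Proof.
move=> x /(_ _ (local_star KC x))[y [[t [tK St] ty] h]].
by exists t => //; exact: h.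
Qed.

Lemma triangle_edge t v w : t \in faces K 2 -> v \in t -> w \in t -> v != w ->
  exists2 u, t = [fset v; w; u]%fset & area v w u != 0.
Proof.
move=> /faceP[tK t3] vt wt vw.
have [u ut uvw] : exists2 u, u \in t & u \notin [fset v; w]%fset.
  apply/fsubsetPn; apply/negP => /fsubset_leq_card.
  by rewrite t3 cardfs2 vw.
move: (uvw); rewrite !inE negb_or => /andP[uv uw].
have uq : uniq [:: v; w; u] by rewrite /= !inE negb_or vw !(eq_sym _ u) uv uw.
have tE : t = [fset v; w; u]%fset.
  apply/esym/eqP; rewrite eqEfcard; apply/andP; split.
    by apply/fsubsetP => y; rewrite !inE => /orP[/orP[]|] /eqP ->.
  by rewrite t3 fsetUC cardfsU1 uvw cardfs2 vw.
by exists u => //; apply: (affine_indep_area KC); rewrite -?tE.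
Qed.

Lemma triangle_vertex t v : t \in faces K 2 -> v \in t ->
  exists w u, t = [fset v; w; u]%fset /\ area v w u != 0.
Proof.
move=> tK vt; have /faceP[_ t3] := tK.
have [w wt wv] : exists2 w, w \in t & w \notin [fset v]%fset.
  by apply/fsubsetPn; apply/negP => /fsubset_leq_card; rewrite t3 cardfs1.
have vw : v != w by move: wv; rewrite inE eq_sym.
by have [u tE D] := triangle_edge tK vt wt vw; exists w, u.
Qed.

Lemma triangle_face v w u : area v w u != 0 -> [fset v; w; u]%fset \in K ->
  [fset v; w; u]%fset \in faces K 2.
Proof.
move=> D tK; apply/faceP; split => //.
have := area_neq0_uniq D; rewrite /= !inE !negb_or andbT -andbA => /and3P[vw vu wu].
by rewrite fsetUC cardfsU1 cardfs2 vw !inE negb_or !(eq_sym u) vu wu.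
Qed.

(** Two triangles on the same side of the edge would coincide, so distinct ones lie on opposite
    sides. *)
Lemma shared_edge_interior t t' v w : t \in faces K 2 -> t' \in faces K 2 -> t != t' ->
  v != w -> v \in t -> w \in t -> v \in t' -> w \in t' ->
  [fset v; w]%fset \in interior_edges K.
Proof.
move=> tK tK' tt' vw vt wt vt' wt'.
have [u tE D] := triangle_edge tK vt wt vw.
have [u' tE' D'] := triangle_edge tK' vt' wt' vw.
have /faceP[tK0 _] := tK; have /faceP[tK0' _] := tK'.
rewrite tE in tK0; rewrite tE' in tK0'.
apply: (two_sided_interior_edge KC tK0 tK0').
rewrite lt_neqAle mulf_neq0//= leNgt; apply/negP => h.
by move/eqP: tt'; apply; rewrite tE tE' (tri_side_unique KC tK0 tK0' h).
Qed.

Lemma edge_ends e : e \in faces K 1 -> forall v, v \in e ->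
  exists2 w, v != w & e = [fset v; w]%fset.
Proof.
move=> /faceP[eK e2] v ve; have [a [b [ab eE]]] := card2_fset e2.
move: ve; rewrite eE !inE => /orP[] /eqP ->; first by exists b.
by exists a; rewrite 1?eq_sym// fsetUC.
Qed.

Lemma interior_edge_face e : e \in interior_edges K -> e \in faces K 1.
Proof. by move=> /interior_edgeP[]. Qed.

Lemma interior_edge_ends e : e \in interior_edges K ->
  exists v w, v != w /\ e = [fset v; w]%fset.
Proof. by move=> /interior_edgeP[/faceP[_ /card2_fset]]. Qed.

(** Each side has a triangle, and any further triangle on the edge would share its side with one of
    these two. *)
Lemma interior_edge_triangles v w : v != w -> [fset v; w]%fset \in interior_edges K ->
  exists u u', [/\ [fset v; w; u]%fset \in faces K 2, [fset v; w; u']%fset \in faces K 2,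
    0 < area v w u, area v w u' < 0 &
    forall t, (t \in faces K 2) && ([fset v; w] `<=` t)%fset =
      (t == [fset v; w; u]%fset) || (t == [fset v; w; u']%fset)].
Proof.
move=> vw eI.
have [u tK sg] := interior_edge_two_sided KC vw eI (oner_neq0 R).
have [|u' tK' sg'] := interior_edge_two_sided KC vw eI (_ : -1 != 0 :> R).
  by rewrite oppr_eq0 oner_eq0.
rewrite mul1r in sg; rewrite mulN1r oppr_gt0 in sg'.
have D : area v w u != 0 by rewrite gt_eqF.
have D' : area v w u' != 0 by rewrite lt_eqF.
have tF := triangle_face D tK; have tF' := triangle_face D' tK'.
exists u, u'; split => // t; apply/andP/orP => [[tt /fsubsetP et]|].
  have [u'' tE D''] := triangle_edge tt (et v (fset21 _ _)) (et w (fset22 _ _)) vw.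
  have /faceP[tK'' _] := tt; rewrite tE in tK''.
  have [pos|neg|/eqP] := ltgtP (area v w u'') 0; last by rewrite (negPf D'').
    by right; rewrite tE (tri_side_unique KC tK'' tK')// nmulr_rgt0.
  by left; rewrite tE (tri_side_unique KC tK'' tK)// pmulr_rgt0.
by case=> /eqP ->; split => //; apply/fsubsetP => y; rewrite !inE => /orP[] ->; rewrite ?orbT.
Qed.

Lemma coboundaryE (V : lmodType R) (phi : {fset plane} -> V) v w u u' :
  v != w -> 0 < area v w u -> area v w u' < 0 ->
  [fset v; w; u]%fset \in faces K 2 -> [fset v; w; u']%fset \in faces K 2 ->
  (forall t, (t \in faces K 2) && ([fset v; w] `<=` t)%fset =
      (t == [fset v; w; u]%fset) || (t == [fset v; w; u']%fset)) ->
  \sum_(t <- faces K 2 | ([fset v; w] `<=` t)%fset) tsign t [fset v; w]%fset *: phi t =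
  orient v w *: (phi [fset v; w; u]%fset - phi [fset v; w; u']%fset).
Proof.
move=> vw sg sg' tK tK' tE.
have tt' : [fset v; w; u]%fset != [fset v; w; u']%fset.
  apply/eqP => /fsetP/(_ u); rewrite !inE eqxx orbT => /esym.
  have /= := area_neq0_uniq (lt0r_neq0 sg).
  rewrite !inE !negb_or andbT -andbA => /and3P[_ vu wu].
  rewrite !(eq_sym u) (negPf vu) (negPf wu)/= => /eqP uu.
  by move: sg; rewrite -uu ltNge ltW.
rewrite big_seq_cond (eq_bigl _ _ tE) sum_pred2 ?fset_uniq//.
have [D D'] : area v w u != 0 /\ area v w u' != 0 by rewrite gt_eqF// lt_eqF.
rewrite ifT// ifT// !tsignE//.
by rewrite (gtr0_sg sg) (ltr0_sg sg') mulr1 mulrN1 scaleNr scalerBr.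
Qed.

(** * Combinatorial consequences of the disk hypothesis *)

Section Disk.
Hypothesis KD : homeomorphic (carrier K) (@unit_disk R).

Lemma face_eq_sub b b' : b \in K -> (b' `<=` b)%fset -> #|` b'| = 2%N -> b != b' ->
  b \in faces K 2.
Proof.
move=> bK b'b b'2 bb'; apply/faceP; split => //; apply/eqP.
rewrite eqn_leq (face_card KC bK)/= -[X in (X < _)%N]b'2.
by apply: fproper_ltn_card; rewrite fproperEneq eq_sym bb' b'b.
Qed.

(** Otherwise the carrier is the edge alone near its midpoint, which cuts it into two halves,
    neither of them reduced to a point. *)
Lemma edge_in_triangle e : e \in faces K 1 -> exists2 t, t \in faces K 2 & (e `<=` t)%fset.
Proof.
move=> eF; have /faceP[eK e2] := eF; have [v [w [vw eE]]] := card2_fset e2.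
apply: contrapT => ne.
set p := (1 - 2^-1) *: v + 2^-1 *: w.
have ep : hull e p.
  rewrite eE; apply/hull2P; exists 2^-1 => //; have /andP[h1 h2] := @half_in01 R.
  by rewrite !ltW.
have near_e : \forall x \near p, carrier K x -> hull e x.
  have := local_star KC p; apply: filterS => x h [b bK bx].
  have [vb wb] : v \in b /\ w \in b.
    apply: (face_hull_edge KC vw _ bK (@half_in01 R)); rewrite -?eE//; exact: h.
  have eb : (e `<=` b)%fset by rewrite eE; apply/fsubsetP => y; rewrite !inE => /orP[] /eqP ->.
  have [<-//|be] := eqVneq b e.
  by exfalso; apply: ne; exists b => //; exact: face_eq_sub be.
have [f [g [fc gc fX gX]]] := KD.
have vp : v != p.
  apply/eqP => vpE; move/eqP: vw; apply.
  have : v - p = 2^-1 *: (v - w) by rewrite /p; apply: planeP; rewrite !mxE; field.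
  by rewrite -vpE subrr => /esym/eqP; rewrite scaler_eq0 invr_eq0 pnatr_eq0/= subr_eq0 => /eqP.
have wp : w != p.
  apply/eqP => vpE; move/eqP: vw; apply.
  have : w - p = 2^-1 *: (w - v) by rewrite /p; apply: planeP; rewrite !mxE; field.
  by rewrite -vpE subrr => /esym/eqP; rewrite scaler_eq0 invr_eq0 pnatr_eq0/= subr_eq0 => /eqP.
have acc z : z != p -> z \in e -> ~ (\forall x \near p, carrier K x -> hull [fset p; z]%fset x -> x = p).
  move=> zp ze /(near_ray (z - p)) => h.
  have : \forall t \near 0^'+, [/\ (0 : R) < t, t < 1 &
      carrier K (p + t *: (z - p)) -> hull [fset p; z]%fset (p + t *: (z - p)) ->
      p + t *: (z - p) = p].
    near=> t; split; [near: t; exact: nbhs_right_gt|near: t; exact: nbhs_right_lt|].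
    by near: t; exact: h.
  move=> /filter_ex[t [t0 t1]].
  have sE : p + t *: (z - p) = (1 - t) *: p + t *: z by apply: planeP; rewrite !mxE; ring.
  move=> hh; have : p + t *: (z - p) == p.
    apply/eqP/hh; rewrite sE.
      exists e => //; apply: (hull_segment ep (hull_vertex ze)).
      by exists t => //; rewrite /= in_itv/= !ltW.
    by apply/hull2P; exists t; rewrite // !ltW.
  by rewrite -subr_eq0 addrAC subrr add0r scaler_eq0 gt_eqF//= subr_eq0 (negPf zp).
have he x : hull e x -> hull [fset p; v]%fset x \/ hull [fset p; w]%fset x.
  rewrite eE => /hull2P[t /andP[t0 t1] ->].
  have [h|h] := leP t (2^-1).
    left; apply/hull2P; exists (1 - 2 * t); first by apply/andP; split; lra.
    by rewrite /p; apply: planeP; rewrite !mxE; field.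
  right; apply/hull2P; exists (2 * t - 1); first by apply/andP; split; lra.
  by rewrite /p; apply: planeP; rewrite !mxE; field.
have wv0 : w - v != 0 by rewrite subr_eq0 eq_sym.
case: (@homeo_no_local_cut _ _ f g fc gc fX gX p (hull [fset p; v]%fset) (hull [fset p; w]%fset)).
- by exists e.
- exact: hull2_closed.
- exact: hull2_closed.
- by move: near_e; apply: filterS => x h /h/he.
- near=> x => _ /hull2P[a /andP[a0 a1] ->] /hull2P[b /andP[b0 b1]].
  move=> /eqP; rewrite -subr_eq0.
  have -> : (1 - a) *: p + a *: v - ((1 - b) *: p + b *: w) = (- (a + b) / 2) *: (w - v).
    by rewrite /p; apply: planeP; rewrite !mxE; field.
  rewrite scaler_eq0 (negPf wv0) orbF mulf_eq0 invr_eq0 pnatr_eq0 orbF oppr_eq0 => /eqP ab0.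
  have -> : a = 0 by lra.
  by rewrite subr0 scale1r scale0r addr0.
- by apply: (acc v vp); rewrite eE !inE eqxx.
- by apply: (acc w wp); rewrite eE !inE eqxx orbT.
Unshelve. all: by end_near. Qed.

(** Edges are handled by [edge_in_triangle]; a vertex in no larger face would be an isolated point
    of the carrier. *)
Lemma face_in_triangle b : b \in K -> exists2 t, t \in faces K 2 & (b `<=` t)%fset.
Proof.
move=> bK; have := face_card KC bK; rewrite leq_eqVlt ltnS => /orP[/eqP b3|].
  by exists b => //; apply/faceP.
rewrite leq_eqVlt ltnS => /orP[/eqP b2|].
  by apply: edge_in_triangle; apply/faceP.
rewrite leq_eqVlt ltnS leqn0 => /orP[|]; last first.
  by rewrite cardfs_eq0 (negPf (face_nonempty KC bK)).
move=> /cardfs1P[v bE]; rewrite bE in bK *.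
have [[b' [b'K vb' b'v]]|nb] := pselect (exists b', [/\ b' \in K, v \in b' & b' != [fset v]%fset]).
  have [w wb' wv] : exists2 w, w \in b' & w \notin [fset v]%fset.
    apply/fsubsetPn; apply: contra b'v => b'v; rewrite eqEfsubset b'v.
    by apply/fsubsetP => y; rewrite inE => /eqP ->.
  have vw : v != w by move: wv; rewrite inE eq_sym.
  have [|t tK et] := @edge_in_triangle [fset v; w]%fset.
    rewrite (edgeP _ vw); apply: (face_sub KC b'K).
      by apply/fsubsetP => y; rewrite !inE => /orP[] /eqP ->.
    by apply/fset0Pn; exists v; rewrite !inE eqxx.
  by exists t => //; apply: fsubset_trans et; apply/fsubsetP => y; rewrite !inE => ->.
have [f [g [fc gc fX gX]]] := KD.
exfalso; apply: (homeo_not_isolated gc fX gX (p := v)).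
  by exists [fset v]%fset => //; apply/hull1P.
have := local_star KC v; apply: filterS => x h [b' b'K b'x].
have vb' : v \in b' by apply: (hull_face_vertex KC) => //; exact: h.
have [b'E|b'v] := eqVneq b' [fset v]%fset; first by move: b'x; rewrite b'E => /hull1P.
by exfalso; apply: nb; exists b'.
Qed.

Lemma carrier_triangle x : carrier K x <-> exists2 t, t \in faces K 2 & hull t x.
Proof.
split=> [[b bK bx]|[t /faceP[tK _] tx]]; last by exists t.
by have [t tK bt] := face_in_triangle bK; exists t => //; exact: hullS bx.
Qed.

(** If [P] took several values, the triangles at [v] with the value [P t0] and the other ones would
    form two closed pieces that cover the carrier near [v] and meet only in [v]: a local cut. *)
Lemma star_connected (U : Type) (P : {fset plane} -> U) v :
  (forall t t' w, t \in faces K 2 -> t' \in faces K 2 -> v != w ->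
     v \in t -> w \in t -> v \in t' -> w \in t' -> P t = P t') ->
  forall t t', t \in faces K 2 -> t' \in faces K 2 -> v \in t -> v \in t' -> P t = P t'.
Proof.
move=> Padj t0 t1 t0K t1K vt0 vt1; apply: contrapT => P01.
have [f [g [fc gc fX gX]]] := KD.
pose S0 t := (t \in faces K 2 /\ v \in t) /\ P t = P t0.
pose S1 t := (t \in faces K 2 /\ v \in t) /\ P t <> P t0.
have acc S t : t \in faces K 2 -> v \in t -> S t ->
    ~ (\forall x \near v, carrier K x -> (exists2 t, t \in K /\ S t & hull t x) -> x = v).
  move=> tK vt St; have [w [u [tE D]]] := triangle_vertex tK vt.
  have wv : w != v.
    by have /= := area_neq0_uniq D; rewrite inE negb_or eq_sym => /andP[/andP[]].
  move=> /(near_ray (w - v)) => h.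
  have : \forall s \near 0^'+, [/\ (0 : R) < s, s < 1 &
      carrier K (v + s *: (w - v)) -> (exists2 t, t \in K /\ S t & hull t (v + s *: (w - v))) ->
      v + s *: (w - v) = v].
    near=> s; split; [near: s; exact: nbhs_right_gt|near: s; exact: nbhs_right_lt|].
    by near: s; exact: h.
  move=> /filter_ex[s [s0 s1 hh]]; have /faceP[tK0 _] := tK.
  have th : hull t (v + s *: (w - v)).
    have wt : w \in t by rewrite tE !inE eqxx orbT.
    apply: (hull_segment (hull_vertex vt) (hull_vertex wt)); exists s; first by rewrite /= in_itv/= !ltW.
    by apply: planeP; rewrite !mxE; ring.
  have : v + s *: (w - v) == v.
    by apply/eqP/hh; exists t.
  by rewrite -subr_eq0 addrAC subrr add0r scaler_eq0 gt_eqF//= subr_eq0 (negPf wv).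
case: (@homeo_no_local_cut _ _ f g fc gc fX gX v
   [set x | exists2 t, t \in K /\ S0 t & hull t x] [set x | exists2 t, t \in K /\ S1 t & hull t x]).
- by apply: carrier_vertex => //; apply/vertexP => //; exists t0 => //; have /faceP[] := t0K.
- exact: closed_face_union.
- exact: closed_face_union.
- have := local_star KC v; apply: filterS => x h /carrier_triangle[t tK tx].
  have /faceP[tK0 _] := tK.
  have vt : v \in t.
    apply: (hull_face_vertex KC) => //; last exact: h.
    apply: (face_sub KC (b := t0)); first by have /faceP[] := t0K.
      by apply/fsubsetP => y; rewrite inE => /eqP ->.
    by apply/fset0Pn; exists v; rewrite inE.
  by have [e|ne] := pselect (P t = P t0); [left|right]; exists t.
- near=> x => _ [t [tK0 [[tK vt] Pt]] tx] [t' [tK0' [[tK' vt'] Pt']] tx'].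
  have : (hull t `&` hull t') x by [].
  rewrite (face_cap KC)// (_ : (t `&` t')%fset = [fset v]%fset); first by move/hull1P.
  apply/fsetP => w; rewrite !inE; apply/andP/eqP => [[wt wt']|->//].
  apply/eqP/negPn/negP => wv; apply: Pt'; rewrite -Pt; apply: (Padj _ _ w) => //.
  by rewrite eq_sym.
- exact: (acc S0 t0).
- by apply: (acc S1 t1) => //; split => // e; apply: P01.
Unshelve. all: by end_near. Qed.

(** Two triangles that meet share a vertex, so the star of that vertex links them; connectedness of
    the carrier does the rest. *)
Lemma triangles_connected (U : Type) (P : {fset plane} -> U) :
  (forall t t' v w, t \in faces K 2 -> t' \in faces K 2 -> v != w ->
     v \in t -> w \in t -> v \in t' -> w \in t' -> P t = P t') ->
  forall t t', t \in faces K 2 -> t' \in faces K 2 -> P t = P t'.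
Proof.
move=> Padj t t' tK tK'; have [f [g [fc gc fX gX]]] := KD.
have [v1 [w [u tE]]] : exists v w u, t = [fset v; w; u]%fset.
  by have /faceP[_ /card3_fset[v [w [u [_ ->]]]]] := tK; exists v, w, u.
have [v [w' [u' [_ tE']]]] : exists v w u, uniq [:: v; w; u] /\ t' = [fset v; w; u]%fset.
  by have /faceP[_ /card3_fset] := tK'.
have H := @homeo_connected R _ f g gc fX gX _ (fun t : faces K 2 => hull (val t)).
have HP := H _ _ U (fun t : faces K 2 => P (val t)) _ [` tK]%fset [` tK']%fset w v.
apply: HP.
- by move=> s; apply: (hull_closed KC); have /faceP[] := valP s.
- move=> x; split=> [/carrier_triangle[s sK sx]|[s sx]]; first by exists [` sK]%fset.
  by apply/carrier_triangle; exists (val s) => //; exact: valP.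
- move=> s s' x sx sx'.
  have : (hull (val s) `&` hull (val s')) x by [].
  have /faceP[sK _] := valP s; have /faceP[sK' _] := valP s'.
  rewrite (face_cap KC)// => hx.
  have /fset0Pn[y] : (val s `&` val s' != fset0)%fset.
    by apply/eqP => e0; move: hx; rewrite e0; exact: hull0.
  rewrite inE => /andP[ys ys']; apply: (@star_connected _ P y) => //; try exact: valP.
  by move=> ? ? z *; exact: (Padj _ _ y z).
- by apply: hull_vertex; rewrite /= tE !inE eqxx orbT.
- by apply: hull_vertex; rewrite /= tE' !inE eqxx.
Qed.


Lemma sum_fset_cond (V : nmodType) (T : choiceType) (A : {fset T}) (P : pred T) (F : T -> V) :
  \sum_(i <- [fset x in A | P x]%fset) F i = \sum_(i <- A | P i) F i.
Proof.
rewrite -[RHS]big_filter; apply: perm_big; apply: uniq_perm.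
- exact: fset_uniq.
- exact: filter_uniq (fset_uniq _).
- by move=> x; rewrite !inE mem_filter /= andbC.
Qed.

Lemma edge_sub_triangle v w u e : area v w u != 0 -> e \in faces K 1 ->
  (v \in e) && (e `<=` [fset v; w; u])%fset = (e == [fset v; w]%fset) || (e == [fset v; u]%fset).
Proof.
move=> D eK; have := area_neq0_uniq D; rewrite /= !inE !negb_or andbT -andbA => /and3P[vw vu wu].
apply/andP/orP => [[ve et]|].
  have [x vx eE] := edge_ends eK ve.
  have : x \in [fset v; w; u]%fset by apply: (fsubsetP et); rewrite eE !inE eqxx orbT.
  by rewrite !inE eq_sym (negPf vx) /= eE => /orP[] /eqP ->; rewrite eqxx; [left|right].
by case=> /eqP ->; rewrite !inE eqxx; split => //; apply/fsubsetP => y; rewrite !inE => /orP[] ->; rewrite ?orbT.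
Qed.

Lemma sum_edges_triangle (V : nmodType) (E : {fset {fset plane}}) (F : {fset plane} -> V) v w u :
  area v w u != 0 -> (forall e, e \in E -> e \in faces K 1) ->
  (forall e, e \notin E -> F e = 0) ->
  \sum_(e <- E | (v \in e) && (e `<=` [fset v; w; u])%fset) F e =
  F [fset v; w]%fset + F [fset v; u]%fset.
Proof.
move=> D EK F0; have := area_neq0_uniq D.
rewrite /= !inE !negb_or andbT -andbA => /and3P[vw vu wu].
rewrite big_seq_cond (eq_bigl (fun e => (e \in E) && ((e == [fset v; w]%fset) || (e == [fset v; u]%fset)))).
  rewrite -big_seq_cond sum_pred2 ?fset_uniq//.
    by congr (_ + _); case: ifPn => // /F0.
  apply/eqP => /fsetP/(_ w); rewrite !inE eqxx orbT eq_sym (negPf vw) /= => /esym.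
  by rewrite (negPf wu).
by move=> e; case: (boolP (e \in E)) => //= /EK; exact: edge_sub_triangle.
Qed.

Lemma interior_vertex_edge v w : v \in interior_vertices K -> v != w ->
  [fset v; w]%fset \in K -> [fset v; w]%fset \in interior_edges K.
Proof.
move=> /(interior_vertexP KC)[_ vi] vw eK; apply/interior_edgeP; rewrite edgeP//.
split=> // /(_ v (hull_vertex (fset21 _ _))).
exact: interior_nboundary vi.
Qed.

Lemma fset3C v w u : [fset v; w; u]%fset = [fset v; u; w]%fset.
Proof. by rewrite fsetUAC. Qed.

Lemma tsignE' v w u : area v w u != 0 ->
  tsign [fset v; w; u]%fset [fset v; u]%fset = - (orient v u * Num.sg (area v w u)).
Proof.
have aE : area v u w = - area v w u by rewrite /area; ring.
by move=> D; rewrite fset3C tsignE aE ?oppr_eq0// sgrN mulrN.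
Qed.

(** After exchanging the sums, a triangle at [v] contributes through its two edges at [v], both
    interior, and the two products of incidence signs are opposite. *)
Lemma boundary_coboundary (V : lmodType R) (phi : {fset plane} -> V) v :
  v \in interior_vertices K ->
  \sum_(e <- interior_edges K | v \in e) vsign v e *:
    (\sum_(t <- faces K 2 | (e `<=` t)%fset) tsign t e *: phi t) = 0.
Proof.
move=> vI; under eq_bigr do rewrite scaler_sumr.
rewrite (exchange_big_dep xpredT)//= big_seq big1// => t tK.
under eq_bigr do rewrite scalerA; rewrite -scaler_suml.
have [vt|vt] := boolP (v \in t); last first.
  rewrite big_pred0 ?scale0r// => e; apply/andP => -[ve /fsubsetP/(_ v ve)].
  by rewrite (negPf vt).
have [w [u [tE D]]] := triangle_vertex tK vt.
have := area_neq0_uniq D; rewrite /= !inE !negb_or andbT -andbA => /and3P[vw vu wu].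
have /faceP[tK0 _] := tK; rewrite tE in tK0.
pose F e := if e \in interior_edges K then vsign v e * tsign t e else 0.
rewrite (_ : \sum_(_ <- _ | _) _ = \sum_(e <- interior_edges K | (v \in e) && (e `<=` t)%fset) F e).
  rewrite tE sum_edges_triangle//.
  - rewrite /F !interior_vertex_edge//.
      rewrite !vsignE// tE tsignE// tsignE'// mulrN !mulrA !orient_sqr// subrr scale0r//.
    + apply: (face_sub KC tK0); last by apply/fset0Pn; exists v; rewrite !inE eqxx.
      by apply/fsubsetP => y; rewrite !inE => /orP[] ->; rewrite ?orbT.
    + apply: (face_sub KC tK0); last by apply/fset0Pn; exists v; rewrite !inE eqxx.
      by apply/fsubsetP => y; rewrite !inE => /orP[] ->; rewrite ?orbT.
  - exact: interior_edge_face.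
  - by move=> e /negPf eI; rewrite /F eI.
rewrite big_seq_cond [RHS]big_seq_cond; apply: eq_bigr => e /andP[eI _].
by rewrite /F eI.
Qed.

(* A vector [o] annihilated by the coboundary at [v] is constant along the edges at
   [v], up to orientation; so it is a multiple of the boundary at [v] when [v] is
   interior, and it vanishes otherwise, as some edge at [v] then lies on one triangle. *)
Lemma local_exact v (g : {fset plane} -> R) : v \in vertices K ->
  (v \in interior_vertices K ->
     \sum_(e <- interior_edges K | v \in e) vsign v e * g e = 0) ->
  exists F : {fset plane} -> R, forall e, e \in interior_edges K -> v \in e ->
    \sum_(t <- faces K 2 | (e `<=` t)%fset) tsign t e * F t = g e.
Proof.
move=> vV gv; pose Ev := [fset e in interior_edges K | v \in e]%fset.
have EvP e : (e \in Ev) = (e \in interior_edges K) && (v \in e) by rewrite !inE.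
have EvK e : e \in Ev -> e \in faces K 1.
  by rewrite EvP => /andP[/interior_edge_face].
pose D (i : faces K 2) (j : Ev) : R := if (val j `<=` val i)%fset then tsign (val i) (val j) else 0.
have [|phi phiP] := @solvable_dual _ _ D (fun j => g (val j)).
  move=> o Do; pose oo e : R := if insub e is Some j then o j else 0.
  have oo0 e : e \notin Ev -> oo e = 0.
    by move=> eE; rewrite /oo; case: insubP => // j jE; rewrite jE in eE.
  have oov (j : Ev) : oo (val j) = o j by rewrite /oo valK.
  (* Multiplying by the sign of [v] in the edge removes the dependence on orientations. *)
  pose o' w := orient v w * oo [fset v; w]%fset.
  have o't w u : area v w u != 0 -> [fset v; w; u]%fset \in faces K 2 -> o' w = o' u.
    move=> A tK; have := area_neq0_uniq A.
    rewrite /= !inE !negb_or andbT -andbA => /and3P[vw vu wu].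
    have : \sum_(e <- Ev | (v \in e) && (e `<=` [fset v; w; u])%fset)
        tsign [fset v; w; u]%fset e * oo e = 0.
      rewrite -[RHS](Do [` tK]%fset) big_seq_fsetE/= big_mkcond/=.
      apply: eq_bigr => j _; have := valP j; rewrite EvP => /andP[_ ->] /=.
      by rewrite /D /= oov; case: ifP => _; rewrite ?mul0r.
    rewrite sum_edges_triangle//; last by move=> e /oo0 ->; rewrite mulr0.
    rewrite tsignE// tsignE'// mulNr => /eqP; rewrite subr_eq0 => /eqP h.
    have sg0 : Num.sg (area v w u) != 0 by rewrite sgr_eq0.
    by apply: (mulfI sg0); rewrite /o' !mulrA ![Num.sg _ * _]mulrC.
  (* [star_connected] needs a function of the triangle alone: [o'] vanishes at [v] and agrees at the
     two other vertices, hence the factor 2 below. *)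
  pose P t : R := \sum_(w <- t) o' w.
  have o'v : o' v = 0 by rewrite /o' orient_vv mul0r.
  have PE t w : t \in faces K 2 -> v != w -> v \in t -> w \in t -> P t = 2 * o' w.
    move=> tK vw vt wt; have [u tE A] := triangle_edge tK vt wt vw.
    rewrite /P tE big_fset3; last exact: area_neq0_uniq.
    by rewrite o'v add0r -(o't w u)//; [ring|rewrite -tE].
  have Pc := @star_connected _ P v _.
  have [t0 t0K vt0] : exists2 t, t \in faces K 2 & v \in t.
    have [t tK] := face_in_triangle (etrans (esym (vertex_face KC v)) vV).
    by move/fsubsetP/(_ v); rewrite inE eqxx => /(_ isT) vt; exists t.
  pose l := P t0 / 2.
  have o'l w : v != w -> [fset v; w]%fset \in K -> o' w = l.
    move=> vw eK; have [t tK /fsubsetP et] := face_in_triangle eK.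
    have vt := et v (fset21 _ _); have wt := et w (fset22 _ _).
    rewrite /l -(Pc _ t t0 tK t0K vt vt0) ?(PE t w)//; first by field.
    by move=> t1 t2 x t1K t2K vx vt1 xt1 vt2 xt2; rewrite (PE t1 x)// (PE t2 x).
  have ool (j : Ev) : o j = l * vsign v (val j).
    rewrite -oov; have := valP j; rewrite EvP => /andP[jI vj].
    have [w vw eE] := edge_ends (interior_edge_face jI) vj.
    have eK : [fset v; w]%fset \in K by have /faceP[] := interior_edge_face jI; rewrite eE.
    by rewrite eE vsignE// -(o'l w)// /o' mulrC mulrA orient_sqr// mul1r.
  have [vI|vI] := boolP (v \in interior_vertices K).
    under eq_bigr do rewrite ool.
    rewrite -(big_seq_fsetE _ Ev xpredT (fun e => g e * (l * vsign v e)))/=.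
    rewrite sum_fset_cond.
    transitivity (l * \sum_(e <- interior_edges K | v \in e) vsign v e * g e); last first.
      by rewrite (gv vI) mulr0.
    by rewrite mulr_sumr; apply: eq_bigr => e _; ring.
  suff l0 : l = 0 by rewrite big1// => j _; rewrite ool l0 mul0r mulr0.
  have [w [vw eK eI]] : exists w, [/\ v != w, [fset v; w]%fset \in K & [fset v; w]%fset \notin interior_edges K].
    apply: contrapT => nw; move/negP: vI; apply; apply/(interior_vertexP KC); split => //.
    have [w [u [tE A]]] := triangle_vertex t0K vt0.
    have /faceP[t0K0 _] := t0K; rewrite tE in t0K0.
    apply: (all_edges_interior KC t0K0 A) => w' vw' eK.
    by apply/negPn/negP => eI; apply: nw; exists w'.
  by rewrite -(o'l w vw eK) /o' oo0 ?mulr0// EvP (negPf eI).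
pose F t : R := if insub t is Some i then phi i else 0.
exists F => e eI ve; have eE : e \in Ev by rewrite EvP eI ve.
have := phiP [` eE]%fset; rewrite /= => <-.
rewrite big_seq_fsetE/= big_mkcond/=; apply: eq_bigr => i _.
by rewrite /D /F valK /=; case: ifP => _; rewrite ?mul0r.
Qed.

Lemma cochain_exact (g : {fset plane} -> R) :
  (forall v, v \in interior_vertices K ->
     \sum_(e <- interior_edges K | v \in e) vsign v e * g e = 0) ->
  exists phi : {fset plane} -> R, forall e, e \in interior_edges K ->
    \sum_(t <- faces K 2 | (e `<=` t)%fset) tsign t e * phi t = g e.
Proof.
move=> gv; have [f [h [fc hc fX hX]]] := KD.
have : forall v, exists F : {fset plane} -> R, v \in vertices K ->
    forall e, e \in interior_edges K -> v \in e ->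
    \sum_(t <- faces K 2 | (e `<=` t)%fset) tsign t e * F t = g e.
  move=> v; have [vV|_] := boolP (v \in vertices K); last by exists (fun=> 0).
  by have [F FP] := local_exact vV (gv v); exists F.
move=> /choice[F FP].
have Vt t v : t \in faces K 2 -> v \in t -> v \in vertices K.
  by move=> /faceP[tK _] vt; apply/(vertexP KC); exists t.
have Fe e v w u u' : v != w -> e = [fset v; w]%fset -> e \in interior_edges K ->
    0 < area v w u -> area v w u' < 0 ->
    [fset v; w; u]%fset \in faces K 2 -> [fset v; w; u']%fset \in faces K 2 ->
    (forall t, (t \in faces K 2) && ([fset v; w] `<=` t)%fset =
      (t == [fset v; w; u]%fset) || (t == [fset v; w; u']%fset)) ->
    forall x, x \in e ->
    g e = orient v w * (F x [fset v; w; u]%fset - F x [fset v; w; u']%fset).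
  move=> vw eE eI sg sg' tK tK' tE x xe.
  rewrite -(FP x _ e eI xe); last first.
    by apply: (Vt [fset v; w; u]%fset) => //; move: xe; rewrite eE !inE => ->.
  by rewrite eE (@coboundaryE R^o (F x) v w u u').
(* If [x] and [y] are distinct common vertices of two distinct triangles, both local solutions solve
   the equation of the edge joining them, so their increments across it agree. *)
have Findep t t' x y : t \in faces K 2 -> t' \in faces K 2 -> x \in t -> x \in t' ->
    y \in t -> y \in t' -> F x t' - F x t = F y t' - F y t.
  move=> tK tK' xt xt' yt yt'.
  have [<-|tt'] := eqVneq t t'; first by rewrite !subrr.
  have [<-//|xy] := eqVneq x y.
  have eI := shared_edge_interior tK tK' tt' xy xt yt xt' yt'.
  have [u [u' [uK uK' sg sg' tE]]] := interior_edge_triangles xy eI.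
  have gx := Fe _ _ _ _ _ xy erefl eI sg sg' uK uK' tE x (fset21 _ _).
  have := Fe _ _ _ _ _ xy erefl eI sg sg' uK uK' tE y (fset22 _ _).
  rewrite gx => /(congr1 (fun z => orient x y * z)); rewrite !mulrA orient_sqr// !mul1r => fe.
  have sub s : s \in faces K 2 -> x \in s -> y \in s ->
      (s == [fset x; y; u]%fset) || (s == [fset x; y; u']%fset).
    by move=> sK xs ys; rewrite -tE sK; apply/fsubsetP => z; rewrite !inE => /orP[] /eqP ->.
  have /orP[/eqP tu|/eqP tu] := sub t tK xt yt; have /orP[/eqP tu'|/eqP tu'] := sub t' tK' xt' yt'.
  - by move: tt'; rewrite tu tu' eqxx.
  - by rewrite tu tu' -opprB fe opprB.
  - by rewrite tu tu' fe.
  - by move: tt'; rewrite tu tu' eqxx.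
(* Any common vertex gives the same increment; the default 0 occurs only for triangles without a
   common vertex. *)
pose cv (t t' : {fset plane}) := xget 0 [set v | v \in t /\ v \in t'].
pose c (t t' : faces K 2) : R := F (cv (val t) (val t')) (val t') - F (cv (val t) (val t')) (val t).
have cE (t t' : faces K 2) v : v \in val t -> v \in val t' ->
    c t t' = F v (val t') - F v (val t).
  move=> vt vt'; rewrite /c.
  have [h1 h2] : cv (val t) (val t') \in val t /\ cv (val t) (val t') \in val t'.
    by have := @xgetPex _ 0 [set v | v \in val t /\ v \in val t']; apply; exists v.
  by apply: Findep => //; exact: valP.
have N := @homeo_nerve_exact R _ f h fc hc fX hX _ (fun t : faces K 2 => hull (val t)).
have [||t|x t1 t2 t3 h1 h2 h3|phi phiP] := N _ _ c.
- by move=> s; apply: (hull_closed KC); have /faceP[] := valP s.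
- move=> x; split=> [/carrier_triangle[s sK sx]|[s sx]]; first by exists [` sK]%fset.
  by apply/carrier_triangle; exists (val s) => //; exact: valP.
- exact: connected_hull.
(* Three triangles with a common point have a common vertex, where the three increments come from a
   single local solution and thus add up. *)
- have /faceP[t1K _] := valP t1; have /faceP[t2K _] := valP t2; have /faceP[t3K _] := valP t3.
  have : (hull (val t1) `&` hull (val t2)) x by [].
  rewrite (face_cap KC)// => h12.
  have t12 : (val t1 `&` val t2 != fset0)%fset.
    by apply/eqP => e0; move: h12; rewrite e0; exact: hull0.
  have t12K : (val t1 `&` val t2)%fset \in K.
    by apply: (face_sub KC t1K) => //; exact: fsubsetIl.
  have : (hull (val t1 `&` val t2)%fset `&` hull (val t3)) x by [].
  rewrite (face_cap KC)// => h123.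
  have /fset0Pn[v] : (val t1 `&` val t2 `&` val t3 != fset0)%fset.
    by apply/eqP => e0; move: h123; rewrite e0; exact: hull0.
  rewrite !inE => /andP[/andP[v1 v2] v3].
  by rewrite (cE t1 t2 v)// (cE t2 t3 v)// (cE t1 t3 v)// addrC addrA subrK.
pose Phi t : R := if insub t is Some i then phi i else 0.
exists Phi => e eI; have eF := interior_edge_face eI.
have /faceP[eK /card2_fset[v [w [vw eE]]]] := eF.
have eI' := eI; rewrite eE in eI'.
have [u [u' [uK uK' sg sg' tE]]] := interior_edge_triangles vw eI'.
rewrite (Fe e v w u u' vw eE eI sg sg' uK uK' tE v); last by rewrite eE !inE eqxx.
rewrite eE (@coboundaryE R^o Phi v w u u')//; congr (_ * _).
have := phiP [` uK']%fset [` uK]%fset v.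
rewrite (cE _ _ v) /=; [|by rewrite !inE eqxx|by rewrite !inE eqxx].
move=> ->; [|by apply: hull_vertex; rewrite !inE eqxx|by apply: hull_vertex; rewrite !inE eqxx].
by rewrite /Phi !insubT.
Qed.

End Disk.
End Complex.
End Exactness.

(** * Polynomials and orders of vanishing *)

Section MpolyGeneral.
Variables (R : comNzRingType) (n : nat).

Lemma mpoly_gen_ind (P : mpoly n R -> Prop) :
  (forall c, P (mpolyC n c)) -> (forall i, P (mpolyX R (mnm1 i))) ->
  (forall p q, P p -> P q -> P (p + q)) -> (forall p q, P p -> P q -> P (p * q)) ->
  forall p, P p.
Proof.
move=> PC PX PD PM; apply: mpolyind => [|c m p _ _ Pp]; first by rewrite -(mpolyC0 n R).
apply: (PD) => //; rewrite -mul_mpolyC; apply: (PM) => //.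
rewrite mpolyXE_id; apply: (big_ind P); [by rewrite -(mpolyC1 n R)|by move=> *; exact: PM|].
move=> i _; elim: (m i) => [|k IH]; first by rewrite expr0 -(mpolyC1 n R).
by rewrite exprS; exact: PM.
Qed.

End MpolyGeneral.

(** * Substitutions, Taylor expansions and weights of monomials *)

Section Substitution.
Variable R : realType.

Definition msubst n k (h : 'I_n -> mpoly k R) : mpoly n R -> mpoly k R :=
  mmap (@mpolyC k R) h.

HB.instance Definition _ n k h := GRing.RMorphism.on (@msubst n k h).

Lemma msubstC n k h c : @msubst n k h (mpolyC n c) = mpolyC k c.
Proof. exact: mmapC. Qed.

Lemma msubstX n k h i : @msubst n k h (mpolyX R (mnm1 i)) = h i.
Proof. by rewrite /msubst mmapX mmap1U. Qed.

Lemma msubstZ n k h c p : @msubst n k h (c *: p) = c *: msubst h p.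
Proof. by rewrite /msubst mmapZ mul_mpolyC. Qed.

HB.instance Definition _ n k h :=
  GRing.isScalable.Build R (mpoly n R) (mpoly k R) *:%R (@msubst n k h) (@msubstZ n k h).

Lemma msubst_monom n k h m : @msubst n k h (mpolyX R m) = \prod_i h i ^+ m i.
Proof. by rewrite /msubst mmapX. Qed.

Lemma msubst_comp n k l (h : 'I_n -> mpoly k R) (h' : 'I_k -> mpoly l R) p :
  msubst h' (msubst h p) = msubst (fun i => msubst h' (h i)) p.
Proof.
elim/mpoly_gen_ind: p => [c|i|p q IHp IHq|p q IHp IHq].
- by rewrite !msubstC.
- by rewrite !msubstX.
- by rewrite !rmorphD/= IHp IHq.
- by rewrite !rmorphM/= IHp IHq.
Qed.

Lemma msubst_id n p : msubst (fun i : 'I_n => mpolyX R (mnm1 i)) p = p.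
Proof.
elim/mpoly_gen_ind: p => [c|i|p q IHp IHq|p q IHp IHq].
- by rewrite msubstC.
- by rewrite msubstX.
- by rewrite rmorphD/= IHp IHq.
- by rewrite rmorphM/= IHp IHq.
Qed.

Lemma eq_msubst n k (h h' : 'I_n -> mpoly k R) : h =1 h' -> msubst h =1 msubst h'.
Proof. by move=> /funext ->. Qed.

Lemma meval_msubst n k (h : 'I_n -> mpoly k R) x p :
  meval x (msubst h p) = meval (fun i => meval x (h i)) p.
Proof.
elim/mpoly_gen_ind: p => [c|i|p q IHp IHq|p q IHp IHq].
- by rewrite msubstC !mevalC.
- by rewrite msubstX mevalXU.
- by rewrite !rmorphD/= IHp IHq.
- by rewrite !rmorphM/= IHp IHq.
Qed.

Definition translate n (v : 'I_n -> R) : mpoly n R -> mpoly n R :=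
  msubst (fun i => mpolyX R (mnm1 i) + mpolyC n (v i)).

Lemma mderivXU n (i j : 'I_n) : mderiv i (mpolyX R (mnm1 j)) = mpolyC n (j == i)%:R.
Proof.
rewrite mderivX mnm1E; have [->|_] := eqVneq j i; last by rewrite scale0r mpolyC0.
rewrite scale1r mpolyC1 (_ : mnm_sub _ _ = mnm0) ?mpolyX0//.
by apply/mnmP => k; rewrite mnmBE subnn mnm0E.
Qed.

Lemma mderiv_translate n (v : 'I_n -> R) i p :
  mderiv i (translate v p) = translate v (mderiv i p).
Proof.
rewrite /translate; elim/mpoly_gen_ind: p => [c|j|p q IHp IHq|p q IHp IHq].
- by rewrite msubstC !mderivC rmorph0.
- by rewrite msubstX mderivD mderivC addr0 !mderivXU msubstC.
- by rewrite rmorphD/= !mderivD IHp IHq rmorphD.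
- by rewrite rmorphM/= !mderivM IHp IHq rmorphD !rmorphM.
Qed.

Lemma mderivm_translate n (v : 'I_n -> R) m p :
  mderivm m (translate v p) = translate v (mderivm m p).
Proof.
rewrite /mderivm; elim: (enum _) => //= i s ->.
by elim: (m i) => //= k ->; rewrite mderiv_translate.
Qed.

Lemma translateK n (v : 'I_n -> R) p : translate (fun i => - v i) (translate v p) = p.
Proof.
rewrite /translate msubst_comp -[RHS]msubst_id; apply: eq_msubst => i.
by rewrite rmorphD/= msubstX msubstC mpolyCN subrK.
Qed.

Lemma meval0_mcoeff n (p : mpoly n R) : meval (fun=> 0) p = mcoeff mnm0 p.
Proof.
elim/mpoly_gen_ind: p => [c|i|p q IHp IHq|p q IHp IHq].
- by rewrite mevalC mcoeffC eqxx mulr1.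
- rewrite mevalXU mcoeffX; case: eqP => // /mnmP/(_ i).
  by rewrite mnm1E mnm0E eqxx.
- by rewrite mevalD IHp IHq mcoeffD.
- by rewrite mevalM IHp IHq rmorphM.
Qed.

Lemma meval_translate n (v : 'I_n -> R) p : meval (fun=> 0) (translate v p) = meval v p.
Proof.
rewrite /translate meval_msubst; apply: meval_eq => i.
by rewrite mevalD mevalXU mevalC add0r.
Qed.

(** Order of vanishing at least [k] for the weight [w]. One notion covers vanishing at a point
    (total degree), divisibility by a power of a variable (its exponent) and powers of the ideal of
    an axis ([wout] below). *)
Definition wlow n (w : multinom n -> nat) (k : nat) (p : mpoly n R) : Prop :=
  forall m, (w m < k)%N -> mcoeff m p = 0.

(** In characteristic 0, the derivatives at [v] are the Taylor coefficients multiplied by nonzero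
    products of factorials. *)
Lemma taylor_low n (v : 'I_n -> R) k p :
  (forall m, (mdeg m < k)%N -> meval v (mderivm m p) = 0) <-> wlow (@mdeg n) k (translate v p).
Proof.
have E m : meval v (mderivm m p) = mcoeff m (translate v p) *+ (\prod_(i < n) (m i) ^_ (m i)).
  by rewrite -meval_translate -mderivm_translate meval0_mcoeff mcoeff_mderivm addm0.
split=> h m /h; rewrite E; last by move=> ->; rewrite mul0rn.
move=> /eqP; rewrite mulrn_eq0 => /orP[|/eqP//].
by rewrite -leqn0 leqNgt prodn_gt0// => i; rewrite ffactnn fact_gt0.
Qed.

Section Weight.
Variables (n : nat) (w : multinom n -> nat).
Hypothesis wD : forall m m', w (mnm_add m m') = (w m + w m')%N.

Lemma wlow0 k : wlow w k 0.
Proof. by move=> m _; rewrite mcoeff0. Qed.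

Lemma wlowD k p q : wlow w k p -> wlow w k q -> wlow w k (p + q).
Proof. by move=> hp hq m mk; rewrite mcoeffD hp// hq// addr0. Qed.

Lemma wlow_sum k (I : Type) (s : seq I) (F : I -> mpoly n R) :
  (forall i, wlow w k (F i)) -> wlow w k (\sum_(i <- s) F i).
Proof.
move=> hF; elim: s => [|i s IH]; first by rewrite big_nil; exact: wlow0.
by rewrite big_cons; exact: wlowD.
Qed.

Lemma wlowM k l p q : wlow w k p -> wlow w l q -> wlow w (k + l) (p * q).
Proof.
move=> hp hq m mkl; rewrite mcoeffM big1// => -[m1 m2] /= /eqP mE.
have [m1k|km1] := ltnP (w (val m1)) k; first by rewrite hp// mul0r.
have wm : w m = (w (val m1) + w (val m2))%N by rewrite {1}mE wD.
rewrite hq ?mulr0//; move: mkl; rewrite wm => mkl.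
by rewrite -(ltn_add2l k); apply: leq_ltn_trans mkl; rewrite leq_add2r.
Qed.

Lemma wlowMl l p q : wlow w l q -> wlow w l (p * q).
Proof. by move=> hq; apply: (@wlowM 0). Qed.

Lemma wlow_prod (k : nat) (a : 'I_k -> mpoly n R) :
  (forall i, wlow w 1 (a i)) -> wlow w k (\prod_i a i).
Proof.
elim: k a => [a _|k IH a ha]; first by move=> m.
by rewrite big_ord_recl; apply: (@wlowM 1 k) => //; exact: IH.
Qed.

Lemma wlow_msupp k p m : wlow w k p -> m \in msupp p -> (k <= w m)%N.
Proof. by move=> hp; rewrite mcoeff_msupp leqNgt; apply: contra => /hp ->. Qed.

Lemma wlow_closed k (P : mpoly n R -> Prop) p : wlow w k p ->
  P 0 -> (forall q q', P q -> P q' -> P (q + q')) ->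
  (forall c m, (k <= w m)%N -> m \in msupp p -> P (c *: mpolyX R m)) -> P p.
Proof.
move=> hp P0 PD PX; rewrite (mpolyE p) big_seq; apply: (big_ind P) => // m mp.
by apply: PX => //; exact: wlow_msupp mp.
Qed.

(** Together with [pihomog_lsub], this makes every ideal that a weight describes in some linear
    coordinates homogeneous. *)
Lemma wlow_pihomog k d p : wlow w k p -> wlow w k (pihomog mdeg d p).
Proof.
move=> hp; rewrite pihomogE big_mkcond/=; apply: wlow_sum => m m' m'k.
case: ifP => _; last by rewrite mcoeff0.
by rewrite mcoeffZ mcoeffX; case: eqP => [->|_]; rewrite ?mulr0// hp// mul0r.
Qed.

End Weight.

Lemma wlow_mdvd n (i : 'I_n) k p : wlow (fun m => m i) k p <->
  exists q, p = mpolyX R (mnm1 i) ^+ k * q.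
Proof.
split=> [hp|[q ->]]; last first.
  rewrite mulrC -[k]add0n; apply: wlowM => [m m'|//|]; first by rewrite mnmDE.
  move=> m mk; rewrite mpolyXn mcoeffX; case: eqP => // mE.
  by move: mk; rewrite -mE mulmnE mnm1E eqxx mul1n ltnn.
apply: (@wlow_closed _ _ _ (fun p => exists q, p = mpolyX R (mnm1 i) ^+ k * q) _ hp).
- by exists 0; rewrite mulr0.
- by move=> q q' [u ->] [u' ->]; exists (u + u'); rewrite mulrDr.
- move=> c m km _; exists (c *: mpolyX R (mnm_sub m (mnm_muln (mnm1 i) k))).
  rewrite -scalerAr mpolyXn -mpolyXD; congr (_ *: mpolyX _ _).
  apply/mnmP => j; rewrite mnmDE mnmBE mulmnE mnm1E.
  by case: eqP => [<-|_]; rewrite ?mul1n ?mul0n ?subnKC// subn0.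
Qed.

End Substitution.

(** * Linear forms and linear changes of coordinates *)

Section LinearForms.
Variables (R : realType) (n : nat).
Implicit Types (a : 'rV[R]_n) (M N : 'M[R]_n).

Definition lform a : mpoly n R := \sum_i a 0 i *: mpolyX R (mnm1 i).

Lemma lform_homog a : lform a \is ishomog1 1 mdeg.
Proof.
apply: rpred_sum => i _; apply: rpredZ.
by rewrite dhomogX; apply/eqP; exact: mdeg1.
Qed.

Lemma meval_lform x a : meval x (lform a) = \sum_i a 0 i * x i.
Proof. by rewrite /lform raddf_sum; apply: eq_bigr => i _; rewrite /= mevalZ mevalXU. Qed.

Lemma homog1_lform (l : mpoly n R) : l \is ishomog1 1 mdeg -> exists a, l = lform a.
Proof.
move=> hl; exists (\row_i mcoeff (mnm1 i) l); apply/mpolyP => m.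
rewrite /lform raddf_sum/=; under eq_bigr do rewrite mcoeffZ mcoeffX mxE.
have [m1|m1] := eqVneq (mdeg m) 1%N; last first.
  rewrite (dhomog_nemf_coeff hl m1) big1// => i _.
  by case: eqP => [e|]; rewrite ?mulr0//; rewrite -e mdeg1 eqxx in m1.
have /mdeg1P[i /eqP ->] : mdeg m == 1%N by rewrite m1.
rewrite (bigD1 i)//= eqxx mulr1 big1 ?addr0// => j ji.
by case: eqP => [/mnmP/(_ i)|]; rewrite ?mulr0// !mnm1E eqxx (negPf ji).
Qed.

(** On points this is [x] going to [M x], so the columns of [M] are the images of the axes; matrices
    below are chosen by their columns. *)
Definition lsub M : mpoly n R -> mpoly n R := msubst (fun i => lform (row i M)).

HB.instance Definition _ M := GRing.RMorphism.on (lsub M).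
HB.instance Definition _ M := GRing.Linear.on (lsub M).

Lemma lsubX M i : lsub M (mpolyX R (mnm1 i)) = lform (row i M).
Proof. by rewrite /lsub msubstX. Qed.

Lemma lsub_lform M a : lsub M (lform a) = lform (a *m M).
Proof.
rewrite /lform raddf_sum/=; under eq_bigr do rewrite linearZ/= lsubX /lform scaler_sumr.
rewrite exchange_big; apply: eq_bigr => j _ /=.
rewrite !mxE scaler_suml; apply: eq_bigr => i _.
by rewrite scalerA mxE.
Qed.

Lemma lsub_comp M N p : lsub N (lsub M p) = lsub (M *m N) p.
Proof.
rewrite /lsub msubst_comp; apply: eq_msubst => i.
by rewrite -/(lsub N _) lsub_lform row_mul.
Qed.

Lemma lsub1 p : lsub 1%:M p = p.
Proof.
rewrite -[RHS]msubst_id; apply: eq_msubst => i; rewrite /lform (bigD1 i)//=.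
rewrite !mxE eqxx scale1r big1 ?addr0// => j ji.
by rewrite !mxE eq_sym (negPf ji) scale0r.
Qed.

Lemma lsubK M p : M \in unitmx -> lsub (invmx M) (lsub M p) = p.
Proof. by move=> Mu; rewrite lsub_comp mulmxV// lsub1. Qed.

Lemma lsubVK M p : M \in unitmx -> lsub M (lsub (invmx M) p) = p.
Proof. by move=> Mu; rewrite lsub_comp mulVmx// lsub1. Qed.

Lemma meval_lsub M x p : meval x (lsub M p) = meval (fun i => \sum_j M i j * x j) p.
Proof.
rewrite /lsub meval_msubst; apply: meval_eq => i; rewrite meval_lform.
by apply: eq_bigr => j _; rewrite mxE.
Qed.

Lemma lsub_homog M d p : p \is ishomog1 d mdeg -> lsub M p \is ishomog1 d mdeg.
Proof.
move=> /dhomogP hp; rewrite (mpolyE p) raddf_sum/= big_seq; apply: rpred_sum => m mp.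
rewrite linearZ/=; apply: rpredZ.
have -> : d = (\sum_i m i)%N by rewrite -mdegE; exact/esym/hp.
rewrite /lsub msubst_monom.
elim/big_ind2: _ => [|a b c e|i _]; first exact: dhomog1.
  exact: dhomogM.
by have := dhomogMn (m i) (lform_homog (row i M)); rewrite mul1n.
Qed.

Lemma pihomog_lsub M d p : pihomog mdeg d (lsub M p) = lsub M (pihomog mdeg d p).
Proof.
set k := maxn d.+1 (mmeasure mdeg p).
have dk : (d < k)%N by rewrite leq_maxl.
have pE : p = \sum_(e < k) pihomog mdeg e p by apply: pihomog_partitionE; rewrite leq_maxr.
rewrite [in LHS]pE.
transitivity (\sum_(e < k) pihomog mdeg d (lsub M (pihomog mdeg e p))).
  by rewrite (linear_sum (lsub M)) (linear_sum (pihomog mdeg d)).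
rewrite (bigD1 (Ordinal dk))//= big1 ?addr0 => [|e ed].
  by apply: pihomog_dE; apply: lsub_homog; exact: pihomogP.
apply: (@pihomog_ne0 _ _ mdeg e); last by apply: lsub_homog; exact: pihomogP.
by apply: contraNneq ed => ed; apply/eqP/val_inj.
Qed.

End LinearForms.

(** * Forms in three variables *)

Section ThreeVariables.
Variable R : realType.
Local Notation plane := 'rV[R]_2.
Local Notation S := (mpoly 3 R).
Local Notation X i := (mpolyX R (mnm1 i)).

(** Written with [rshift] to match the block decomposition [2 + 1] used by [embed]. *)
Definition last3 : 'I_3 := rshift 2 (0 : 'I_1).

Lemma ord3P (P : 'I_3 -> Prop) : P 0 -> P 1 -> P last3 -> forall i, P i.
Proof.
move=> P0 P1 P2 i; case: i => -[|[|[|//]]] i.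
- by rewrite (_ : Ordinal i = 0) //; apply/val_inj.
- by rewrite (_ : Ordinal i = 1) //; apply/val_inj.
- by rewrite (_ : Ordinal i = last3) //; apply/val_inj.
Qed.

Lemma sum3 (V : nmodType) (F : 'I_3 -> V) : \sum_i F i = F 0 + F 1 + F last3.
Proof.
rewrite !big_ord_recr /= big_ord0 add0r.
by congr (F _ + F _ + F _); apply/val_inj.
Qed.

Lemma embed0 (x : plane) : embed x 0 0 = x 0 0.
Proof.
rewrite /embed mxE; case: splitP => // j j0.
by congr (x 0 _); apply/val_inj.
Qed.

Lemma embed1 (x : plane) : embed x 0 1 = x 0 1.
Proof.
rewrite /embed mxE; case: splitP => // j j0.
by congr (x 0 _); apply/val_inj.
Qed.

Lemma embed2 (x : plane) : embed x 0 last3 = 1.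
Proof.
rewrite /embed mxE; case: splitP => [j /= j2|j _]; last by rewrite mxE.
by have := ltn_ord j; rewrite -j2.
Qed.

Lemma vertex_idealP (v : plane) (P : S) :
  vertex_ideal v P <-> forall c, meval (fun i => c * embed v 0 i) P = 0.
Proof.
split=> [h c|h _ [c _ [x [n [p [a [pv a0 a1 ->]]]] <-]]].
  rewrite (_ : (fun i => _) = (fun i => (c *: embed v) 0 i)).
    apply: (h (c *: embed v)); exists c => //; exists (embed v) => //=.
    exists 1%N, (fun=> embed v), (fun=> 1); split => //.
    - by move=> _; right; exists v => //; apply/hull1P.
    - by rewrite big_ord1.
    - by rewrite big_ord1 scale1r.
  by apply/funext => i; rewrite [RHS]mxE.
(* The cone of a vertex is the segment from the origin to [embed v]: points equal to 0 drop out of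
   the combination, the others are all [embed v]. *)
have [b ->] : exists b, \sum_i a i *: p i = b *: embed v.
  exists (\sum_i (if p i == 0 then 0 else a i)); rewrite scaler_suml.
  apply: eq_bigr => i _; case: eqP => [->|p0]; first by rewrite scaler0 scale0r.
  by case: (pv i) => // -[y /hull1P -> <-].
rewrite -[RHS](h (c * b)); apply: meval_eq => i; by rewrite !mxE mulrA.
Qed.

Lemma edge_form_hull (e : {fset plane}) (l : S) x : edge_form e l -> hull e x ->
  meval (fun i => embed x 0 i) l = 0.
Proof.
move=> [_ _ h] ex; apply: h; exists 1%N, (fun=> embed x), (fun=> 1); split => //.
- by move=> _; right; exists x.
- by rewrite big_ord1.
- by rewrite big_ord1 scale1r.
Qed.

Lemma edge_form_vertex (e : {fset plane}) (l : S) v : edge_form e l -> v \in e ->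
  meval (fun i => embed v 0 i) l = 0.
Proof. by move=> el ve; apply: edge_form_hull el _; exact: hull_vertex. Qed.

(* Dehomogenization: [P(x, y, z)] becomes [P(x, y, 1)]. *)
Definition dehom : S -> mpoly 2 R :=
  msubst (fun i : 'I_3 => match fintype.split (i : 'I_(2 + 1)) with inl j => X j | inr _ => 1 end).

HB.instance Definition _ := GRing.RMorphism.on dehom.
HB.instance Definition _ := GRing.Linear.on dehom.

Lemma meval_dehom (x : plane) P :
  meval (fun i => x 0 i) (dehom P) = meval (fun i => embed x 0 i) P.
Proof.
rewrite /dehom meval_msubst; apply: meval_eq => i; rewrite /embed mxE.
by case: splitP => j _; rewrite ?mevalXU ?meval1 ?mxE.
Qed.

Definition mproj (m : multinom 3) : multinom 2 :=
  Multinom (mktuple (fun i : 'I_2 => m (lshift 1 i))).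

(** The last variable makes up the missing degree; as subtraction is truncated, the result has
    degree [d] only when [mdeg k <= d]. *)
Definition mlift (d : nat) (k : multinom 2) : multinom 3 :=
  Multinom (mktuple (fun i : 'I_3 =>
    match fintype.split (i : 'I_(2 + 1)) with inl j => k j | inr _ => (d - mdeg k)%N end)).

Lemma mprojE m i : mproj m i = m (lshift 1 i).
Proof. by rewrite mnmE. Qed.

Lemma split_lshift (m n : nat) (i : 'I_m) : fintype.split (lshift n i) = inl i.
Proof. by have := unsplitK (inl i : 'I_m + 'I_n). Qed.

Lemma split_rshift (m n : nat) (i : 'I_n) : fintype.split (rshift m i) = inr i.
Proof. by have := unsplitK (inr i : 'I_m + 'I_n). Qed.

Lemma mliftEl d k (i : 'I_2) : mlift d k (lshift 1 i) = k i.
Proof. by rewrite mnmE split_lshift. Qed.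

Lemma mliftEr d k : mlift d k last3 = (d - mdeg k)%N.
Proof. by rewrite mnmE split_rshift. Qed.

Lemma mproj_lift d k : mproj (mlift d k) = k.
Proof. by apply/mnmP => i; rewrite mprojE mliftEl. Qed.

Lemma mdeg3 m : mdeg m = (mdeg (mproj m) + m last3)%N.
Proof.
rewrite !mdegE (@big_split_ord _ _ _ 2 1) big_ord1; congr (_ + _)%N.
by apply: eq_bigr => i _; rewrite mprojE.
Qed.

Lemma mproj_inj m m' : mdeg m = mdeg m' -> mproj m = mproj m' -> m = m'.
Proof.
rewrite !mdeg3 => mm pp; rewrite pp in mm; move/addnI: mm => mm.
apply/mnmP; apply: ord3P => //.
  by have := congr1 (fun k : multinom 2 => k 0) pp; rewrite !mprojE (_ : lshift 1 0 = 0)//; apply/val_inj.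
by have := congr1 (fun k : multinom 2 => k 1) pp; rewrite !mprojE (_ : lshift 1 1 = 1)//; apply/val_inj.
Qed.

Lemma dehomX m : dehom (mpolyX R m) = mpolyX R (mproj m).
Proof.
rewrite /dehom msubst_monom (@big_split_ord _ _ _ 2 1) big_ord1 mpolyXE_id.
rewrite (_ : fintype.split _ = inr 0); last exact: split_rshift.
rewrite expr1n /= mulr1; apply: eq_bigr => i _; by rewrite split_lshift mprojE.
Qed.

Lemma dehomE P : dehom P = \sum_(m <- msupp P) mcoeff m P *: mpolyX R (mproj m).
Proof.
rewrite {1}(mpolyE P) (linear_sum dehom); apply: eq_bigr => m _.
by rewrite linearZ/= dehomX.
Qed.

Lemma mcoeff_dehom P d m : P \is ishomog1 d mdeg -> mdeg m = d ->
  mcoeff (mproj m) (dehom P) = mcoeff m P.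
Proof.
move=> /dhomogP hP md; rewrite dehomE raddf_sum/=.
under eq_bigr do rewrite mcoeffZ mcoeffX.
have z m' : m' \in msupp P -> m' != m -> mcoeff m' P * (mproj m' == mproj m)%:R = 0.
  move=> m'P m'm; case: eqP => [e|_]; last by rewrite mulr0.
  by move/eqP: m'm; case; apply: mproj_inj => //; rewrite md; exact: hP.
have [mP|mP] := boolP (m \in msupp P); last first.
  rewrite big_seq big1 => [|m' m'P]; first by rewrite memN_msupp_eq0.
  by apply: z => //; apply: contraNneq mP => <-.
rewrite (bigD1_seq m) ?msupp_uniq//= eqxx mulr1 big_seq_cond big1 ?addr0// => m' /andP[].
exact: z.
Qed.

Lemma dehom_size P d : P \is ishomog1 d mdeg -> (mmeasure mdeg (dehom P) <= d.+1)%N.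
Proof.
move=> /dhomogP hP; rewrite leqNgt; apply/negP => h.
have : exists2 k, k \in msupp (dehom P) & (d < mdeg k)%N.
  apply: contrapT => nk; move: h; rewrite ltnNge => /negP; apply.
  rewrite msizeE; apply/bigmax_leqP_seq => k kP _; rewrite ltnS leqNgt; apply/negP => dk.
  by apply: nk; exists k.
move=> [k + dk]; rewrite mcoeff_msupp dehomE raddf_sum/= big_seq big1 ?eqxx// => m mP.
rewrite mcoeffZ mcoeffX; case: eqP => [e|_]; last by rewrite mulr0.
have kd : d = (mdeg k + m last3)%N by rewrite -e -mdeg3; exact/esym/hP.
by move: dk; rewrite kd ltnNge leq_addr.
Qed.

Lemma dehom_inj P d : P \is ishomog1 d mdeg -> dehom P = 0 -> P = 0.
Proof.
move=> hP P0; apply/mpolyP => m; rewrite mcoeff0.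
have [md|md] := eqVneq (mdeg m) d; last exact: dhomog_nemf_coeff hP md.
by rewrite -(mcoeff_dehom hP md) P0 mcoeff0.
Qed.

Lemma dehom_surj p d : (mmeasure mdeg p <= d.+1)%N ->
  exists2 P, P \is ishomog1 d mdeg & dehom P = p.
Proof.
move=> pd; exists (\sum_(k <- msupp p) mcoeff k p *: mpolyX R (mlift d k)).
  rewrite big_seq; apply: rpred_sum => k kp; apply: rpredZ; rewrite dhomogX.
  rewrite /= mdeg3 mproj_lift mliftEr subnKC//.
  by rewrite -ltnS; apply: leq_trans pd; exact: msize_mdeg_lt.
rewrite (linear_sum dehom) [RHS](mpolyE p); apply: eq_bigr => k _.
by rewrite linearZ/= dehomX mproj_lift.
Qed.

Lemma poly_nat_roots (p : {poly R}) : (forall n : nat, p.[n%:R] = 0) -> p = 0.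
Proof.
move=> h; apply: contrapT => /eqP p0.
have := @max_poly_roots _ p [seq i%:R | i <- iota 0 (size p)] p0.
rewrite size_map size_iota ltnn => H; suff : false by [].
apply: H; first by apply/allP => _ /mapP[i _ ->]; rewrite /root h.
by rewrite map_inj_uniq ?iota_uniq// => i j /eqP; rewrite eqr_nat => /eqP.
Qed.

(* The restriction of [q] to a line parallel to the [j]-th axis. *)
Definition axis_poly (j : 'I_3) (c : 'I_3 -> R) : S -> {poly R} :=
  mmap (@polyC R) (fun i => if i == j then 'X else (c i)%:P).

HB.instance Definition _ j c := GRing.RMorphism.on (axis_poly j c).

Lemma horner_axis_poly j c q t :
  (axis_poly j c q).[t] = meval (fun i => if i == j then t else c i) q.
Proof.
rewrite /axis_poly; elim/mpoly_gen_ind: q => [a|i|p q IHp IHq|p q IHp IHq].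
- by rewrite mmapC hornerC mevalC.
- by rewrite mmapX mmap1U mevalXU; case: ifP => _; rewrite ?hornerX ?hornerC.
- by rewrite rmorphD/= hornerD IHp IHq mevalD.
- by rewrite rmorphM/= hornerM IHp IHq mevalM.
Qed.

Lemma coef_axis_poly j c q k : (axis_poly j c q)`_k =
  \sum_(m <- msupp q | m j == k) mcoeff m q * \prod_(i | i != j) c i ^+ m i.
Proof.
rewrite /axis_poly /mmap coef_sum [RHS]big_mkcond/=; apply: eq_bigr => m _.
rewrite coefCM /mmap1 (bigD1 j)//= eqxx.
rewrite (eq_bigr (fun i => (c i ^+ m i)%:P)) => [|i /negPf ->]; last by rewrite polyC_exp.
rewrite -(big_morph _ (@polyCM R) (erefl : (1 : R)%:P = 1)) coefMC coefXn eq_sym.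
by case: eqP => _; rewrite ?mul1r// mul0r mulr0.
Qed.

(** The order of vanishing of a monomial along the [j]-th coordinate axis. *)
Definition wout (j : 'I_3) (m : multinom 3) : nat := (\sum_(i | i != j) m i)%N.

Lemma woutD j m m' : wout j (mnm_add m m') = (wout j m + wout j m')%N.
Proof. by rewrite /wout -big_split/=; apply: eq_bigr => i _; rewrite mnmDE. Qed.

Lemma ideal_pow_wlow (w : multinom 3 -> nat) (I : set S) (psi : {rmorphism S -> S}) k P :
  (forall m m', w (mnm_add m m') = (w m + w m')%N) ->
  (forall a, I a -> wlow w 1 (psi a)) -> ideal_pow I k P -> wlow w k (psi P).
Proof.
move=> wD Iw [n [a [g [gI ->]]]]; rewrite rmorph_sum; apply: wlow_sum => // i.
rewrite rmorphM; apply: wlowMl => //; have [b [bI ->]] := gI i.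
by rewrite rmorph_prod; apply: wlow_prod => // l; exact: Iw.
Qed.

Lemma ideal_powMl (I : set S) k a P : ideal_pow I k P -> ideal_pow I k (a * P).
Proof.
move=> [n [b [g [gI ->]]]]; exists n, (fun i => a * b i), g; split => //.
by rewrite mulr_sumr; apply: eq_bigr => i _; rewrite mulrA.
Qed.

Lemma ideal_genD (G : set S) P Q : ideal_gen G P -> ideal_gen G Q -> ideal_gen G (P + Q).
Proof.
move=> [n [a [g [gG ->]]]] [m [b [h [hG ->]]]].
exists (n + m)%N, (fun i => match fintype.split i with inl j => a j | inr j => b j end),
  (fun i => match fintype.split i with inl j => g j | inr j => h j end); split.
  by move=> i; case: fintype.split.
rewrite big_split_ord/=; congr (_ + _); apply: eq_bigr => i _.
  by rewrite split_lshift.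
by rewrite split_rshift.
Qed.

Lemma ideal_gen0 (G : set S) : ideal_gen G 0.
Proof. by exists 0%N, (fun=> 0), (fun=> 0); split => [[]|]//; rewrite big_ord0. Qed.

(* If the monomial [m] has weight at least [k], it is a product of [k] of the
   variables that vanish on the [j]-th axis, times a remaining factor. *)
Lemma vertex_powP (N : 'M[R]_3) j (u : plane) k P : N \in unitmx ->
  (forall i, N i j = embed u 0 i) ->
  ideal_pow (vertex_ideal u) k P <-> wlow (wout j) k (lsub N P).
Proof.
move=> Nu Nj; split.
  apply: (@ideal_pow_wlow _ _ (lsub N)); first exact: woutD.
  move=> a /vertex_idealP au.
  (* Column [j] of [N] is [embed u], so [lsub N a] vanishes on the [j]-th axis and contains no pure
     power of the [j]-th variable. *)
  have a0 : axis_poly j (fun=> 0) (lsub N a) = 0.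
    apply: poly_nat_roots => t; rewrite horner_axis_poly meval_lsub.
    rewrite -[RHS](au t%:R); apply: meval_eq => i.
    rewrite (bigD1 j)//= eqxx big1 ?addr0 => [|l /negPf ->]; last by rewrite mulr0.
    by rewrite Nj mulrC.
  move=> m; rewrite ltnS leqn0 /wout sum_nat_eq0 => /forall_inP m0.
  have := congr1 (fun p : {poly R} => p`_(m j)) a0; rewrite coef_axis_poly coef0.
  have [mP|mP] := boolP (m \in msupp (lsub N a)); last by rewrite memN_msupp_eq0.
  rewrite big_mkcond (bigD1_seq m) ?msupp_uniq//= eqxx big1 => [|i ij].
    rewrite mulr1 big1 ?addr0// => m' mm; case: eqP => // mj.
    have [i ij mi] : exists2 i, i != j & m' i != 0%N.
      apply: contrapT => nz; move/eqP: mm; apply; apply/mnmP => i.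
      have [->|ij] := eqVneq i j; first by []; rewrite (eqP (m0 i ij)); apply/eqP/negPn/negP => mi.
      by apply: nz; exists i.
    by rewrite (bigD1 i)//= expr0n (negPf mi) mul0r mulr0.
  by rewrite (eqP (m0 i ij)) expr0.
move=> h; rewrite -(lsubK P Nu); apply: (@wlow_closed R 3 (wout j) k
  (fun q => ideal_pow (vertex_ideal u) k (lsub (invmx N) q)) _ h).
- by rewrite rmorph0; exact: ideal_gen0.
- by move=> q q'; rewrite rmorphD; exact: ideal_genD.
move=> c m km _; rewrite linearZ/= -mul_mpolyC; apply: ideal_powMl.
have Xi i : i != j -> vertex_ideal u (lsub (invmx N) (X i)).
  move=> ij; apply/vertex_idealP => t; rewrite meval_lsub mevalXU.
  under eq_bigr do rewrite -Nj mulrCA.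
  rewrite -mulr_sumr (_ : \sum_j0 _ = (invmx N *m N) i j); last by rewrite mxE.
  by rewrite mulVmx// mxE (negPf ij) mulr0.
have gen : forall (k : nat) (m : multinom 3), (k <= wout j m)%N ->
    ideal_pow (vertex_ideal u) k (lsub (invmx N) (mpolyX R m)).
  elim=> [|k' IH] m' km'.
    exists 1%N, (fun=> lsub (invmx N) (mpolyX R m')), (fun=> 1); split.
      by move=> _; exists (fun=> 0); split => [[]//|]; rewrite big_ord0.
    by rewrite big_ord1 mulr1.
  have [i ij mi] : exists2 i, i != j & (0 < m' i)%N.
    apply: contrapT => nz; move: km'; rewrite /wout big1// => i ij.
    apply/eqP/negPn/negP => mi; apply: nz; exists i => //; by rewrite lt0n.
  have mE : m' = mnm_add (mnm1 i) (mnm_sub m' (mnm1 i)).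
    apply/mnmP => l; rewrite mnmDE mnmBE mnm1E; case: eqP => [<-|_]; last by rewrite subn0.
    by rewrite subnKC.
  have : ideal_pow (vertex_ideal u) k' (lsub (invmx N) (mpolyX R (mnm_sub m' (mnm1 i)))).
    apply: IH; move: km'; rewrite {1}mE woutD (_ : wout j (mnm1 i) = 1%N)//.
    rewrite /wout (bigD1 i)//= mnm1E eqxx big1 ?addn0// => l /andP[_ li].
    by rewrite mnm1E eq_sym (negPf li).
  move=> [n [a [g [gI gE]]]]; rewrite mE mpolyXD rmorphM /= gE.
  exists n, a, (fun l => lsub (invmx N) (X i) * g l); split.
    move=> l; have [b [bI gl]] := gI l.
    exists (fun o => match unlift ord0 o with Some z => b z | None => lsub (invmx N) (X i) end).
    split; first by move=> o; case: unliftP => [z _|_]; [exact: bI|exact: Xi].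
    by rewrite big_ord_recl unlift_none gl; under [in RHS]eq_bigr do rewrite liftK.
  by rewrite mulr_sumr; apply: eq_bigr => l _; rewrite mulrCA.
exact: gen.
Qed.

(** In the affine chart this linear map is the translation by [v]; it carries the last axis to the
    line through [embed v]. *)
Definition vertex_mx (v : plane) : 'M[R]_3 :=
  block_mx (1%:M : 'M[R]_2) (v^T : 'M[R]_(2, 1)) (0 : 'M[R]_(1, 2)) (1%:M : 'M[R]_1).

Lemma vertex_mx_unit v : vertex_mx v \in unitmx.
Proof.
have := det_ublock (1%:M : 'M[R]_2) (v^T) (1%:M : 'M[R]_1).
by rewrite !det1 mulr1 unitmxE => h; rewrite [\det _]h unitr1.
Qed.

Lemma vertex_mx_last v i : vertex_mx v i last3 = embed v 0 i.
Proof.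
rewrite /embed [RHS]mxE /vertex_mx mxE.
by case: fintype.split => k; rewrite mxE split_rshift !mxE ?(ord1 k).
Qed.

Lemma dehom_vertex_mx v P :
  dehom (lsub (vertex_mx v) P) = translate (fun i => v 0 i) (dehom P).
Proof.
rewrite /dehom /lsub /translate !msubst_comp; apply: eq_msubst => i.
rewrite /lform (linear_sum (msubst _))/=.
under eq_bigr do rewrite linearZ/= msubstX mxE.
rewrite (@big_split_ord _ _ _ 2 1) big_ord1 /= split_rshift.
under eq_bigr do rewrite split_lshift.
rewrite -(splitK (i : 'I_(2 + 1))); case: (fintype.split _) => k.
  have E1 (j : 'I_2) : vertex_mx v (lshift 1 k) (lshift 1 j) = (k == j)%:R.
    by transitivity ((1%:M : 'M[R]_2) k j); [exact: block_mxEul|rewrite mxE].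
  have E2 : vertex_mx v (lshift 1 k) (rshift 2 ord0) = v 0 k.
    by transitivity (v^T k (0 : 'I_1)); [exact: block_mxEur|rewrite mxE].
  rewrite [unsplit _]/(lshift 1 k) split_lshift msubstX E2.
  congr (_ + _); last by rewrite -mul_mpolyC mulr1.
  rewrite (bigD1 k)//= E1 eqxx scale1r big1 ?addr0// => j jk.
  by rewrite E1 eq_sym (negPf jk) scale0r.
have E3 (j : 'I_2) : vertex_mx v (rshift 2 k) (lshift 1 j) = 0.
  by transitivity ((0 : 'M[R]_(1, 2)) k j); [exact: block_mxEdl|rewrite mxE].
have E4 : vertex_mx v (rshift 2 k) (rshift 2 ord0) = 1.
  by transitivity ((1%:M : 'M[R]_1) k 0); [exact: block_mxEdr|rewrite mxE (ord1 k)].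
rewrite [unsplit _]/(rshift 2 k) split_rshift rmorph1 E4 scale1r.
by rewrite big1 ?add0r// => j _; rewrite E3 scale0r.
Qed.

Lemma mdeg_mproj m : mdeg (mproj m) = wout last3 m.
Proof.
apply/eqP; rewrite -(eqn_add2r (m last3)) -mdeg3 mdegE (bigD1 last3)//=.
by rewrite addnC.
Qed.

(* Homogenizing the Taylor expansion at [v]. *)
Lemma vertex_condition (v : plane) P d s : P \is ishomog1 d mdeg ->
  (forall m, (mdeg m <= s)%N -> meval (fun i => v 0 i) (mderivm m (dehom P)) = 0) <->
  ideal_pow (vertex_ideal v) s.+1 P.
Proof.
move=> hP; rewrite (vertex_powP _ _ (vertex_mx_unit v) (vertex_mx_last v)).
have hQ := lsub_homog (vertex_mx v) hP; set Q := lsub _ P in hQ *.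
have -> : (forall m, (mdeg m <= s)%N -> meval (fun i => v 0 i) (mderivm m (dehom P)) = 0) <->
    wlow (@mdeg 2) s.+1 (dehom Q).
  by rewrite /Q dehom_vertex_mx -taylor_low.
split=> [h m ms|h k ks].
  have [md|md] := eqVneq (mdeg m) d; last exact: dhomog_nemf_coeff hQ md.
  by rewrite -(mcoeff_dehom hQ md) h// mdeg_mproj.
have [kd|dk] := leqP (mdeg k) d; last first.
  apply: memN_msupp_eq0; apply: msize_mdeg_ge.
  by apply: leq_trans (dehom_size hQ) dk.
have md : mdeg (mlift d k) = d by rewrite mdeg3 mproj_lift mliftEr subnKC.
rewrite -(mproj_lift d k) (mcoeff_dehom hQ md) h// -mdeg_mproj mproj_lift//.
Qed.

Lemma unit_by_kernel (N : 'M[R]_3) :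
  (forall y : 'cV_3, N *m y = 0 -> y = 0) -> N \in unitmx.
Proof.
move=> h; rewrite -unitmx_tr -row_free_unit -kermx_eq0; apply/eqP/row_matrixP => i.
rewrite row0; have /(congr1 trmx) : row i (kermx N^T) *m N^T = 0.
  by rewrite -row_mul mulmx_ker row0.
rewrite trmx_mul trmxK trmx0 => /h /(congr1 trmx).
by rewrite trmxK trmx0.
Qed.

Lemma edge_coordinates (l : S) v w : v != w -> edge_form [fset v; w]%fset l ->
  exists2 N : 'M[R]_3, N \in unitmx &
    [/\ lsub N l = X 0, forall i, N i 1 = embed w 0 i & forall i, N i last3 = embed v 0 i].
Proof.
move=> vw el; have lv := edge_form_vertex el (fset21 _ _); have lw := edge_form_vertex el (fset22 _ _).
have [hl l0 _] := el; have [a la] := homog1_lform hl.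
have [i0 ai0] : exists i, a 0 i != 0.
  apply: contrapT => na; move/eqP: l0; apply; rewrite la /lform big1// => i _.
  by case: (eqVneq (a 0 i) 0) => [->|ai]; [rewrite scale0r|exfalso; apply: na; exists i].
(* The first column is a multiple of a basis vector, scaled so that [l] takes the value 1 there. *)
pose N : 'M[R]_3 := \matrix_(i, j) (if j == 0 then (i == i0)%:R / a 0 i0
   else if j == 1 then embed w 0 i else embed v 0 i).
have N0 i : N i 0 = (i == i0)%:R / a 0 i0 by rewrite mxE.
have N1 i : N i 1 = embed w 0 i by rewrite mxE.
have N2 i : N i last3 = embed v 0 i by rewrite mxE.
rewrite la !meval_lform in lv lw.
have aN : a *m N = delta_mx 0 0.
  apply/rowP; apply: ord3P; rewrite !mxE /=.
  - rewrite (bigD1 i0)//= N0 eqxx mul1r divff// big1 ?addr0// => i ii.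
    by rewrite N0 (negPf ii) mul0r mulr0.
  - by rewrite -[RHS]lw; apply: eq_bigr => i _; rewrite N1.
  - by rewrite -[RHS]lv; apply: eq_bigr => i _; rewrite N2.
exists N; last first.
  split => //; rewrite la lsub_lform aN /lform (bigD1 0)//= mxE !eqxx scale1r.
  by rewrite big1 ?addr0// => i i0'; rewrite mxE (negPf i0') andbF scale0r.
apply: unit_by_kernel => y Ny.
have y0 : y 0 0 = 0.
  have := congr1 (mulmx a) Ny; rewrite mulmxA aN mulmx0 => /matrixP/(_ 0 0).
  rewrite !mxE (bigD1 0)//= mxE !eqxx mul1r big1 ?addr0// => i i0'.
  by rewrite mxE (negPf i0') andbF mul0r.
have Nyi i : embed w 0 i * y 1 0 + embed v 0 i * y last3 0 = 0.
  have := congr1 (fun M : 'cV[R]_3 => M i 0) Ny; rewrite [LHS]mxE [RHS]mxE sum3 y0 mulr0 add0r.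
  by rewrite N1 N2.
have e2 := Nyi last3; rewrite !embed2 !mul1r in e2.
have y2 : y last3 0 = - y 1 0 by apply/eqP; rewrite -subr_eq0 opprK addrC e2.
have y1 : y 1 0 = 0.
  apply: contrapT => /eqP y1; move/eqP: vw; apply; apply: planeP.
    have := Nyi 0; rewrite !embed0 y2 mulrN -mulrBl => /eqP.
    by rewrite mulf_eq0 (negPf y1) orbF subr_eq0 => /eqP.
  have := Nyi 1; rewrite !embed1 y2 mulrN -mulrBl => /eqP.
  by rewrite mulf_eq0 (negPf y1) orbF subr_eq0 => /eqP.
by apply/colP; apply: ord3P; rewrite mxE ?y0 ?y1 ?y2 ?y1 ?oppr0.
Qed.

Lemma edge_idealP (r : {fset plane} -> nat) (ell : {fset plane} -> S) e P :
  edge_ideal r ell e P <-> exists q, P = ell e ^+ (r e).+1 * q.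
Proof.
split=> [[n [a [g [gE ->]]]]|[q ->]].
  exists (\sum_i a i); rewrite mulr_sumr; apply: eq_bigr => i _.
  by rewrite gE mulrC.
by exists 1%N, (fun=> q), (fun=> ell e ^+ (r e).+1); rewrite big_ord1 mulrC.
Qed.

Lemma edge_ideal_wlow N (l : S) k P : N \in unitmx -> lsub N l = X 0 ->
  (exists q, P = l ^+ k * q) <-> wlow (fun m => m 0) k (lsub N P).
Proof.
move=> Nu lN; rewrite wlow_mdvd; split=> [[q ->]|[q PN]].
  by exists (lsub N q); rewrite rmorphM rmorphXn /= lN.
exists (lsub (invmx N) q); rewrite -(lsubK P Nu) PN rmorphM rmorphXn /=.
by rewrite -lN lsubK.
Qed.

(** In edge coordinates, the points [(0, t, 1)] with [t >= 0] lie over the edge. On the line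
    [(x, t, 1)] the polynomial vanishes to order [k] at [x = 0]; so its coefficients of degree below
    [k] in [x] are polynomials in [t] that vanish at all natural numbers. *)
Lemma edge_dvd (l : S) v w k d P : v != w -> edge_form [fset v; w]%fset l ->
  P \is ishomog1 d mdeg ->
  (forall x, hull [fset v; w]%fset x -> ideal_pow (vertex_ideal x) k P) ->
  exists q, P = l ^+ k * q.
Proof.
move=> vw el hP hx; have [N Nu [lN N1 N2]] := edge_coordinates vw el.
apply/(edge_ideal_wlow k P Nu lN) => m mk.
have hQ := lsub_homog N hP; set Q := lsub N P in hQ *.
have [md|md] := eqVneq (mdeg m) d; last exact: dhomog_nemf_coeff hQ md.
pose c (t : R) (i : 'I_3) := if i == 1 then t else 1 : R.
have ax (t : R) : 0 <= t -> 'X ^+ k %| axis_poly 0 (c t) Q.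
  move=> t0; have t1 : 1 + t != 0 by rewrite gt_eqF// ltr_pwDl.
  (* The vector [embed v + t *: embed w] is [1 + t] times the embedding of this point of the
     edge. *)
  have [|n [a [g [gI PE]]]] := hx ((1 - t / (1 + t)) *: v + (t / (1 + t)) *: w).
    apply/hull2P; exists (t / (1 + t)) => //.
    by rewrite divr_ge0 ?addr_ge0//= ler_pdivrMr ?ltr_pwDl// mul1r lerDr.
  rewrite /Q PE (rmorph_sum (lsub N)) (rmorph_sum (axis_poly 0 (c t))); apply: (big_ind (fun q => 'X ^+ k %| q)) => [|p q|i _].
  - by rewrite dvdp0.
  - exact: dvdp_add.
  rewrite (rmorphM (lsub N)) (rmorphM (axis_poly 0 (c t))); apply: dvdp_mull; have [b [bI ->]] := gI i.
  rewrite (rmorph_prod (lsub N)) (rmorph_prod (axis_poly 0 (c t))); elim: k b bI {mk hx gI} => [|k' IH] b bI.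
    by rewrite expr0 dvd1p.
  rewrite big_ord_recl exprS; apply: dvdp_mul; last by apply: IH => o; exact: bI.
  rewrite -['X]subr0 dvdp_XsubCl /root horner_axis_poly meval_lsub.
  have /vertex_idealP/(_ (1 + t)) b0 := bI ord0.
  apply/eqP; rewrite -[RHS]b0; apply: meval_eq => o.
  rewrite sum3 eqxx mulr0 add0r N1 N2 /c /= mulr1.
  move: o; apply: ord3P; rewrite ?embed0 ?embed1 ?embed2 ?mxE; by field.
(* The coefficient of degree [m 0] in the first variable, with the last variable set to 1;
   homogeneity recovers a monomial from its first two exponents. *)
pose A := \sum_(m' <- msupp Q | m' 0 == m 0) mcoeff m' Q *: 'X ^+ (m' 1) : {poly R}.
have A0 : A = 0.
  apply: poly_nat_roots => t; have /dvdpP[q Eq] := ax t%:R (ler0n _ _).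
  have : (axis_poly 0 (c t%:R) Q)`_(m 0) = 0 by rewrite Eq coefMXn mk.
  rewrite coef_axis_poly => E; rewrite /A horner_sum -[RHS]E.
  apply: eq_bigr => m' _; rewrite hornerZ hornerXn; congr (_ * _).
  rewrite (bigD1 (1 : 'I_3))//= big1 ?mulr1 => [|i /andP[_ /negPf i1]].
    by rewrite /c eqxx.
  by rewrite /c i1 expr1n.
have := congr1 (fun p : {poly R} => p`_(m 1)) A0; rewrite coef0 /A coef_sum => E.
have [mQ|mQ] := boolP (m \in msupp Q); last by rewrite memN_msupp_eq0.
move: E; rewrite big_mkcond (bigD1_seq m) ?msupp_uniq//= eqxx coefZ coefXn eqxx mulr1.
rewrite big_seq_cond big1 ?addr0// => m' /andP[m'Q m'm]; case: eqP => // m0.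
rewrite coefZ coefXn; case: eqP => [m1|_]; last by rewrite mulr0.
exfalso; move/eqP: m'm; apply.
have md' : mdeg m' = mdeg m by rewrite md; move/dhomogP: hQ => /(_ _ m'Q).
apply: mproj_inj => //; apply/mnmP => i; rewrite !mprojE.
have [->|->//] : lshift 1 i = 0 :> 'I_3 \/ lshift 1 i = 1 :> 'I_3.
  by case: i => -[|[|i']] lti; [left|right|]; try exact/val_inj.
by rewrite m0.
Qed.

End ThreeVariables.

(** * Piecewise polynomial functions *)

Section PolynomialFunctions.
Variable R : realType.
Local Notation plane := 'rV[R]_2.
Local Notation ev p := (fun y : plane => meval (fun i => y 0 i) p).
Implicit Types (p q l : mpoly 2 R) (x y : plane).

Lemma is_derive_coord x (v : plane) j : is_derive x v (fun y : plane => y 0 j) (v 0 j).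
Proof.
have did : derivable (id : plane -> plane) x v by apply: derivable_id.
apply: DeriveDef; first by move/derivable_mxP : did; apply.
by have := derive_mx did; rewrite derive_id => /matrixP/(_ 0 j); rewrite mxE.
Qed.

Lemma is_derive_meval p x i :
  is_derive x (delta_mx 0 i) (ev p) (meval (fun j => x 0 j) (mderiv i p)).
Proof.
elim/mpoly_gen_ind: p => [c|j|p q IHp IHq|p q IHp IHq].
- rewrite (_ : ev _ = cst c); last by apply/funext => y; rewrite mevalC.
  by rewrite mderivC meval0; exact: is_derive_cst.
- rewrite (_ : ev _ = fun y : plane => y 0 j); last by apply/funext => y; rewrite mevalXU.
  apply: is_derive_eq (is_derive_coord x (delta_mx 0 i) j) _.
  by rewrite mderivXU mevalC !mxE eqxx.
- rewrite (_ : ev _ = ev p + ev q); last by apply/funext => y; rewrite mevalD.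
  by rewrite mderivD mevalD; exact: is_deriveD.
- rewrite (_ : ev _ = ev p * ev q); last by apply/funext => y; rewrite mevalM.
  apply: is_derive_eq (is_deriveM IHp IHq) _.
  by rewrite mderivM mevalD !mevalM /= addrC mulrC.
Qed.

Lemma meval_continuous p : continuous (ev p).
Proof.
elim/mpoly_gen_ind: p => [c|j|p q IHp IHq|p q IHp IHq] x.
- rewrite (_ : ev _ = cst c); last by apply/funext => y; rewrite mevalC.
  exact: cst_continuous.
- rewrite (_ : ev _ = fun y : plane => y 0 j); last by apply/funext => y; rewrite mevalXU.
  exact: coord_continuous.
- rewrite (_ : ev _ = fun y => ev p y + ev q y); last by apply/funext => y; rewrite mevalD.
  exact: (cvgD (IHp x) (IHq x)).
- rewrite (_ : ev _ = fun y => ev p y * ev q y); last by apply/funext => y; rewrite mevalM.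
  exact: (cvgM (IHp x) (IHq x)).
Qed.

Lemma near0_mderiv p x i : (\forall y \near x, ev p y = 0) ->
  \forall y \near x, ev (mderiv i p) y = 0.
Proof.
move=> /nbhs_interior; apply: filterS => y hy.
have d0 : is_derive y (delta_mx 0 i) (ev p) 0.
  apply: (@near_eq_is_derive _ _ _ (cst (0 : R))).
  by have : \forall z \near y, ev p z = 0; [exact: hy|apply: filterS => z ->].
by rewrite -(@derive_val _ _ _ _ _ _ _ (is_derive_meval p y i)) (@derive_val _ _ _ _ _ _ _ d0).
Qed.

(** All derivatives vanish at [x], hence so does the whole Taylor expansion there. *)
Lemma near0_mpoly p x : (\forall y \near x, ev p y = 0) -> p = 0.
Proof.
move=> p0; have dm m : \forall y \near x, ev (mderivm m p) y = 0.
  rewrite /mderivm; elim: (enum _) => //= i s IH.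
  by elim: (m i) => //= k IHk; exact: near0_mderiv.
have tp0 : translate (fun i => x 0 i) p = 0.
  apply/mpolyP => m; rewrite mcoeff0.
  have /taylor_low : forall m', (mdeg m' < (mdeg m).+1)%N ->
      meval (fun i => x 0 i) (mderivm m' p) = 0.
    by move=> m' _; exact: (nbhs_singleton (dm m')).
  by apply.
by rewrite -(translateK (fun i => x 0 i) p) tp0 /translate rmorph0.
Qed.

(** The shape of the regions does not matter: every difference quotient of [h] at [x] is one of [f]
    or one of [g]. *)
Lemma is_derive_piecewise (f g h : plane -> R) x (v : plane) (d : R) :
  is_derive x v f d -> is_derive x v g d -> f x = g x ->
  (forall y, h y = f y \/ h y = g y) -> is_derive x v h d.
Proof.
move=> [df fd] [dg gd] fg hfg.
have hx : h x = f x by case: (hfg x) => ->.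
have cf : (fun t : R => t^-1 *: ((f \o shift x) (t *: v) - f x)) @ 0^' --> d by rewrite -fd.
have cg : (fun t : R => t^-1 *: ((g \o shift x) (t *: v) - g x)) @ 0^' --> d by rewrite -gd.
have ch : (fun t : R => t^-1 *: ((h \o shift x) (t *: v) - h x)) @ 0^' --> d.
  move=> V Vd; have := cf V Vd; have := cg V Vd => Vg Vf.
  suff : \forall t \near 0^', V (t^-1 *: ((h \o shift x) (t *: v) - h x)) by [].
  near=> t; rewrite /= hx.
  have [e|e] := hfg (t *: v + x); rewrite e.
    by near: t.
  by rewrite fg; near: t.
apply: DeriveDef; first by apply/cvg_ex; exists d.
exact: cvg_lim ch.
Unshelve. all: by end_near. Qed.

Definition piecewise l p p' : plane -> R := fun x => if 0 <= ev l x then ev p x else ev p' x.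

Lemma piecewise_or l p p' y : piecewise l p p' y = ev p y \/ piecewise l p p' y = ev p' y.
Proof. by rewrite /piecewise; case: ifP; [left|right]. Qed.

Lemma piecewise_near l p p' x : ev l x != 0 ->
  (\forall y \near x, piecewise l p p' y = ev p y) /\ 0 < ev l x \/
  (\forall y \near x, piecewise l p p' y = ev p' y) /\ ev l x < 0.
Proof.
move=> l0; have lc := @meval_continuous l x.
have [lneg|lpos|/eqP] := ltgtP (ev l x) 0; last by rewrite (negPf l0).
  right; split => //; near=> y; rewrite /piecewise leNgt ifF//; apply/negbF.
  by near: y; exact: (cvgr_lt _ lc _ lneg).
left; split => //; near=> y; rewrite /piecewise ltW//.
by near: y; exact: (cvgr_gt _ lc _ lpos).
Unshelve. all: by end_near. Qed.

Lemma piecewise_continuous l p p' x : (ev l x = 0 -> ev p x = ev p' x) ->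
  {for x, continuous (piecewise l p p')}.
Proof.
move=> h; have [l0|l0] := eqVneq (ev l x) 0.
  have e := h l0; move=> V; have -> : piecewise l p p' x = ev p x.
    by rewrite /piecewise l0 lexx.
  move=> Vx; have Vp := @meval_continuous p x V Vx.
  have Vp' : \forall y \near x, V (ev p' y).
    by apply: (@meval_continuous p' x V); rewrite /= -e.
  suff : \forall y \near x, V (piecewise l p p' y) by [].
  near=> y; case: (piecewise_or l p p' y) => ->; near: y; [exact: Vp|exact: Vp'].
have [[nq _]|[nq _]] := piecewise_near p p' l0.
  move=> V; rewrite (nbhs_singleton nq) => Vx.
  suff : \forall y \near x, V (piecewise l p p' y) by [].
  near=> y; rewrite (near nq y)//; near: y; exact: (@meval_continuous p x V Vx).
move=> V; rewrite (nbhs_singleton nq) => Vx.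
suff : \forall y \near x, V (piecewise l p p' y) by [].
near=> y; rewrite (near nq y)//; near: y; exact: (@meval_continuous p' x V Vx).
Unshelve. all: by end_near. Qed.

Lemma mderiv_exp l i k : mderiv i (l ^+ k.+1) = k.+1%:R *: (l ^+ k * mderiv i l).
Proof.
elim: k => [|k IH]; first by rewrite expr1 expr0 mul1r scale1r.
rewrite exprS mderivM IH -(natr1 k.+1) scalerDl scale1r -scalerAr mulrA -exprS addrC.
by rewrite [mderiv i l * _]mulrC.
Qed.

(* The difference vanishes to order [k] along the line [l = 0]; differentiating lowers
   this order by one. *)
Lemma piecewise_class_C l k p p' q : p - p' = l ^+ k.+1 * q ->
  class_C_open k [set: plane] (piecewise l p p').
Proof.
elim: k p p' q => [|k IH] p p' q pq.
  split=> // x _; apply: piecewise_continuous => l0; apply/eqP.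
  by rewrite -subr_eq0 -mevalB pq mevalM rmorphXn /= l0 expr0n mul0r.
split=> [x _|i].
  apply: piecewise_continuous => l0; apply/eqP.
  by rewrite -subr_eq0 -mevalB pq mevalM rmorphXn /= l0 expr0n mul0r.
have dpq : mderiv i p - mderiv i p' = l ^+ k.+1 * (k.+2%:R *: (mderiv i l * q) + l * mderiv i q).
  rewrite -mderivB pq mderivM mderiv_exp mulrDr -scalerAl -scalerAr -!mulrA; congr (_ + _).
  by rewrite !mulrA -exprSr.
have dE x : is_derive x (delta_mx 0 i) (piecewise l p p') (piecewise l (mderiv i p) (mderiv i p') x).
  have [l0|l0] := eqVneq (ev l x) 0.
    have pE : piecewise l (mderiv i p) (mderiv i p') x = ev (mderiv i p) x.
      by rewrite /piecewise l0 lexx.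
    rewrite pE; apply: (@is_derive_piecewise (ev p) (ev p')).
    - exact: is_derive_meval.
    - apply: is_derive_eq (is_derive_meval p' x i) _; apply/esym/eqP.
      by rewrite -subr_eq0 -mevalB dpq mevalM rmorphXn /= l0 expr0n mul0r.
    - by apply/eqP; rewrite -subr_eq0 -mevalB pq mevalM rmorphXn /= l0 expr0n mul0r.
    - exact: piecewise_or.
  have [[nq lx]|[nq lx]] := piecewise_near p p' l0.
    rewrite {2}/piecewise ltW//.
    by apply: near_eq_is_derive (is_derive_meval p x i); apply: filterS nq => y ->.
  rewrite {2}/piecewise leNgt lx /=.
  by apply: near_eq_is_derive (is_derive_meval p' x i); apply: filterS nq => y ->.
split=> [x _|]; first by have [] := dE x.
rewrite (_ : (fun x => _) = piecewise l (mderiv i p) (mderiv i p')).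
  exact: IH dpq.
by apply/funext => x; have [_ ->] := dE x.
Qed.

Lemma mnm_pos (n : nat) (m : multinom n) : (0 < mdeg m)%N ->
  exists i m', m = mnm_add (mnm1 i) m' /\ mdeg m = (mdeg m').+1.
Proof.
move=> m0; have [i mi] : exists i, (0 < m i)%N.
  apply: contrapT => nz; move: m0; rewrite mdegE big1// => i _.
  by apply/eqP/negPn/negP => mi; apply: nz; exists i; rewrite lt0n.
exists i, (mnm_sub m (mnm1 i)).
have mE : m = mnm_add (mnm1 i) (mnm_sub m (mnm1 i)).
  apply/mnmP => l; rewrite mnmDE mnmBE mnm1E; case: eqP => [<-|_]; last by rewrite subn0.
  by rewrite subnKC.
by split => //; rewrite {1}mE mdegD mdeg1.
Qed.

(** The derivatives agree in the interior of [A]; by continuity, a discrepancy at a point of [A]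
    would persist nearby, hence at an interior point. *)
Lemma deriv_on_closure (U A : set plane) (g : plane -> R) p i : open U -> A `<=` U ->
  A `<=` closure A° -> (forall x, A x -> g x = ev p x) ->
  (forall x, U x -> {for x, continuous (fun x => 'D_(delta_mx 0 i) g x)}) ->
  forall x, A x -> 'D_(delta_mx 0 i) g x = ev (mderiv i p) x.
Proof.
move=> oU AU Acl gp gc x Ax; apply/eqP; rewrite -subr_eq0; apply/negPn/negP => ne.
have c1 : {for x, continuous (fun y => 'D_(delta_mx 0 i) g y - ev (mderiv i p) y)}.
  exact: (cvgB (gc x (AU x Ax)) (@meval_continuous (mderiv i p) x)).
have nz : \forall y \near x, 'D_(delta_mx 0 i) g y - ev (mderiv i p) y != 0.
  by have := c1 _ (open_nbhs_nbhs (conj (@open_neq R 0) ne)).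
have [y [Ay]] := Acl x Ax _ nz; case/negP; rewrite subr_eq0; apply/eqP.
apply: (@derive_val _ _ _ _ _ _ _).
apply: near_eq_is_derive (is_derive_meval p y i).
by have := Ay; apply: filterS => z Az; rewrite gp.
Qed.

Lemma class_C_vanish k (U A A' : set plane) (g : plane -> R) p p' : open U ->
  A `<=` U -> A' `<=` U -> A `<=` closure A° -> A' `<=` closure A'° ->
  (forall x, A x -> g x = ev p x) -> (forall x, A' x -> g x = ev p' x) ->
  class_C_open k U g -> forall x, A x -> A' x ->
  forall m, (mdeg m <= k)%N -> meval (fun i => x 0 i) (mderivm m (p - p')) = 0.
Proof.
move=> oU AU AU' Acl Acl'; elim: k g p p' => [|k IH] g p p' gp gp' [gc gC] x Ax Ax' m mk.
  have -> : m = mnm0 by apply/eqP; rewrite -mdeg_eq0 -leqn0.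
  by rewrite mderivm0m mevalB -gp// -gp'// subrr.
have [m0|m0] := posnP (mdeg m).
  have -> : m = mnm0 by apply/eqP; rewrite -mdeg_eq0 m0.
  by rewrite mderivm0m mevalB -gp// -gp'// subrr.
have [i [m' [mE dm]]] := mnm_pos m0; rewrite dm in mk; rewrite mE.
rewrite mderivmDm mderivmU1m mderivB.
have [gd gC'] := gC i.
have gc' y : U y -> {for y, continuous (fun x => 'D_(delta_mx 0 i) g x)}.
  by case: (k) gC' => [|k'] [h _]; exact: h.
apply: (IH _ _ _ _ _ gC' x Ax Ax'); last by [].
  exact: deriv_on_closure oU AU Acl gp gc'.
exact: deriv_on_closure oU AU' Acl' gp' gc'.
Qed.

Lemma hull3_interior (v w u x : plane) : area v w u != 0 ->
  0 < area x w u * area v w u -> 0 < area v x u * area v w u ->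
  0 < area v w x * area v w u -> (hull [fset v; w; u]%fset)° x.
Proof.
move=> D h1 h2 h3.
have c1 : {for x, continuous (fun x => area w u x * area v w u)}.
  exact: (cvgM (@area_continuous _ w u x) (cvg_cst _)).
have c2 : {for x, continuous (fun x => area u v x * area v w u)}.
  exact: (cvgM (@area_continuous _ u v x) (cvg_cst _)).
have c3 : {for x, continuous (fun x => area v w x * area v w u)}.
  exact: (cvgM (@area_continuous _ v w x) (cvg_cst _)).
rewrite area_rot in h1; rewrite -area_rot in h2.
have n1 := cvgr_gt _ c1 _ h1; have n2 := cvgr_gt _ c2 _ h2; have n3 := cvgr_gt _ c3 _ h3.
near=> y; apply/(hull3P _ D); split.
- by rewrite area_rot ltW//; near: y; exact: n1.
- by rewrite -area_rot ltW//; near: y; exact: n2.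
- by rewrite ltW//; near: y; exact: n3.
Unshelve. all: by end_near. Qed.

Lemma hull3_closure_interior (v w u : plane) : area v w u != 0 ->
  hull [fset v; w; u]%fset `<=` closure (hull [fset v; w; u]%fset)°.
Proof.
move=> D x /(hull3P _ D)[h1 h2 h3] V Vx.
(* Moving towards the centroid makes all barycentric coordinates positive. *)
pose c : plane := 3^-1 *: (v + w + u).
have := near_ray (c - x) Vx => h.
have : \forall s \near 0^'+, [/\ (0 : R) < s, s < 1 & V (x + s *: (c - x))].
  near=> s; split; [near: s; exact: nbhs_right_gt|near: s; exact: nbhs_right_lt|].
  by near: s; exact: h.
move=> /filter_ex[s [s0 s1 Vs]]; exists (x + s *: (c - x)); split => //.
have D2 : 0 < area v w u ^+ 2 by rewrite exprn_even_gt0.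
have s1' : 0 <= 1 - s by rewrite subr_ge0 ltW.
have pos (a : R) : 0 <= a -> 0 < (1 - s) * a + s / 3 * area v w u ^+ 2.
  by move=> a0; rewrite ltr_wpDl ?mulr_ge0// mulr_gt0// divr_gt0.
apply: hull3_interior => //.
- rewrite (_ : _ * _ = (1 - s) * (area x w u * area v w u) + s / 3 * area v w u ^+ 2) ?pos//.
  by rewrite /area /c !mxE; field.
- rewrite (_ : _ * _ = (1 - s) * (area v x u * area v w u) + s / 3 * area v w u ^+ 2) ?pos//.
  by rewrite /area /c !mxE; field.
- rewrite (_ : _ * _ = (1 - s) * (area v w x * area v w u) + s / 3 * area v w u ^+ 2) ?pos//.
  by rewrite /area /c !mxE; field.
Unshelve. all: by end_near. Qed.

Lemma represents_unique (f : plane -> R) v w u p p' : area v w u != 0 ->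
  represents f [fset v; w; u]%fset p -> represents f [fset v; w; u]%fset p' -> p = p'.
Proof.
move=> D fp fp'; apply/eqP; rewrite -subr_eq0; apply/eqP.
have vh : hull [fset v; w; u]%fset v by apply: hull_vertex; rewrite !inE eqxx.
have [x [xi _]] := hull3_closure_interior D vh filterT.
apply: (@near0_mpoly _ x); have := xi; apply: filterS => y hy.
by rewrite mevalB -fp// -fp'// subrr.
Qed.

End PolynomialFunctions.

(** * Splines as compatible families of forms *)

Section SplinesAsFamilies.
Variable R : realType.
Local Notation plane := 'rV[R]_2.
Local Notation S := (mpoly 3 R).
Local Notation ev3 P x := (meval (fun i => embed x 0 i) P).
Implicit Types (v w u x y : plane) (b e t : {fset plane}).

(** The last factor is [area v w] made homogeneous in [P]. It is a linear form vanishing on the same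
    plane as [l], so it is proportional to [l], and evaluation at [u] gives the ratio. *)
Lemma edge_form_cross (l : S) v w u (P : 'rV[R]_3) : v != w -> edge_form [fset v; w]%fset l ->
  meval (fun i => P 0 i) l * area v w u =
  ev3 l u * ((w 0 0 - v 0 0) * (P 0 1 - P 0 last3 * v 0 1) -
             (w 0 1 - v 0 1) * (P 0 0 - P 0 last3 * v 0 0)).
Proof.
move=> vw el; have [hl _ _] := el; have [a la] := homog1_lform hl.
have := edge_form_vertex el (fset21 v w); have := edge_form_vertex el (fset22 v w).
rewrite la !meval_lform !sum3 !embed0 !embed1 !embed2 /area => hw hv.
set a0 := a 0 0 in hv hw *; set a1 := a 0 1 in hv hw *; set a2 := a 0 last3 in hv hw *.
have ea2 : a2 = - (a0 * v 0 0 + a1 * v 0 1) by lra.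
have ed : a0 * (w 0 0 - v 0 0) + a1 * (w 0 1 - v 0 1) = 0 by lra.
apply/eqP; rewrite -subr_eq0 ea2; apply/eqP.
transitivity ((a0 * (w 0 0 - v 0 0) + a1 * (w 0 1 - v 0 1)) *
  ((P 0 0 - P 0 last3 * v 0 0) * (u 0 1 - v 0 1) - (P 0 1 - P 0 last3 * v 0 1) * (u 0 0 - v 0 0))).
  by ring.
by rewrite ed mul0r.
Qed.

Lemma edge_form_area (l : S) v w u x : v != w -> edge_form [fset v; w]%fset l ->
  ev3 l x * area v w u = ev3 l u * area v w x.
Proof.
by move=> vw el; rewrite (edge_form_cross u (embed x) vw el) embed0 embed1 embed2 !mul1r.
Qed.

Lemma edge_form_neq0 (l : S) v w u : v != w -> edge_form [fset v; w]%fset l ->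
  area v w u != 0 -> ev3 l u != 0.
Proof.
move=> vw el D; apply/eqP => lu; have [hl /eqP l0 _] := el; apply: l0.
apply: (dehom_inj hl); apply: (@near0_mpoly _ _ v); near=> x.
rewrite meval_dehom; apply/eqP; rewrite -(mulIr_eq0 _ (mulIf D)) (edge_form_area _ _ vw el).
by rewrite lu mul0r.
Unshelve. all: by end_near. Qed.

Section Complex.
Variables (K : {fset {fset plane}}) (KC : simplicial_complex K)
  (KD : homeomorphic (carrier K) (@unit_disk R)).
Variables (r : {fset plane} -> nat) (s : plane -> nat) (ell : {fset plane} -> S)
  (ell_form : forall e, e \in interior_edges K -> edge_form e (ell e)).

Definition triangle_at x : {fset plane} :=
  xget fset0 [set t | t \in faces K 2 /\ hull t x].

Lemma triangle_atP x : carrier K x -> triangle_at x \in faces K 2 /\ hull (triangle_at x) x.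
Proof.
by move=> /(carrier_triangle KC KD)[t tK tx]; rewrite /triangle_at; case: xgetP => // /(_ t); case.
Qed.

(** Zero off the carrier, as [splines] requires; for a compatible family the choice of the triangle
    at [x] is immaterial. *)
Definition realize (phi : {fset plane} -> S) : plane -> R :=
  fun x => if `[< carrier K x >] then ev3 (phi (triangle_at x)) x else 0.

Definition compatible (phi : {fset plane} -> S) : Prop :=
  forall e t t', e \in interior_edges K -> t \in faces K 2 -> t' \in faces K 2 ->
    (e `<=` t)%fset -> (e `<=` t')%fset -> J_edge r s ell e (phi t - phi t').

Lemma J_edge0 e : J_edge r s ell e 0.
Proof.
split; first by apply/edge_idealP; exists 0; rewrite mulr0.
by move=> v _; exact: ideal_gen0.
Qed.

(** Distinct triangles meet in an edge or in a vertex. On a common edge the difference is divisible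
    by a form vanishing there; at a mere common vertex, equality is carried around the star. *)
Lemma compatible_glue phi t t' x : compatible phi -> t \in faces K 2 -> t' \in faces K 2 ->
  hull t x -> hull t' x -> ev3 (phi t) x = ev3 (phi t') x.
Proof.
move=> cphi; have edge (v w y : plane) (u u' : {fset plane}) : v != w -> u \in faces K 2 -> u' \in faces K 2 ->
    v \in u -> w \in u -> v \in u' -> w \in u' -> hull [fset v; w]%fset y ->
    ev3 (phi u) y = ev3 (phi u') y.
  move=> vw uK u'K vu wu vu' wu' ye; have [->//|uu'] := eqVneq u u'.
  have eK := shared_edge_interior KC uK u'K uu' vw vu wu vu' wu'.
  have eu : ([fset v; w] `<=` u)%fset by rewrite fsubUset !fsub1set vu.
  have eu' : ([fset v; w] `<=` u')%fset by rewrite fsubUset !fsub1set vu'.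
  have [/edge_idealP[q qE] _] := cphi _ _ _ eK uK u'K eu eu'.
  apply/eqP; rewrite -subr_eq0 -mevalB qE mevalM rmorphXn /=.
  by rewrite (edge_form_hull (ell_form eK) ye) expr0n mul0r.
move=> tK t'K tx t'x; have [tF tc] := (faceP K t 2).1 tK; have [t'F t'c] := (faceP K t' 2).1 t'K.
have : hull (t `&` t')%fset x by rewrite -(face_cap KC tF t'F).
have [->//|tt'] := eqVneq t t'.
have sub2 v : v \in t -> v \in t' -> hull [fset v]%fset x -> ev3 (phi t) x = ev3 (phi t') x.
  move=> vt vt' /hull1P ->.
  have h (u u' : {fset plane}) w : u \in faces K 2 -> u' \in faces K 2 -> v != w -> v \in u -> w \in u ->
      v \in u' -> w \in u' -> ev3 (phi u) v = ev3 (phi u') v.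
    move=> uK u'K vw vu wu vu' wu'; apply: (edge v w) => //.
    by apply: hull_vertex; rewrite !inE eqxx.
  exact: (star_connected KC KD h tK t'K vt vt').
have [->|[v]] := fset_0Vmem (t `&` t')%fset; first by move=> /hull0.
rewrite inE => /andP[vt vt'] bx.
have [b0|[w]] := fset_0Vmem ((t `&` t') `\ v)%fset.
  apply: (sub2 v) => //; apply: hullS bx; apply/fsubsetP => y yb.
  have : y \notin ((t `&` t') `\ v)%fset by rewrite b0 inE.
  by rewrite in_fsetD1 yb andbT negbK inE.
rewrite !inE => /and3P[wv wt wt']; rewrite eq_sym in wv.
have [u tE D] := triangle_edge KC tK vt wt wv.
apply: (edge v w) => //; apply: hullS bx; apply/fsubsetP => y.
rewrite inE {1}tE !inE => /andP[/orP[//|/eqP -> ut']]; exfalso.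
move/eqP: tt'; apply; apply/eqP; rewrite eqEfcard t'c tc leqnn andbT.
by rewrite tE !fsubUset !fsub1set vt' wt' ut'.
Qed.

Lemma realizeE phi t x : compatible phi -> t \in faces K 2 -> hull t x ->
  realize phi x = ev3 (phi t) x.
Proof.
move=> cphi tK tx; have cx : carrier K x by apply/(carrier_triangle KC KD); exists t.
rewrite /realize asboolT//; have [uK ux] := triangle_atP cx.
exact: compatible_glue.
Qed.

(** Near [x] only the triangles at [x] occur, and their polynomials all take the same value at
    [x]. *)
Lemma realize_continuous phi : compatible phi -> {within carrier K, continuous (realize phi)}.
Proof.
move=> cphi; apply/subspace_continuousP => x cx V.
rewrite /from_subspace => Vx.
have all : \forall y \near x, forall t : faces K 2, hull (val t) x -> V (ev3 (phi (val t)) y).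
  have := @filter_forall _ _ (fun (t : faces K 2) y => hull (val t) x -> V (ev3 (phi (val t)) y)) (nbhs x) _.
  apply=> t; have [tx|tx] := pselect (hull (val t) x); last by apply: nearW.
  rewrite (realizeE cphi (valP t) tx) -meval_dehom in Vx.
  have ct := @meval_continuous _ (dehom (phi (val t))) x V Vx.
  by near=> y => _; rewrite -meval_dehom; near: y; exact: ct.
have st := local_star KC x.
suff : \forall y \near x, carrier K y -> V (realize phi y) by [].
near=> y => cy; have [t tK ty] := (carrier_triangle KC KD y).1 cy.
have ally : forall t : faces K 2, hull (val t) x -> V (ev3 (phi (val t)) y).
  by near: y; exact: all.
have sty : forall b, b \in K -> hull b y -> hull b x by near: y; exact: st.
rewrite (realizeE cphi tK ty); apply: (ally [` tK]%fset); apply: sty => //.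
by have [] := (faceP K t 2).1 tK.
Unshelve. all: by end_near. Qed.

Lemma triangle_represents_unique (f : plane -> R) t (p p' : mpoly 2 R) : t \in faces K 2 ->
  represents f t p -> represents f t p' -> p = p'.
Proof.
move=> tK; have [tF tc] := (faceP K t 2).1 tK; have [v [w [u [vwu tE]]]] := card3_fset tc.
by rewrite tE in tF *; exact: represents_unique (affine_indep_area KC tF vwu).
Qed.

Lemma triangle_closure_interior t : t \in faces K 2 -> hull t `<=` closure (hull t)°.
Proof.
move=> tK; have [tF tc] := (faceP K t 2).1 tK; have [v [w [u [vwu tE]]]] := card3_fset tc.
by rewrite tE in tF *; exact: hull3_closure_interior (affine_indep_area KC tF vwu).
Qed.

Lemma realize_class_C phi v w u u' : compatible phi -> v != w ->
  [fset v; w]%fset \in interior_edges K ->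
  [fset v; w; u]%fset \in faces K 2 -> [fset v; w; u']%fset \in faces K 2 ->
  area v w u * area v w u' < 0 ->
  class_C (r [fset v; w]%fset)
    (hull [fset v; w; u]%fset `|` hull [fset v; w; u']%fset) (realize phi).
Proof.
set e := [fset v; w]%fset; set t := [fset v; w; u]%fset; set t' := [fset v; w; u']%fset.
move=> cphi vw eK tK t'K uu'; have el := ell_form eK.
have D : area v w u != 0 by apply: contraTneq uu' => ->; rewrite mul0r ltxx.
have D' : area v w u' != 0 by apply: contraTneq uu' => ->; rewrite mulr0 ltxx.
have et : (e `<=` t)%fset by exact: fsubsetUl.
have et' : (e `<=` t')%fset by exact: fsubsetUl.
have [/edge_idealP[q qE] _] := cphi _ _ _ eK tK t'K et et'.
set c := ev3 (ell e) u; have c0 : c != 0 := edge_form_neq0 vw el D.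
(* Multiplied by its own value at [u], the form is nonnegative on the side of [u] and negative
   strictly on the other side. *)
pose l := c *: dehom (ell e).
have lE x : meval (fun i => x 0 i) l = c * ev3 (ell e) x by rewrite mevalZ meval_dehom.
have larea x : meval (fun i => x 0 i) l * area v w u ^+ 2 = c ^+ 2 * (area v w x * area v w u).
  by rewrite lE expr2 mulrA -(mulrA c) (edge_form_area _ _ vw el) /c; ring.
have D2 : 0 < area v w u ^+ 2 by rewrite exprn_even_gt0.
have c2 : 0 < c ^+ 2 by rewrite exprn_even_gt0.
exists setT, (piecewise l (dehom (phi t)) (dehom (phi t'))); split => //.
- exact: openT.
- move=> x [tx|t'x]; rewrite /piecewise.
    rewrite (realizeE cphi tK tx) -(pmulr_lge0 _ D2) larea pmulr_rge0//.
    by have [_ _ ->] := (hull3P x D).1 tx; rewrite meval_dehom.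
  rewrite (realizeE cphi t'K t'x); case: ifP => [l0|_]; last by rewrite meval_dehom.
  (* A point of [t'] on the nonnegative side lies on the line of the edge, where both polynomials
     agree. *)
  have [_ _ h3] := (hull3P x D').1 t'x.
  have : area v w x * area v w u <= 0.
    rewrite -(pmulr_lle0 _ (_ : 0 < area v w u' ^+ 2)) ?exprn_even_gt0//.
    rewrite (_ : _ * _ ^+ 2 = (area v w x * area v w u') * (area v w u * area v w u')); last by ring.
    by rewrite mulr_ge0_le0// ltW.
  rewrite -(pmulr_rle0 _ c2) -larea (pmulr_lle0 _ D2) => l0'.
  have lx : c * ev3 (ell e) x = 0 by rewrite -lE; apply/eqP; rewrite eq_le l0 l0'.
  have lx0 : ev3 (ell e) x = 0 by apply/eqP; move/eqP: lx; rewrite mulf_eq0 (negPf c0).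
  rewrite meval_dehom; apply/esym/eqP; rewrite -subr_eq0 -mevalB qE mevalM rmorphXn /=.
  by rewrite lx0 expr0n mul0r.
apply: (@piecewise_class_C _ _ _ _ _ ((c ^+ (r e).+1)^-1 *: dehom q)).
rewrite -scalerAr exprZn -scalerAl scalerA mulVf ?expf_neq0// scale1r.
have := congr1 (@dehom R) qE.
by rewrite (raddfB (@dehom R)) (rmorphM (@dehom R)) (rmorphXn (@dehom R)).
Qed.

Lemma realize_spline phi d : compatible phi ->
  (forall t, t \in faces K 2 -> phi t \is ishomog1 d mdeg) -> splines K r s d (realize phi).
Proof.
move=> cphi hphi.
have rep t : t \in faces K 2 -> represents (realize phi) t (dehom (phi t)).
  by move=> tK x tx; rewrite meval_dehom (realizeE cphi tK tx).
split.
- split; first exact: realize_continuous.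
  by move=> x nx; rewrite /realize asboolF.
- by move=> t tK; exists (dehom (phi t)); [exact: dehom_size (hphi t tK)|exact: rep].
- move=> e t t' eK tK t'K tt' et et'.
  have [v [w [vw eE]]] := interior_edge_ends eK.
  subst e; have [u [u' [uK u'K Du Du' tE]]] := interior_edge_triangles KC vw eK.
  have := tE t; have := tE t'; rewrite tK t'K et et' /=.
  have uu' : area v w u * area v w u' < 0 by rewrite pmulr_rlt0.
  have u'u : area v w u' * area v w u < 0 by rewrite mulrC.
  move=> /esym/orP[]/eqP t'E /esym/orP[]/eqP tE'; move: tt'; rewrite tE' t'E ?eqxx// => _.
    exact: (realize_class_C cphi vw eK u'K uK).
  exact: (realize_class_C cphi vw eK).
move=> v t t' vK tK t'K vt vt' p p' fp fp' m ms.
rewrite (triangle_represents_unique tK fp (rep t tK)).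
rewrite (triangle_represents_unique t'K fp' (rep t' t'K)).
(* Agreement of derivatives at [v] is known only across interior edges; connectedness of the star
   carries it to all triangles at [v]. *)
apply: (@star_connected _ _ KC KD _
  (fun t => meval (fun i => v 0 i) (mderivm m (dehom (phi t)))) v) => // {tK t'K vt vt' fp fp'}.
move=> {}t {}t' w tK t'K vw vt wt vt' wt'; have [->//|tt'] := eqVneq t t'.
have eK := shared_edge_interior KC tK t'K tt' vw vt wt vt' wt'.
have et : ([fset v; w] `<=` t)%fset by rewrite fsubUset !fsub1set vt.
have et' : ([fset v; w] `<=` t')%fset by rewrite fsubUset !fsub1set vt'.
have [_ /(_ v (fset21 v w)) Jv] := cphi _ _ _ eK tK t'K et et'.
have := (vertex_condition v (s v) (rpredB (hphi t tK) (hphi t' t'K))).2 Jv m ms.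
by rewrite (raddfB (@dehom R)) raddfB mevalB => /eqP; rewrite subr_eq0 => /eqP.
Qed.

Lemma spline_realize f d : splines K r s d f ->
  exists phi, [/\ compatible phi,
    forall t, t \in faces K 2 -> phi t \is ishomog1 d mdeg & f = realize phi].
Proof.
move=> [[fc f0] fpoly fC fv].
pose phi t : S := xget 0 [set P | P \is ishomog1 d mdeg /\ represents f t (dehom P)].
have phiP t : t \in faces K 2 -> phi t \is ishomog1 d mdeg /\ represents f t (dehom (phi t)).
  move=> tK; rewrite /phi; case: xgetP => [_ _ //|nP]; exfalso.
  have [p pd fp] := fpoly t tK; have [P hP Pp] := dehom_surj pd.
  by apply: (nP P); rewrite /= Pp.
have cphi : compatible phi.
  move=> e t t' eK tK t'K et et'; have [->|tt'] := eqVneq t t'; first by rewrite subrr; exact: J_edge0.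
  have [ht ft] := phiP t tK; have [ht' ft'] := phiP t' t'K; have hB := rpredB ht ht'.
  have et_sub x : hull e x -> hull t x /\ hull t' x by move=> ex; split; exact: hullS ex.
  split.
    have [v [w [vw eE]]] := interior_edge_ends eK.
    apply/edge_idealP; have el := ell_form eK; rewrite eE in el.
    (* Smoothness across the edge makes the derivatives of the difference vanish up to order [r e]
       at every point of the edge, and [edge_dvd] turns this into divisibility. *)
    rewrite {1}eE; apply: (edge_dvd vw el hB) => x; rewrite -eE => ex.
    apply/(vertex_condition x (r e) hB); rewrite (raddfB (@dehom R)).
    have [U [g [oU AU fg gC]]] := fC e t t' eK tK t'K tt' et et'.
    have [tx t'x] := et_sub x ex; move=> m; move: x tx t'x {ex} m.
    apply: (class_C_vanish oU _ _ (triangle_closure_interior tK) (triangle_closure_interior t'K) _ _ gC).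
    - by move=> x tx; apply: AU; left.
    - by move=> x tx; apply: AU; right.
    - by move=> x tx; rewrite -fg ?ft//; left.
    - by move=> x tx; rewrite -fg ?ft'//; right.
  move=> v ve; apply/(vertex_condition v (s v) hB) => m ms.
  have vt : v \in t by exact: (fsubsetP et).
  have vt' : v \in t' by exact: (fsubsetP et').
  have vK : v \in vertices K by apply/vertexP => //; exists t => //; have [] := (faceP K t 2).1 tK.
  by rewrite (raddfB (@dehom R)) raddfB mevalB (fv v t t' vK tK t'K vt vt' _ _ ft ft' m ms) subrr.
exists phi; split => // [t /phiP[]//|].
apply/funext => x; have [cx|nx] := pselect (carrier K x); last by rewrite f0// /realize asboolF.
have [t tK tx] := (carrier_triangle KC KD x).1 cx.
by rewrite (realizeE cphi tK tx) -meval_dehom; have [_ ->] := phiP t tK.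
Qed.

End Complex.
End SplinesAsFamilies.

(** * Dimension count *)

Section Families.
Variables (R : realType) (A : choiceType) (I : {fset A}).

Lemma linear_lfun (aT rT : vectType R) (f : aT -> rT) : linear f ->
  {F : 'Hom(aT, rT) | forall u, F u = f u}.
Proof.
move=> fl; pose m := GRing.isLinear.Build R aT rT *:%R f fl.
pose fL : {linear aT -> rT} := HB.pack f m.
by exists (linfun fL) => u; rewrite lfunE.
Qed.

Definition extend (V : zmodType) (g : {ffun I -> V}) (a : A) : V :=
  if insub a is Some i then g i else 0.

Lemma extend_val (V : zmodType) (g : {ffun I -> V}) (i : I) : extend g (val i) = g i.
Proof. by rewrite /extend valK. Qed.

Lemma extend_linear (V : lmodType R) (a : A) : linear (fun g : {ffun I -> V} => extend g a).
Proof.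
move=> c g h; rewrite /extend; case: insubP => [i _ _|_]; first by rewrite !ffunE.
by rewrite scaler0 addr0.
Qed.

Lemma extend_finfun (V : zmodType) (phi : A -> V) a : a \in I ->
  extend [ffun i : I => phi (val i)] a = phi a.
Proof. by move=> aI; rewrite /extend insubT ffunE. Qed.

End Families.

Section HomogeneousParts.
Variables (R : realType) (d : nat).
Local Notation S := (mpoly 3 R).
Local Notation D := (dhomog 3 R d).

Lemma dim_dhomog3 : \dim (fullv : {vspace D}) = 'C(d + 2, 2).
Proof. by rewrite dimvf -[RHS]bin_sub ?leq_addl// addnK. Qed.

Lemma dhomog_homog (u : D) : mpoly_of_dhomog u \is ishomog1 d mdeg.
Proof. exact: valP u. Qed.

(** The degree part is moved to the finite-dimensional type of forms of degree [d], where
    rank-nullity is available. *)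
Lemma degree_part_vspace (I : set S) : I 0 ->
  (forall c p q, I p -> I q -> I (c *: p + q)) ->
  {U : {vspace D} | (forall u, u \in U <-> I (mpoly_of_dhomog u))
    & fdim (degree_part I d) = \dim U}.
Proof.
move=> I0 Ilin; have [|c u v|U UE] := @subspace_vspace R D [set u | I (mpoly_of_dhomog u)].
- exact: I0.
- exact: Ilin.
have UP u : u \in U <-> I (mpoly_of_dhomog u).
  by have /seteqP[h h'] := UE; split; [exact: h'|exact: h].
exists U => //; rewrite -(@fdim_image _ D _ (@mpoly_of_dhomog 3 R d)); last first.
  by move=> u _ u0; apply: val_inj.
congr fdim; apply/seteqP; split => p /=.
  by move=> [Ip hp]; exists (DHomog hp) => //; apply/UP.
by move=> [u /UP uI <-]; split => //; exact: dhomog_homog.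
Qed.

End HomogeneousParts.

Section DimensionCount.
Variable R : realType.
Local Notation plane := 'rV[R]_2.
Local Notation S := (mpoly 3 R).
Variables (K : {fset {fset plane}}) (KC : simplicial_complex K)
  (KD : homeomorphic (carrier K) (@unit_disk R)).
Variables (r : {fset plane} -> nat) (s : plane -> nat) (ell : {fset plane} -> S)
  (ell_form : forall e, e \in interior_edges K -> edge_form e (ell e)).

Lemma ideal_pow_linear (I : set S) k c p q :
  ideal_pow I k p -> ideal_pow I k q -> ideal_pow I k (c *: p + q).
Proof.
by move=> Ip Iq; apply: ideal_genD => //; rewrite -mul_mpolyC; exact: ideal_powMl.
Qed.

Lemma edge_ideal_linear e c p q :
  edge_ideal r ell e p -> edge_ideal r ell e q -> edge_ideal r ell e (c *: p + q).
Proof.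
move=> /edge_idealP[a ->] /edge_idealP[b ->]; apply/edge_idealP.
by exists (c *: a + b); rewrite mulrDr scalerAr.
Qed.

Lemma J_edge_linear e c p q :
  J_edge r s ell e p -> J_edge r s ell e q -> J_edge r s ell e (c *: p + q).
Proof.
move=> [p1 p2] [q1 q2]; split; first exact: edge_ideal_linear.
by move=> v ve; apply: ideal_pow_linear; [exact: p2|exact: q2].
Qed.

Lemma J_vertex0 v : J_vertex r s ell K v 0.
Proof.
exists (fun=> 0); split; last by rewrite big1.
move=> e _; split; last exact: ideal_gen0.
by apply/edge_idealP; exists 0; rewrite mulr0.
Qed.

Lemma J_vertex_linear v c p q :
  J_vertex r s ell K v p -> J_vertex r s ell K v q -> J_vertex r s ell K v (c *: p + q).
Proof.
move=> [a [aI ->]] [b [bI ->]]; exists (fun e => c *: a e + b e).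
split; last by rewrite scaler_sumr -big_split.
move=> e eK; have [a1 a2] := aI e eK; have [b1 b2] := bI e eK.
by split; [exact: edge_ideal_linear|exact: ideal_pow_linear].
Qed.

Lemma realize_linear c phi psi :
  realize K (fun t => c *: phi t + psi t) = c *: realize K phi + realize K psi.
Proof.
apply/funext => x; rewrite /realize !fctE; case: ifP => _; last by rewrite scaler0 addr0.
by rewrite mevalD mevalZ.
Qed.

Section Degree.
Import VectorInternalTheory.
Variable d : nat.
Local Notation D := (dhomog 3 R d).
Local Notation faces2 := (faces K 2).

Definition family (g : {ffun faces2 -> D}) (t : {fset plane}) : S :=
  mpoly_of_dhomog (extend g t).

Lemma family_linear c g h :
  family (c *: g + h) = fun t => c *: family g t + family h t.
Proof. by apply/funext => t; rewrite /family extend_linear. Qed.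

Lemma splines_vspace : exists2 U : {vspace {ffun faces2 -> D}},
  (forall g, g \in U <-> compatible K r s ell (family g))
  & fdim (splines K r s d) = \dim U.
Proof.
have [||U UE] := @subspace_vspace R {ffun faces2 -> D} [set g | compatible K r s ell (family g)].
- move=> e t t' _ _ _ _ _; rewrite /family.
  have z t0 : extend (0 : {ffun faces2 -> D}) t0 = 0.
    by rewrite /extend; case: insubP => // i _ _; rewrite ffunE.
  by rewrite !z subrr; exact: J_edge0.
- move=> c g h cg ch e t t' eK tK t'K et et'; rewrite family_linear opprD addrACA -scalerBr.
  by apply: J_edge_linear; [exact: cg|exact: ch].
have UP g : g \in U <-> compatible K r s ell (family g).
  by have /seteqP[h h'] := UE; split; [exact: h'|exact: h].
exists U => //.
have rl : linear (fun g => realize K (family g)).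
  by move=> c g h; rewrite family_linear realize_linear.
pose m := GRing.isLinear.Build R {ffun faces2 -> D} (plane -> R) *:%R _ rl.
pose F : {linear {ffun faces2 -> D} -> (plane -> R)} := HB.pack (fun g => realize K (family g)) m.
rewrite -(fdim_image (f := F)) => [|g /UP cg g0]; last first.
  apply/ffunP => t; rewrite ffunE; apply: val_inj; rewrite /= -(extend_val g).
  apply: (dehom_inj (dhomog_homog _)).
  apply: (triangle_represents_unique KC (f := realize K (family g)) (valP t)) => x tx.
    by rewrite meval_dehom (realizeE KC KD ell_form cg (valP t) tx).
  by rewrite meval0 -[LHS]/((F g) x) g0.
congr fdim; apply/seteqP; split => f /=.
  move=> /(spline_realize KC KD ell_form)[phi [cphi hphi ->]].
  pose g : {ffun faces2 -> D} := [ffun t => indhomog d (phi (val t))].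
  have gE t : t \in faces2 -> family g t = phi t.
    move=> tK; rewrite /family (@extend_finfun _ _ _ (fun t => indhomog d (phi t)))//.
    by rewrite /indhomog /insubd insubT//; exact: hphi.
  exists g; first by apply/UP => e t t' eK tK t'K et et'; rewrite !gE//; exact: cphi.
  apply/funext => x; have [cx|nx] := pselect (carrier K x); last by rewrite /realize asboolF.
  by rewrite /= /realize asboolT// gE//; have [] := triangle_atP KC KD cx.
by move=> [g /UP cg <-]; apply: (realize_spline KC KD ell_form) => // t _; exact: dhomog_homog.
Qed.

(** The signs are scalars, so the scalar statement applies to each coordinate in a basis. *)
Lemma cochain_exact_vector (V : vectType R) (g : {fset plane} -> V) :
  (forall v, v \in interior_vertices K ->
     \sum_(e <- interior_edges K | v \in e) vsign v e *: g e = 0) ->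
  exists phi : {fset plane} -> V, forall e, e \in interior_edges K ->
    \sum_(t <- faces K 2 | (e `<=` t)%fset) tsign t e *: phi t = g e.
Proof.
move=> dg; have /choice[phi phiP] : forall i : 'I_(dim V), exists phi : {fset plane} -> R,
    forall e, e \in interior_edges K ->
    \sum_(t <- faces K 2 | (e `<=` t)%fset) tsign t e * phi t = v2r (g e) 0 i.
  move=> i; apply: (cochain_exact KC KD) => v vK.
  have /(congr1 (fun u => v2r u 0 i)) := dg v vK.
  rewrite linear_sum linear0 summxE mxE => dvi; rewrite -[RHS]dvi.
  by apply: eq_bigr => e _; rewrite linearZ mxE.
exists (fun t => r2v (\row_i phi i t)) => e eK; apply: (can_inj v2rK).
apply/rowP => i; rewrite -phiP// linear_sum summxE; apply: eq_bigr => t _.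
by rewrite linearZ [LHS]mxE /= r2vK mxE.
Qed.

Definition coboundary (g : {ffun faces2 -> D}) : {ffun interior_edges K -> D} :=
  [ffun e => \sum_(t <- faces K 2 | (val e `<=` t)%fset) tsign t (val e) *: extend g t].

Definition edge_boundary (g : {ffun interior_edges K -> D}) : {ffun interior_vertices K -> D} :=
  [ffun v => \sum_(e <- interior_edges K | val v \in e) vsign (val v) e *: extend g e].

Lemma coboundary_linear : linear coboundary.
Proof.
move=> c g h; apply/ffunP => e; rewrite !ffunE scaler_sumr -big_split; apply: eq_bigr => t _.
by rewrite extend_linear scalerDr !scalerA mulrC.
Qed.

Lemma edge_boundary_linear : linear edge_boundary.
Proof.
move=> c g h; apply/ffunP => e; rewrite !ffunE scaler_sumr -big_split; apply: eq_bigr => t _.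
by rewrite extend_linear scalerDr !scalerA mulrC.
Qed.

Lemma coboundary_edge (g : {ffun faces2 -> D}) e : e \in interior_edges K ->
  exists t t' c, [/\ t \in faces K 2, t' \in faces K 2, (e `<=` t)%fset & (e `<=` t')%fset] /\
  [/\ c != 0, extend (coboundary g) e = c *: (extend g t - extend g t')
  & forall u, (u \in faces K 2) && (e `<=` u)%fset = (u == t) || (u == t')].
Proof.
move=> eK; have [v [w [vw eE]]] := interior_edge_ends eK.
subst e; have [u [u' [uK u'K Du Du' tE]]] := interior_edge_triangles KC vw eK.
exists [fset v; w; u]%fset, [fset v; w; u']%fset, (orient v w).
split; first by split => //; exact: fsubsetUl.
split => //; first by apply: contra_eq_neq (orient_sqr vw) => ->; rewrite mulr0 eq_sym oner_eq0.
rewrite -[[fset v; w]%fset]/(val [` eK]%fset) extend_val ffunE.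
exact: coboundaryE.
Qed.

(** Rank-nullity is applied twice, to the coboundary on compatible families and to the boundary on
    the product of the [J(e)_d]; the image of the first map is the kernel of the second. *)
Lemma fdim_splines : exists2 W : {vspace {ffun interior_vertices K -> D}},
  (fdim (splines K r s d) + \dim W =
     'C(d + 2, 2) + \sum_(e <- interior_edges K) fdim (degree_part (J_edge r s ell e) d))%N
  & forall h, h \in W <-> exists2 g : {ffun interior_edges K -> D},
      (forall e : interior_edges K, J_edge r s ell (val e) (mpoly_of_dhomog (g e)))
      & h = edge_boundary g.
Proof.
have [U UP ->] := splines_vspace.
have JE e := degree_part_vspace d (J_edge0 r s ell e) (@J_edge_linear e).
pose JU (e : interior_edges K) := s2val (JE (val e)).
have JUP e u : u \in JU e <-> J_edge r s ell (val e) (mpoly_of_dhomog u).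
  exact: (s2valP (JE (val e))).
have [W WP Wd] := prod_vspace JU.
have [delta deltaE] := linear_lfun coboundary_linear.
have [bd bdE] := linear_lfun edge_boundary_linear.
have WE g : g \in W <-> forall e, J_edge r s ell (val e) (mpoly_of_dhomog (g e)).
  rewrite WP; split=> [/forallP h e|h]; first exact/JUP.
  by apply/forallP => e; apply/JUP.
exists (bd @: W)%VS; last first.
  move=> h; split=> [/memv_imgP[g /WE gW ->]|[g /WE gW ->]]; first by exists g => //; rewrite bdE.
  by rewrite -bdE memv_img.
have dW : (\dim W = \sum_(e <- interior_edges K) fdim (degree_part (J_edge r s ell e) d))%N.
  rewrite Wd (big_seq_fsetE _ (interior_edges K) xpredT (fun e => fdim (degree_part (J_edge r s ell e) d))).
  by apply: eq_bigr => e _; rewrite -(s2valP' (JE (val e))).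
rewrite -dW -(limg_ker_dim bd W) -(limg_ker_dim delta U) addnA; congr (_ + _)%N.
congr (_ + _)%N.
  have [t0 t0K] : exists t0, t0 \in faces K 2.
    have [f [f' [_ _ _ h]]] := KD; have [|cx _] := h 0.
      by rewrite /unit_disk /= !mxE expr0n addr0 ler01.
    by have [t tK _] := (carrier_triangle KC KD _).1 cx; exists t.
  (* Evaluation at one triangle identifies the kernel of the coboundary with the space of all forms
     of degree [d]. *)
  have [ev evE] := linear_lfun (@extend_linear R _ faces2 D t0).
  have const g : g \in (U :&: lker delta)%VS -> forall t t', t \in faces2 -> t' \in faces2 -> extend g t = extend g t'.
    rewrite memv_cap memv_ker deltaE => /andP[_ /eqP g0] t t' tK t'K.
    apply: (triangles_connected KC KD _ tK t'K) => {tK t'K}t {}t' v w tK t'K vw vt wt vt' wt'.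
    have [->//|tt'] := eqVneq t t'.
    have eK := shared_edge_interior KC tK t'K tt' vw vt wt vt' wt'.
    have [u [u' [c [_ [c0 gc uE]]]]] := coboundary_edge g eK.
    move: gc; rewrite g0 -[[fset v; w]%fset]/(val [` eK]%fset) extend_val ffunE => /esym/eqP.
    rewrite scaler_eq0 (negPf c0) subr_eq0 => /eqP uu'.
    have := uE t; have := uE t'; rewrite tK t'K !fsubUset !fsub1set vt wt vt' wt' /=.
    by move=> /esym/orP[]/eqP -> /esym/orP[]/eqP ->.
  rewrite -(dim_dhomog3 R d) -(limg_dim_eq (f := ev)); last first.
    apply/eqP; rewrite -subv0; apply/subvP => g; rewrite memv_cap memv_ker evE => /andP[gU /eqP g0].
    rewrite memv0; apply/eqP/ffunP => t; rewrite ffunE -(extend_val g) -g0.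
    by apply: const => //; exact: valP.
  apply/eqP; rewrite eqn_leq dimvS ?subvf//= dimvS//; apply/subvP => u _.
  apply/memv_imgP; exists [ffun=> u]; last by rewrite evE (@extend_finfun _ _ _ (fun=> u)).
  rewrite memv_cap memv_ker deltaE; apply/andP; split.
    apply/UP => e t t' _ tK t'K _ _.
    by rewrite /family !(@extend_finfun _ _ _ (fun=> u))// subrr; exact: J_edge0.
  apply/eqP/ffunP => e; rewrite [RHS]ffunE -[LHS](extend_val _ e).
  have [t [t' [c [[tK t'K _ _] [_ -> _]]]]] := coboundary_edge [ffun=> u] (valP e).
  by rewrite !(@extend_finfun _ _ _ (fun=> u))// subrr scaler0.
congr (\dim _); apply/vspaceP => g; apply/idP/idP.
  move=> /memv_imgP[f /UP fU ->]; rewrite deltaE memv_cap memv_ker bdE; apply/andP; split.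
    apply/WE => e; rewrite -[coboundary f e]extend_val.
    have [t [t' [c [[tK t'K et et'] [_ -> _]]]]] := coboundary_edge f (valP e).
    by rewrite -[c *: _]addr0; apply: J_edge_linear; [exact: (fU (val e) t t' (valP e))|exact: J_edge0].
  apply/eqP/ffunP => v; rewrite !ffunE.
  rewrite -[RHS](boundary_coboundary KC (fun t => extend f t) (valP v)).
  rewrite big_seq_cond [RHS]big_seq_cond; apply: eq_bigr => e /andP[eK _].
  by rewrite -[e]/(val [` eK]%fset) extend_val ffunE.
rewrite memv_cap memv_ker bdE => /andP[/WE gW /eqP g0].
have [v vK|phi phiP] := @cochain_exact_vector D (extend g).
  by have /ffunP/(_ [` vK]%fset) := g0; rewrite !ffunE.
pose f : {ffun faces2 -> D} := [ffun t => phi (val t)].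
have fg : coboundary f = g.
  apply/ffunP => e; rewrite ffunE -[RHS]extend_val -phiP ?(valP e)//.
  rewrite big_seq_cond [RHS]big_seq_cond; apply: eq_bigr => t /andP[tK _].
  by rewrite (@extend_finfun _ _ _ phi).
apply/memv_imgP; exists f; last by rewrite deltaE fg.
apply/UP => e t t' eK tK t'K et et'.
have [u [u' [c [_ [c0 gE uE]]]]] := coboundary_edge f eK.
have Jc : J_edge r s ell e (mpoly_of_dhomog (extend f u - extend f u')).
  have -> : extend f u - extend f u' = c^-1 *: extend g e.
    by rewrite -fg gE scalerA mulVf// scale1r.
  rewrite -[c^-1 *: _]addr0; apply: J_edge_linear; last exact: J_edge0.
  by have := gW [` eK]%fset; rewrite -(extend_val g).
have := uE t; have := uE t'; rewrite tK t'K et et' /=.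
move=> /esym/orP[]/eqP -> /esym/orP[]/eqP ->; rewrite /family ?subrr; try exact: J_edge0.
  by rewrite -opprB -[- _]addr0 -scaleN1r; apply: J_edge_linear; [exact: Jc|exact: J_edge0].
exact: Jc.
Qed.

End Degree.
End DimensionCount.

(** * Surjectivity of the boundary map in large degree *)

Section Surjectivity.
Variable R : realType.
Local Notation plane := 'rV[R]_2.
Local Notation S := (mpoly 3 R).
Local Notation X i := (mpolyX R (mnm1 i)).
Local Notation ev3 P x := (meval (fun i => embed x 0 i) P).
Implicit Types (v w u x y : plane) (b e t : {fset plane}).

(** The zero vector is allowed, so a [P] that is not parallel to some vertex is nonzero. *)
Definition parallel (P : 'rV[R]_3) v : Prop := exists c, P = c *: embed v.

(** Two distinct planes through the line over [v] meet in that line only. *)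
Lemma two_edges_parallel (l l' : S) (P : 'rV[R]_3) v w u : area v w u != 0 ->
  edge_form [fset v; w]%fset l -> edge_form [fset v; u]%fset l' ->
  meval (fun i => P 0 i) l = 0 -> meval (fun i => P 0 i) l' = 0 -> parallel P v.
Proof.
move=> D el el' lP lP'; have /and3P[] := area_neq0_uniq D.
rewrite !inE negb_or => /andP[vw vu] _ _.
have D' : area v u w != 0 by rewrite area_rot area_swap oppr_eq0 -area_rot.
have := edge_form_cross u P vw el; rewrite lP mul0r => /esym/eqP.
rewrite mulf_eq0 (negPf (edge_form_neq0 vw el D)) /= => /eqP c1.
have := edge_form_cross w P vu el'; rewrite lP' mul0r => /esym/eqP.
rewrite mulf_eq0 (negPf (edge_form_neq0 vu el' D')) /= => /eqP c2.
set X0 := P 0 0 - P 0 last3 * v 0 0 in c1 c2; set X1 := P 0 1 - P 0 last3 * v 0 1 in c1 c2.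
have x0 : X0 = 0.
  apply/eqP; rewrite -(mulIr_eq0 _ (mulIf D)); apply/eqP.
  transitivity ((u 0 0 - v 0 0) * ((w 0 0 - v 0 0) * X1 - (w 0 1 - v 0 1) * X0) -
    (w 0 0 - v 0 0) * ((u 0 0 - v 0 0) * X1 - (u 0 1 - v 0 1) * X0)); first by rewrite /area; ring.
  by rewrite c1 c2 !mulr0 subrr.
have x1 : X1 = 0.
  apply/eqP; rewrite -(mulIr_eq0 _ (mulIf D)); apply/eqP.
  transitivity ((u 0 1 - v 0 1) * ((w 0 0 - v 0 0) * X1 - (w 0 1 - v 0 1) * X0) -
    (w 0 1 - v 0 1) * ((u 0 0 - v 0 0) * X1 - (u 0 1 - v 0 1) * X0)); first by rewrite /area; ring.
  by rewrite c1 c2 !mulr0 subrr.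
exists (P 0 last3); apply/rowP; apply: ord3P; rewrite mxE ?embed0 ?embed1 ?embed2 ?mulr1//.
  by apply/eqP; rewrite -subr_eq0 -/X0 x0.
by apply/eqP; rewrite -subr_eq0 -/X1 x1.
Qed.

Section Complex.
Variables (K : {fset {fset plane}}) (KC : simplicial_complex K).
Variables (r : {fset plane} -> nat) (s : plane -> nat) (ell : {fset plane} -> S)
  (ell_form : forall e, e \in interior_edges K -> edge_form e (ell e)).
Local Notation E := (interior_edges K).

(* If all vertices reached from [v] are interior, every neighbor of a reached vertex is
   reached too, except possibly the one vertex lying under [P]; but the leftmost and the
   rightmost reached vertices both have a neighbor further out. *)
Lemma escape v (P : 'rV[R]_3) (Q : plane -> Prop) :
  Q v -> ~ parallel P v ->
  (forall u w, Q u -> u \in interior_vertices K -> u != w -> [fset u; w]%fset \in E ->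
     meval (fun i => P 0 i) (ell [fset u; w]%fset) != 0 -> Q w) ->
  exists2 u, Q u & u \notin interior_vertices K.
Proof.
move=> Qv nPv Qstep; apply: contrapT => nesc.
have Qint u : Q u -> u \in interior_vertices K.
  by move=> Qu; apply/negPn/negP => nu; apply: nesc; exists u.
have Kedge u w z : [fset u; w; z]%fset \in faces K 2 ->
    [/\ [fset u; z]%fset \in K & [fset w; z]%fset \in K].
  move=> /(faceP K _ 2)[tK _]; split; apply: (face_sub KC tK);
    by [apply/fsubsetP => y; rewrite !inE => /orP[]->; rewrite ?orbT|apply/fset0Pn; eexists; exact: fset21].
have step u w : Q u -> ~ parallel P u -> u != w -> [fset u; w]%fset \in K ->
    Q w \/ parallel P w.
  move=> Qu nPu uw uwK; have eK := interior_vertex_edge KC (Qint u Qu) uw uwK.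
  have [e0|ne0] := eqVneq (meval (fun i => P 0 i) (ell [fset u; w]%fset)) 0; last first.
    by left; exact: (Qstep u w Qu (Qint u Qu) uw eK ne0).
  (* The form of the edge vanishes at [P], so the path goes around it through the third vertex [z]
     of a triangle on this edge. *)
  have [z [_ [tK _ D _ _]]] := interior_edge_triangles KC uw eK.
  have [uzK wzK] := Kedge _ _ _ tK; have Dn : area u w z != 0 by rewrite gt_eqF.
  have /and3P[] := area_neq0_uniq Dn; rewrite !inE => _ wz _.
  have uz : u != z by apply: contraTneq D => ->; rewrite area_vuv ltxx.
  have uzE := interior_vertex_edge KC (Qint u Qu) uz uzK.
  have [f0|nf0] := eqVneq (meval (fun i => P 0 i) (ell [fset u; z]%fset)) 0.
    by case: nPu; exact: (two_edges_parallel Dn (ell_form eK) (ell_form uzE)).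
  have Qz := Qstep _ _ Qu (Qint u Qu) uz uzE nf0.
  rewrite [[fset w; z]%fset]fsetUC in wzK; rewrite eq_sym in wz.
  have zwE := interior_vertex_edge KC (Qint z Qz) wz wzK.
  have [g0|ng0] := eqVneq (meval (fun i => P 0 i) (ell [fset z; w]%fset)) 0; last first.
    by left; exact: (Qstep z w Qz (Qint z Qz) wz zwE ng0).
  right; have D' : area w u z != 0 by rewrite area_swap oppr_eq0.
  move: (ell_form zwE) (ell_form eK) g0 e0; rewrite [[fset z; w]%fset]fsetUC [[fset u; w]%fset]fsetUC.
  by move=> h1 h2 h3 h4; exact: (two_edges_parallel D' h2 h1).
have vint := Qint v Qv.
have ext (sg : R) : sg != 0 -> exists p, parallel P p /\ 0 < sg * (p 0 0 - v 0 0).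
  move=> sg0; pose C (i : interior_vertices K) := `[< Q (val i) /\ ~ parallel P (val i) >].
  have Cv : C [` vint]%fset by apply/asboolP.
  case: (@Order.TotalTheory.arg_maxP _ _ _ [` vint]%fset C (fun i => sg * (val i) 0 0) Cv) => i /asboolP[Qi nPi] imax.
  have [w [wi wK sw]] := interior_vertex_neighbor KC (valP i) sg0.
  have sv : sg * v 0 0 <= sg * (val i) 0 0 by exact: (imax _ Cv).
  have [Pw|nPw] := pselect (parallel P w).
    by exists w; split => //; move: sw; rewrite !mulrBr !subr_gt0; exact: le_lt_trans.
  rewrite eq_sym in wi; have [Qw|//] := step _ _ Qi nPi wi wK.
  have := imax [` Qint w Qw]%fset; rewrite /C asboolT// => /(_ isT) /=.
  by move: sw; rewrite mulrBr subr_gt0 ltNge => /negP.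
have [p [Pp vp]] := ext 1 (oner_neq0 _).
have [p' [Pp' vp']] := ext (-1) (ltac:(by rewrite oppr_eq0 oner_neq0)).
(* [P] is a nonzero multiple of both [embed p] and [embed p'], so the two points agree, although one
   lies to the right of [v] and the other to the left. *)
suff pp' : p 0 0 = p' 0 0 by rewrite pp' in vp; lra.
have [[c Pc] [c' Pc']] := (Pp, Pp'); apply/eqP; apply: contraT => npp'.
have e2 : c = c' by have := congr1 (fun M : 'rV_3 => M 0 last3) (etrans (esym Pc) Pc'); rewrite [LHS]mxE [RHS]mxE !embed2 !mulr1.
have := congr1 (fun M : 'rV_3 => M 0 0) (etrans (esym Pc) Pc'); rewrite [LHS]mxE [RHS]mxE !embed0 -e2 => /eqP.
rewrite -subr_eq0 -mulrBr mulf_eq0 subr_eq0 (negPf npp') orbF => /eqP c0.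
by case: nPv; exists 0; rewrite Pc c0 !scale0r.
Qed.

(** Linear duality: a form outside the row space of the given ones is nonzero at some column of the
    cokernel matrix, and such a column is a common zero of the given forms. *)
Lemma span_or_point (T : {fset {fset plane}}) (a : 'rV[R]_3) :
  (forall e, e \in T -> edge_form e (ell e)) ->
  (exists c : {fset plane} -> R, lform a = \sum_(e <- T) c e *: ell e) \/
  exists P : 'rV[R]_3, (forall e, e \in T -> meval (fun i => P 0 i) (ell e) = 0) /\
    meval (fun i => P 0 i) (lform a) != 0.
Proof.
move=> Tform; have /choice[f fP] : forall i : T, exists f, ell (val i) = lform f.
  by move=> i; have [/homog1_lform] := Tform _ (valP i).
pose M := \matrix_(i < #|{: T}|) f (enum_val i).
have MP (i : T) : row (enum_rank i) M = f i by rewrite rowK enum_rankK.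
have [/submxP[D aE]|] := boolP (a <= M)%MS.
  left; exists (fun e => if insub e is Some i then D 0 (enum_rank i) else 0).
  rewrite (big_seq_fsetE _ T xpredT (fun e => (if insub e is Some i then D 0 (enum_rank i) else 0) *: ell e)) /=.
  under eq_bigr do rewrite valK fP -MP /lform scaler_sumr.
  rewrite exchange_big; apply: eq_bigr => i _ /=.
  rewrite aE mxE scaler_suml (reindex (@enum_rank _)) /=; last exact: onW_bij (@enum_rank_bij _).
  by apply: eq_bigr => e _; rewrite scalerA [row _ _ _ _]mxE.
rewrite submxE => /matrix0Pn[i [j ]]; rewrite ord1 => ne0; right.
exists (col j (cokermx M))^T; split=> [e eT|].
  rewrite (fP [` eT]%fset) meval_lform -MP.
  have /matrixP/(_ (enum_rank [` eT]%fset) j) := mulmx_coker M; rewrite !mxE => cM.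
  by rewrite -[RHS]cM; apply: eq_bigr => k _; rewrite !mxE.
rewrite meval_lform; move: ne0; rewrite mxE.
by under eq_bigr => k _ do [rewrite (_ : cokermx M k j = (col j (cokermx M))^T 0 k); last by rewrite !mxE].
Qed.

Lemma J_edgeM e a p : J_edge r s ell e p -> J_edge r s ell e (a * p).
Proof.
move=> [/edge_idealP[q ->] h]; split; first by apply/edge_idealP; exists (a * q); rewrite mulrCA.
by move=> v ve; apply: ideal_powMl; exact: h.
Qed.

Lemma J_edgeD e p q : J_edge r s ell e p -> J_edge r s ell e q -> J_edge r s ell e (p + q).
Proof. by move=> hp; rewrite -[p]scale1r; exact: J_edge_linear. Qed.

Lemma wout_last (m : multinom 3) : wout last3 m = (m 0%R + m 1%R)%N.
Proof.
rewrite /wout (bigD1 (0 : 'I_3))//= (bigD1 (1 : 'I_3))//= big1 ?addn0//.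
by apply: ord3P; rewrite ?eqxx ?andbF.
Qed.

Lemma wout_mid (m : multinom 3) : wout 1 m = (m 0%R + m last3)%N.
Proof.
rewrite /wout (bigD1 (0 : 'I_3))//= (bigD1 last3)//= big1 ?addn0//.
by apply: ord3P; rewrite ?eqxx ?andbF.
Qed.

Lemma J_edge_monomial v w N (m : multinom 3) : v != w -> N \in unitmx ->
  lsub N (ell [fset v; w]%fset) = X 0 ->
  (forall i, N i 1 = embed w 0 i) -> (forall i, N i last3 = embed v 0 i) ->
  (r [fset v; w]%fset < m 0%R)%N -> (s v < m 0%R + m 1%R)%N -> (s w < m 0%R + m last3)%N ->
  J_edge r s ell [fset v; w]%fset (lsub (invmx N) (mpolyX R m)).
Proof.
move=> vw Nu lN N1 N2 m0 mv mw.
have low (wt : multinom 3 -> nat) k : (k <= wt m)%N -> wlow wt k (mpolyX R m).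
  by move=> km m' m'k; rewrite mcoeffX; case: eqP => // mm'; move: m'k; rewrite -mm' ltnNge km.
split.
  apply/edge_idealP/(edge_ideal_wlow _ _ Nu lN); rewrite lsubVK//.
  exact: low.
move=> u; rewrite !inE => /orP[] /eqP ->.
  apply/(vertex_powP _ _ Nu N2); rewrite lsubVK//; apply: low.
  by rewrite wout_last.
apply/(vertex_powP _ _ Nu N1); rewrite lsubVK//; apply: low.
by rewrite wout_mid.
Qed.

(** An exponent exceeding [r e] and the [s v] of both ends, so that this power of the form lies in
    [J(e)] by itself. *)
Definition edge_order e : nat := (r e + \sum_(v <- e) s v).+1.

Lemma J_edge_power e : e \in E -> J_edge r s ell e (ell e ^+ edge_order e).
Proof.
move=> eE; have [v [w [vw ee]]] := interior_edge_ends eE.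
subst e; have [N Nu [lN N1 N2]] := edge_coordinates vw (ell_form eE).
have -> : ell [fset v; w]%fset ^+ edge_order [fset v; w]%fset =
    lsub (invmx N) (mpolyX R (mnm_muln (mnm1 0) (edge_order [fset v; w]%fset))).
  by rewrite -mpolyXn (rmorphXn (lsub (invmx N))) /= -lN lsubK.
by apply: J_edge_monomial => //; rewrite !mulmnE !mnm1E /= /edge_order big_fset2//; lia.
Qed.

(** No homogeneity is asked for: parts of degree [d] are taken at the very end. When [v] is not an
    interior vertex, [g] only has to be a cycle, so every [p] qualifies. *)
Definition transfers v (p : S) : Prop := exists2 g : {fset plane} -> S,
  (forall e, e \in E -> J_edge r s ell e (g e)) &
  forall u, u \in interior_vertices K ->
    \sum_(e <- E | u \in e) vsign u e *: g e = if u == v then p else 0.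

Lemma transfers0 v : transfers v 0.
Proof.
exists (fun=> 0) => [e _|u _]; first exact: J_edge0.
by rewrite if_same big1// => e _; rewrite scaler0.
Qed.

Lemma transfersM v a p : transfers v p -> transfers v (a * p).
Proof.
move=> [g gJ gp]; exists (fun e => a * g e) => [e /gJ|u /gp h]; first exact: J_edgeM.
under eq_bigr do rewrite scalerAr.
by rewrite -mulr_sumr h; case: ifP; rewrite ?mulr0.
Qed.

Lemma transfersD v p q : transfers v p -> transfers v q -> transfers v (p + q).
Proof.
move=> [g gJ gp] [h hJ hp]; exists (fun e => g e + h e) => [e eE|u uK].
  by apply: J_edgeD; [exact: gJ|exact: hJ].
under eq_bigr do rewrite scalerDr.
by rewrite big_split /= gp// hp//; case: ifP; rewrite ?addr0.
Qed.

Lemma transfers_sum v (I : eqType) (q : seq I) (F : I -> S) :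
  (forall i, i \in q -> transfers v (F i)) -> transfers v (\sum_(i <- q) F i).
Proof.
move=> h; rewrite big_seq; apply: big_ind => //; [exact: transfers0|exact: transfersD].
Qed.

Lemma transfers_boundary v p : v \notin interior_vertices K -> transfers v p.
Proof.
move=> nv; exists (fun=> 0) => [e _|u uK]; first exact: J_edge0.
rewrite ifF; first by rewrite big1// => e _; rewrite scaler0.
by apply: contraNF nv => /eqP <-.
Qed.

(** Up to orientation, [p] on the edge has boundary [p] at [v] and [- p] at [w]; adding a solution
    for [p] at [w] cancels the latter. *)
Lemma transfers_edge v w p : v != w -> [fset v; w]%fset \in E ->
  J_edge r s ell [fset v; w]%fset p -> transfers w p -> transfers v p.
Proof.
set f := [fset v; w]%fset; move=> vw fE Jp [g gJ gp].
exists (fun e => (if e == f then orient v w *: p else 0) + g e) => [e eE|u uK].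
  apply: J_edgeD; last exact: gJ.
  case: eqP => [->|_]; last exact: J_edge0.
  by rewrite -mul_mpolyC; exact: J_edgeM.
under eq_bigr do rewrite scalerDr.
rewrite big_split /= gp// big_mkcond.
rewrite (bigD1_seq f) ?fset_uniq//= eqxx big1 ?addr0; last first.
  by move=> e /negPf ->; rewrite scaler0 if_same.
rewrite !inE; have [->|uv] := eqVneq u v.
  by rewrite /= (negPf vw) vsignE// scalerA orient_sqr// scale1r addr0.
have [->|uw] := eqVneq u w; last by rewrite /= addr0.
rewrite /= /f fsetUC vsignE; last by rewrite eq_sym.
by rewrite scalerA orientC mulNr orient_sqr// scaleN1r addNr.
Qed.

Definition transfers_mod v (T : {fset {fset plane}}) (p : S) : Prop :=
  exists (b : S) (a : {fset plane} -> S), transfers v b /\ p = b + \sum_(e <- T) a e * ell e.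

Lemma transfers_modM v T c p : transfers_mod v T p -> transfers_mod v T (c * p).
Proof.
move=> [b [a [vb ->]]]; exists (c * b), (fun e => c * a e); split; first exact: transfersM.
by rewrite mulrDr mulr_sumr; congr (_ + _); apply: eq_bigr => e _; rewrite mulrA.
Qed.

Lemma transfers_modD v T p q :
  transfers_mod v T p -> transfers_mod v T q -> transfers_mod v T (p + q).
Proof.
move=> [b [a [vb ->]]] [b' [a' [vb' ->]]]; exists (b + b'), (fun e => a e + a' e).
split; first exact: transfersD.
by rewrite addrACA -big_split; congr (_ + _); apply: eq_bigr => e _; rewrite mulrDl.
Qed.

Lemma transfers_mod_base v T p : transfers v p -> transfers_mod v T p.
Proof.
move=> vp; exists p, (fun=> 0); split => //.
by rewrite big1 ?addr0// => e _; rewrite mul0r.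
Qed.

Lemma transfers_modU1 v T e p : e \notin T -> transfers_mod v (e |` T)%fset p ->
  exists q a, transfers_mod v T q /\ p = q + a * ell e.
Proof.
move=> eT [b [a [vb ->]]]; exists (b + \sum_(f <- T) a f * ell f), (a e).
split; first by exists b, a.
by rewrite big_fsetU1//= [a e * _ + _]addrC addrA.
Qed.

(** Modulo an ideal, [p] is a multiple of [l], hence [p ^+ n] is a multiple of [l ^+ n]. *)
Lemma transfers_mod_power v T l p n :
  (exists q a, transfers_mod v T q /\ p = q + a * l) ->
  exists q a, transfers_mod v T q /\ p ^+ n = q + a * l ^+ n.
Proof.
move=> [q [a [vq pE]]]; elim: n => [|n [q' [a' [vq' IH]]]].
  by exists 0, 1; split; [exact/transfers_mod_base/transfers0|rewrite !expr0 mulr1 add0r].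
exists (p * q' + a' * l ^+ n * q), (a' * a); split.
  by apply: transfers_modD; exact: transfers_modM.
by rewrite exprS IH mulrDr -addrA; congr (_ + _); rewrite {1}pE exprS; ring.
Qed.

Lemma power_transfers v (a : 'rV[R]_3) : ev3 (lform a) v = 0 ->
  exists n, transfers v (lform a ^+ n).
Proof.
move=> av; set x := lform a.
have main (T : {fset {fset plane}}) : (T `<=` E)%fset -> exists n, transfers_mod v T (x ^+ n).
  (* The induction runs on the number of interior edges outside [T]. *)
  have [k] := ubnP (#|` E| - #|` T|)%N; elim: k T => // k IH T ltk TE.
  have [|[c xE]|[P [PT Px]]] := @span_or_point T a.
  - by move=> e eT; apply: ell_form; exact: (fsubsetP TE).
  - exists 1%N, 0, (fun e => mpolyC 3 (c e)); split; first exact: transfers0.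
    by rewrite expr1 add0r /x xE; apply: eq_bigr => e _; rewrite mul_mpolyC.
  pose F (es : seq {fset plane}) := \prod_(e <- es) ell e ^+ edge_order e.
  pose good (es : seq {fset plane}) := forall e, e \in es -> e \in E /\ meval (fun i => P 0 i) (ell e) != 0.
  (* A vertex [u] counts as reached when the product [F es], over edges whose forms do not vanish at
     [P], lets transfers pass from [u] to [v]. *)
  have [|||u [es [esE es_move]] nu] := @escape v P (fun u => exists es, good es /\
      forall b : S, transfers u (b * F es) -> transfers v (b * F es)).
  - by exists [::].
  - move=> [c Pc]; move/eqP: Px; apply; rewrite Pc meval_lform.
    transitivity (c * \sum_i a 0 i * embed v 0 i); last by rewrite -meval_lform av mulr0.
    by rewrite mulr_sumr; apply: eq_bigr => i _; rewrite mxE mulrCA.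
  - move=> u w [es [esE es_move]] _ uw eE eP; exists ([fset u; w]%fset :: es); split.
      by move=> e; rewrite inE => /orP[/eqP ->|/esE].
    move=> b; rewrite /F big_cons mulrA -/(F es) => wb; apply: es_move.
    apply: (transfers_edge uw eE) => //.
    by rewrite mulrAC; apply: J_edgeM; exact: J_edge_power.
  have vF : transfers v (F es).
    by rewrite -[F es]mul1r; apply: es_move; exact: transfers_boundary.
  (* The factors of [F es] are gathered one at a time: the form of such an edge is nonzero at [P],
     so the edge is not in [T], and the induction hypothesis applies to [T] with this edge added. *)
  suff [n [q [c [vq xn]]]] : exists n q c, transfers_mod v T q /\ x ^+ n = q + c * F es.
    exists n; rewrite xn; apply: transfers_modD => //; apply: transfers_mod_base.
    exact: transfersM.
  elim: es esE {es_move vF} => [|e es IHes] esE.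
    exists 0%N, 0, 1; split; first exact/transfers_mod_base/transfers0.
    by rewrite expr0 /F big_nil mulr1 add0r.
  have [n [q [c [vq xn]]]] : exists n q c, transfers_mod v T q /\ x ^+ n = q + c * F es.
    by apply: IHes => f fes; apply: esE; rewrite inE fes orbT.
  have [eE eP] := esE e (mem_head _ _).
  have eT : e \notin T by apply: contra_neqN eP => /PT.
  have eTE : (e |` T `<=` E)%fset by rewrite fsubUset fsub1set eE.
  have [||n' /(transfers_modU1 eT)/(transfers_mod_power (edge_order e))[q' [c' [vq' xn']]]] :=
    IH (e |` T)%fset => //.
    by have := fsubset_leq_card eTE; rewrite cardfsU1 eT; move: ltk; lia.
  (* The product of the congruences for [x ^+ (n' * edge_order e)] and for [x ^+ n]. *)
  exists (n' * edge_order e + n)%N, (x ^+ n * q' + c' * ell e ^+ edge_order e * q), (c' * c).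
  split; first by apply: transfers_modD; exact: transfers_modM.
  rewrite exprD exprM xn' /F big_cons -/(F es) {2}xn; ring: xn.
have [n [b [c [vb xn]]]] := main fset0 (fsub0set _).
by exists n; rewrite xn big_seq_fset0 addr0.
Qed.


Lemma ideal_pow_pihomog v k d p : ideal_pow (vertex_ideal v) k p ->
  ideal_pow (vertex_ideal v) k (pihomog mdeg d p).
Proof.
have h := vertex_powP _ _ (vertex_mx_unit v) (vertex_mx_last v).
by move=> /h hp; apply/h; rewrite -pihomog_lsub; exact: wlow_pihomog.
Qed.

Lemma edge_ideal_pihomog e d p : e \in E -> edge_ideal r ell e p ->
  edge_ideal r ell e (pihomog mdeg d p).
Proof.
move=> eE; have [v [w [vw ee]]] := interior_edge_ends eE.
subst e; have [N Nu [lN _ _]] := edge_coordinates vw (ell_form eE).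
move=> /edge_idealP/(edge_ideal_wlow _ _ Nu lN) hp.
by apply/edge_idealP/(edge_ideal_wlow _ _ Nu lN); rewrite -pihomog_lsub; exact: wlow_pihomog.
Qed.

(* Only finitely many monomials in the coordinates of the edge are not divisible by a large
   power of a form vanishing at [v]; those lie in the ideal of the edge once their degree is
   large, hence can be moved to [w], where they are divisible by a large power of a form
   vanishing at [w]. *)
Lemma edge_transfers v w : v != w -> [fset v; w]%fset \in E ->
  exists d0, forall d p, (d0 <= d)%N -> p \is ishomog1 d mdeg ->
    edge_ideal r ell [fset v; w]%fset p -> ideal_pow (vertex_ideal v) (s v).+1 p ->
    transfers v p.
Proof.
move=> vw eE; have [N Nu [lN N1 N2]] := edge_coordinates vw (ell_form eE).
pose h i := lsub (invmx N) (X i).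
have hE i : h i = lform (row i (invmx N)) by rewrite /h lsubX.
have hv i j x : (forall k, N k j = embed x 0 k) -> i != j -> ev3 (h i) x = 0.
  move=> Nj ij; rewrite hE meval_lform.
  have /matrixP/(_ i j) := mulVmx Nu; rewrite !mxE (negPf ij) => h0; rewrite -[RHS]h0.
  by apply: eq_bigr => k _; rewrite Nj [row _ _ _ _]mxE.
have hpow x i : ev3 (h i) x = 0 -> exists n, transfers x (h i ^+ n).
  by rewrite hE; exact: power_transfers.
have [n0 t0] := hpow v 0 (hv 0 last3 v N2 isT).
have [n1 t1] := hpow v 1 (hv 1 last3 v N2 isT).
have [n2 t2] := hpow w last3 (hv last3 1 w N1 isT).
(* The first two coordinates vanish over [v], the last one over [w]. If the first two exponents are
   below [n0] and [n1], the last one exceeds both [n2] and [s w]. *)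
exists (n0 + n1 + n2 + (s w).+1)%N => d p d0d hp /edge_idealP/(edge_ideal_wlow _ _ Nu lN) pe.
move=> /(vertex_powP _ _ Nu N2) pv.
rewrite -(lsubK p Nu) [lsub N p]mpolyE (linear_sum (lsub (invmx N))).
apply: transfers_sum => m mp; rewrite linearZ /= -mul_mpolyC; apply: transfersM.
have md : mdeg m = d by move/dhomogP: (lsub_homog N hp) => /(_ _ mp).
have m3 : (m 0%R + m 1%R + m last3 = d)%N.
  by rewrite -md mdegE (bigD1 (0 : 'I_3))//= (bigD1 (1 : 'I_3))//= (bigD1 last3)//= big1 ?addn0 ?addnA//; apply: ord3P; rewrite ?eqxx ?andbF.
have mE : lsub (invmx N) (mpolyX R m) = h 0 ^+ m 0%R * h 1 ^+ m 1%R * h last3 ^+ m last3.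
  rewrite /lsub msubst_monom (bigD1 (0 : 'I_3))//= (bigD1 (1 : 'I_3))//= (bigD1 last3)//= big1 ?mulr1.
    by rewrite mulrA !hE.
  by apply: ord3P; rewrite ?eqxx ?andbF.
have pow x (i : 'I_3) n k a : (n <= k)%N -> transfers x (h i ^+ n) -> transfers x (a * h i ^+ k).
  by move=> nk tn; rewrite -(subnK nk) exprD mulrA; exact: transfersM.
have [le0|lt0] := leqP n0 (m 0%R).
  by rewrite mE -mulrA mulrC; exact: pow t0.
have [le1|lt1] := leqP n1 (m 1%R).
  by rewrite mE mulrAC; exact: pow t1.
apply: (transfers_edge vw eE); last by rewrite mE; apply: pow t2; lia.
apply: J_edge_monomial => //; last by lia.
  exact: (wlow_msupp pe mp).
by rewrite -wout_last; exact: (wlow_msupp pv mp).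
Qed.

Lemma in_fset_cond (A : choiceType) (F : {fset A}) (P : pred A) a :
  (a \in [fset x in F | P x]%fset) = (a \in F) && P a.
Proof. by rewrite !inE. Qed.

(** The maximum of the finitely many thresholds works for all elements. *)
Lemma uniform_bound (A : choiceType) (F : {fset A}) (P : A -> nat -> Prop) :
  (forall a, a \in F -> exists n, forall d, (n <= d)%N -> P a d) ->
  exists n, forall d, (n <= d)%N -> forall a, a \in F -> P a d.
Proof.
move=> h; have /choice[n nP] : forall i : F, exists n, forall d, (n <= d)%N -> P (val i) d.
  by move=> i; apply: h; exact: valP.
exists (\max_i n i)%N => d nd a aF; apply: (nP [` aF]%fset).
by apply: leq_trans nd; exact: (leq_bigmax [` aF]%fset).
Qed.

Lemma edge_boundary_onto : exists d0, forall d, (d0 <= d)%N -> forall h : plane -> S,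
  (forall v, v \in interior_vertices K -> J_vertex r s ell K v (h v) /\ h v \is ishomog1 d mdeg) ->
  exists2 g : {fset plane} -> S,
    forall e, e \in E -> J_edge r s ell e (g e) /\ g e \is ishomog1 d mdeg &
    forall v, v \in interior_vertices K -> \sum_(e <- E | v \in e) vsign v e *: g e = h v.
Proof.
pose P v e d := forall p, p \is ishomog1 d mdeg -> edge_ideal r ell e p ->
  ideal_pow (vertex_ideal v) (s v).+1 p -> transfers v p.
have [d0 d0P] : exists d0, forall d, (d0 <= d)%N -> forall v, v \in interior_vertices K ->
    forall e, e \in [fset e in E | v \in e]%fset -> P v e d.
  apply: uniform_bound => v vK; apply: uniform_bound => e; rewrite in_fset_cond => /andP[eE ve].
  have [w vw ee] := edge_ends (interior_edge_face eE) ve; subst e.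
  have [d0 h] := edge_transfers vw eE.
  by exists d0 => d dd p; exact: h.
exists d0 => d dd h hJ.
have tr v : v \in interior_vertices K -> transfers v (h v).
  move=> vK; have [[q [qJ hq]] hh] := hJ v vK.
  (* The summands of [h v] need not be homogeneous; their parts of degree [d] are, and they still
     lie in the ideals. *)
  rewrite -(pihomog_dE hh) hq linear_sum; apply: transfers_sum => e eF.
  have [q1 q2] := qJ e eF; have := eF; rewrite in_fset_cond => /andP[eE _].
  apply: (d0P d dd v vK e eF); first exact: pihomogP.
    exact: edge_ideal_pihomog.
  exact: ideal_pow_pihomog.
have /choice[G GP] : forall v : interior_vertices K, exists g : {fset plane} -> S,
    (forall e, e \in E -> J_edge r s ell e (g e)) /\
    forall u, u \in interior_vertices K ->
      \sum_(e <- E | u \in e) vsign u e *: g e = if u == val v then h (val v) else 0.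
  by move=> v; have [g g1 g2] := tr _ (valP v); exists g.
(* Transfers forget degrees; keeping only the part of degree [d] does not change the boundary, since
   [h] is homogeneous of degree [d]. *)
exists (fun e => pihomog mdeg d (\sum_v G v e)) => [e eE|u uK].
  split; last exact: pihomogP.
  have [j1 j2] : J_edge r s ell e (\sum_v G v e).
    apply: big_ind => [|p q|v _]; [exact: J_edge0|exact: J_edgeD|].
    by have [g1 _] := GP v; exact: g1.
  by split; [exact: edge_ideal_pihomog|move=> v ve; apply: ideal_pow_pihomog; exact: j2].
have [_ hh] := hJ u uK; rewrite -[RHS](pihomog_dE hh).
under eq_bigr do rewrite -linearZ scaler_sumr.
rewrite -linear_sum exchange_big /=; congr pihomog.
have [_ gu] := GP [` uK]%fset.
rewrite (bigD1 [` uK]%fset)//= gu//= eqxx big1 ?addr0// => v vu.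
have [_ ->//] := GP v; case: eqP => // uv; case/negP: vu; apply/eqP.
by apply: val_inj.
Qed.

End Complex.
End Surjectivity.

(** * The dimension of the space of splines *)

Lemma edge_boundary_J (R : realType) (K : {fset {fset 'rV[R]_2}})
    (r : {fset 'rV[R]_2} -> nat) (s : 'rV[R]_2 -> nat) (ell : {fset 'rV[R]_2} -> mpoly 3 R) d
    (g : {ffun interior_edges K -> dhomog 3 R d}) (v : interior_vertices K) :
  (forall e, J_edge r s ell (val e) (mpoly_of_dhomog (g e))) ->
  J_vertex r s ell K (val v) (mpoly_of_dhomog (edge_boundary g v)).
Proof.
move=> gJ; exists (fun e => mpoly_of_dhomog (vsign (val v) e *: extend g e)); split.
  move=> e; rewrite in_fset_cond => /andP[eE ve].
  have Je : J_edge r s ell e (mpoly_of_dhomog (vsign (val v) e *: extend g e)).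
    rewrite -[_ *: _]addr0; apply: J_edge_linear; last exact: J_edge0.
    by have := gJ [` eE]%fset; rewrite -(extend_val g).
  by have [e1 e2] := Je; split => //; exact: e2.
by rewrite ffunE (linear_sum (@mpoly_of_dhomog 3 R d)) sum_fset_cond.
Qed.

Theorem theorem5p4 (R : realType) (K : {fset {fset 'rV[R]_2}})
    (r : {fset 'rV[R]_2} -> nat) (s : 'rV[R]_2 -> nat)
    (ell : {fset 'rV[R]_2} -> mpoly 3 R)
    (K_complex : simplicial_complex K)
    (K_disk : homeomorphic (carrier K) (@unit_disk R))
    (ell_form : forall e : {fset 'rV[R]_2}, e \in interior_edges K -> edge_form e (ell e)) :
  let bound (d : nat) : int :=
    'C(d + 2, 2)%:Z
    + \sum_(e <- interior_edges K) (fdim (degree_part (J_edge r s ell e) d))%:Z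
    - \sum_(v <- interior_vertices K)
        (fdim (degree_part (J_vertex r s ell K v) d))%:Z in
  (forall d : nat, bound d <= (fdim (splines K r s d))%:Z) /\
  (exists d0 : nat, forall d : nat, (d0 <= d)%N ->
     (fdim (splines K r s d))%:Z = bound d).
Proof.
move=> bound; have KC := K_complex; have KD := K_disk.
pose b d := ('C(d + 2, 2) + \sum_(e <- interior_edges K) fdim (degree_part (J_edge r s ell e) d))%N.
pose c d := (\sum_(v <- interior_vertices K) fdim (degree_part (J_vertex r s ell K v) d))%N.
have boundE d : bound d = (b d)%:Z - (c d)%:Z.
  by rewrite /bound /b /c PoszD !(big_morph Posz PoszD erefl).
have JV d v := degree_part_vspace d (J_vertex0 K r s ell v) (@J_vertex_linear _ K r s ell v).
pose U d (v : interior_vertices K) := s2val (JV d (val v)).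
have UP d v u : u \in U d v <-> J_vertex r s ell K (val v) (mpoly_of_dhomog u).
  exact: (s2valP (JV d (val v))).
have Ud d : (\sum_v \dim (U d v) = c d)%N.
  rewrite /c (big_seq_fsetE _ (interior_vertices K) xpredT
    (fun v => fdim (degree_part (J_vertex r s ell K v) d))).
  by apply: eq_bigr => v _; rewrite (s2valP' (JV d (val v))).
(* The image [W] of the boundary map lies in the product of the spaces [J(v)_d], whence the
   inequality; it fills the product as soon as the map is onto. *)
have count d : exists2 W : {vspace {ffun interior_vertices K -> dhomog 3 R d}},
    (fdim (splines K r s d) + \dim W = b d)%N &
    (\dim W <= c d)%N /\ ((forall h : {ffun interior_vertices K -> dhomog 3 R d},
       (forall v, J_vertex r s ell K (val v) (mpoly_of_dhomog (h v))) ->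
       exists2 g : {ffun interior_edges K -> dhomog 3 R d},
         (forall e, J_edge r s ell (val e) (mpoly_of_dhomog (g e))) & h = edge_boundary g) ->
     \dim W = c d).
  have [W Wd WP] := fdim_splines KC KD r s ell_form d; exists W => //.
  have [V VP Vd] := prod_vspace (U d); rewrite -Ud -Vd.
  have WV : (W <= V)%VS.
    apply/subvP => h /WP[g gJ ->]; rewrite VP; apply/forallP => v; apply/UP.
    exact: edge_boundary_J.
  split; first exact: dimvS.
  move=> hW; apply/eqP; rewrite eqn_leq !dimvS//; apply/subvP => h.
  by rewrite VP => /forallP hV; apply/WP/hW => v; apply/UP.
split=> [d|].
  have [W Wd [Wc _]] := count d; rewrite boundE; lia.
have [d0 onto] := edge_boundary_onto KC r s ell_form.
exists d0 => d /onto {}onto; have [W Wd [_ Wc]] := count d.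
suff dW : \dim W = c d by rewrite boundE; lia.
apply: Wc => h hJ; have [v vK|g gJ gh] := onto (fun v => mpoly_of_dhomog (extend h v)).
  split; last exact: dhomog_homog.
  by have := hJ [` vK]%fset; rewrite -(extend_val h).
pose g' : {ffun interior_edges K -> dhomog 3 R d} := [ffun e => indhomog d (g (val e))].
have gE e : e \in interior_edges K -> mpoly_of_dhomog (extend g' e) = g e.
  move=> eE; rewrite (@extend_finfun _ _ _ (fun e => indhomog d (g e)))//.
  by rewrite /indhomog /insubd insubT//; have [] := gJ e eE.
exists g' => [e|].
  by rewrite -(extend_val g') gE ?(valP e)//; have [] := gJ _ (valP e).
apply/ffunP => v; apply: val_inj; rewrite /= ffunE (linear_sum (@mpoly_of_dhomog 3 R d)).
rewrite -[h v]extend_val -(gh _ (valP v)) big_seq_cond [RHS]big_seq_cond.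
by apply: eq_bigr => e /andP[eE _]; rewrite linearZ /= gE.
Qed.
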